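(* Let $p_1\equiv p_2\equiv1\pmod4$ be primes such that at least two of $\left(\frac{p_1}{p_2}\right),\left(\frac{2}{p_1}\right),\left(\frac{2}{p_2}\right)$ equal $-1$ (equivalently, the 2-class group $\mathbf{C}_{k,2}$ of $k=\mathbb{Q}(\sqrt{2p_1p_2},i)$ is of type $(2,2,2)$). Let $\mathbb{K}_1=k(\sqrt{p_1})$ and $\mathbb{K}_2=k(\sqrt{p_2})$. Then exactly four classes of $k$ capitulate in each of $\mathbb{K}_1$ and $\mathbb{K}_2$, and $\ker J_{\mathbb{K}_1}=\langle[\mathcal{H}_1],[\mathcal{H}_2]\rangle$, $\ker J_{\mathbb{K}_2}=\langle[\mathcal{H}_0\mathcal{H}_1],[\mathcal{H}_0\mathcal{H}_2]\rangle$.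
   Context: $i=\sqrt{-1}$; $\left(\frac{\cdot}{\cdot}\right)$ is the Legendre symbol. Write $p_1=e^2+4f^2$, $p_2=g^2+4h^2$ with integers $e,f,g,h$, and $\pi_1=e+2if$, $\pi_2=e-2if$, $\pi_3=g+2ih$, $\pi_4=g-2ih$. For $j=1,\dots,4$, $\mathcal{H}_j$ is the prime ideal of $k$ above $\pi_j$ ($\mathcal{H}_j^2=\pi_j\mathcal{O}_k$), and $\mathcal{H}_0$ the prime of $k$ above $1+i$ ($\mathcal{H}_0^2=(1+i)\mathcal{O}_k$). $J_L:\mathbf{C}_k\to\mathbf{C}_L$ is the map on ideal class groups induced by extension of ideals. *)

(* Defs.v *)
From mathcomp Require Import all_boot all_order all_algebra all_field.
Set Implicit Arguments. Unset Strict Implicit. Unset Printing Implicit Defensive.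
Import Order.TTheory GRing.Theory Num.Theory.
Local Open Scope ring_scope.

(* Number fields are modelled as subfields of algC (algebraic complex numbers). *)

Definition is_subfield (F : algC -> Prop) : Prop :=
  [/\ F 0, F 1,
      (forall x y, F x -> F y -> F (x + y)),
      (forall x, F x -> F (- x)) &
      [/\ (forall x y, F x -> F y -> F (x * y)) &
      (forall x, F x -> F x^-1)]].

Definition genfield (S : seq algC) (x : algC) : Prop :=
  forall F, is_subfield F -> (forall s, s \in S -> F s) -> F x.

Definition ringint (F : algC -> Prop) (x : algC) : Prop := F x /\ x \in Aint.

Definition is_ideal (F : algC -> Prop) (I : algC -> Prop) : Prop :=
  [/\ (forall x, I x -> ringint F x), I 0,
      (forall x y, I x -> I y -> I (x + y)) &
      (forall r x, ringint F r -> I x -> I (r * x))].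

Definition nonzero_ideal (F I : algC -> Prop) : Prop :=
  is_ideal F I /\ exists x, I x /\ x != 0.

Definition prime_ideal (F I : algC -> Prop) : Prop :=
  [/\ nonzero_ideal F I, ~ I 1 &
      (forall a b, ringint F a -> ringint F b -> I (a * b) -> I a \/ I b)].

Definition ideal_gen (F G : algC -> Prop) (x : algC) : Prop :=
  forall J, is_ideal F J -> (forall g, G g -> J g) -> J x.

Definition pideal (F : algC -> Prop) (a : algC) : algC -> Prop :=
  ideal_gen F (fun z => z = a).

Definition ideal_mul (F I J : algC -> Prop) : algC -> Prop :=
  ideal_gen F (fun z => exists x y, [/\ I x, J y & z = x * y]).

Fixpoint ideal_pow (F I : algC -> Prop) (n : nat) : algC -> Prop :=
  match n with
  | 0 => ringint F
  | n'.+1 => ideal_mul F I (ideal_pow F I n')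
  end.

Definition ideal_eq (I J : algC -> Prop) : Prop := forall x, I x <-> J x.

Definition is_principal (F I : algC -> Prop) : Prop :=
  exists a, ringint F a /\ ideal_eq I (pideal F a).

Definition same_class (F I J : algC -> Prop) : Prop :=
  exists a b, [/\ ringint F a, ringint F b, a != 0, b != 0 &
    ideal_eq (ideal_mul F (pideal F a) I) (ideal_mul F (pideal F b) J)].

Definition ideal_ext (L I : algC -> Prop) : algC -> Prop := ideal_gen L I.

Definition capitulates (L I : algC -> Prop) : Prop :=
  is_principal L (ideal_ext L I).

Definition legendre (a p : nat) : int :=
  if (p %| a)%N then 0
  else if [exists x : 'I_p, ((x * x) %% p == a %% p)%N] then 1 else -1.

(* Main.v *)
Require Import Defs.
From mathcomp Require Import all_boot all_order all_algebra all_field.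
From mathcomp Require Import all_solvable realalg.
From mathcomp Require Import ring lra zify.
From Stdlib Require Import FunctionalExtensionality PropExtensionality Classical.
Import Order.TTheory GRing.Theory Num.Theory.
Local Open Scope ring_scope.
Set Implicit Arguments. Unset Strict Implicit. Unset Printing Implicit Defensive.

(* Let [I] be an ideal of [k = Q(i, sqrt d)], [d = 2 p1 p2], capitulating in [K = k(sqrt p)].  If [I]
   extends to [(a)], then [I^2] is generated by the norm of [a], so only classes of order at most 2
   matter.  As [Z[i]] is principal and [i] times a square of [Z[i]] is never a norm from [k] (a
   condition on quadratic symbols), Hilbert 90 shows that these classes are generated by the ramified
   primes [H0], ..., [H4].
   If [e = x + y sqrt m] is a unit of norm -1, then [(1 + i e)^2 = i (1 + i)^2 e (x - i)], and [x - i]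
   is, up to units and squares, a product of Gaussian primes above the divisors of [m].  Such units
   exist for [m = p1], [p2] and [d], by descent on Pell's equation.  For [m = p1] this makes [H1] and
   [H2] principal in [K1], for [m = p2] it makes [H3] and [H4] principal in [K2], and for [m = d] it
   gives a relation in [k] which, with [(sqrt d) = H0^2 H1 H2 H3 H4], turns [<H3, H4>] into
   [<H0 H1, H0 H2>].
   Conversely [H1], [H2], [H1 H2] and their analogues are not principal, because norms from [k] are
   squares modulo the ramified Gaussian primes.  Finally [H0] does not capitulate: a square root in
   [K] of a unit times [1 + i] could be made real, and then 2 would ramify in [Q(sqrt p)]. *)

(** * Subfields and ideals *)

(** The number four comes from a squeeze. The five ramified primes satisfy two relations, so a
    capitulating class is one of the eight products of [H0], [H1], [H2] with exponents 0 or 1.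
    Taking [H0 H1] and [H0 H2] in place of [H1] and [H2] gives the same eight classes, so both
    kernels have the same shape: two known elements inside and [H0] outside leave the four products
    of the known ones, and nonprincipality keeps these apart. The condition on the symbols enters
    three times: it excludes [i] times a square as a norm, it eliminates all but one outcome of the
    descent for [x^2 + 1 = d y^2], and it contradicts the congruences that a principal ramified
    ideal would impose. Its substitutes are the inversion [I * tau I = (n)], cancellation of
    principal ideals, and the fact that an ideal of [k] is determined by its square. Units of [K]
    are not computed either: only integers of absolute value 1 matter, and they are roots of unity
    on which automorphisms chosen to fix all 48th roots of unity act trivially. *)

Section Subfield.
Variable F : algC -> Prop.
Hypothesis sF : is_subfield F.

Lemma sf0 : F 0. Proof. by case: sF. Qed.
Lemma sf1 : F 1. Proof. by case: sF. Qed.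
Lemma sfD x y : F x -> F y -> F (x + y). Proof. by case: sF => _ _ h _ _; exact: h. Qed.
Lemma sfN x : F x -> F (- x). Proof. by case: sF => _ _ _ h _; exact: h. Qed.
Lemma sfB x y : F x -> F y -> F (x - y). Proof. by move=> hx /sfN; exact: sfD. Qed.
Lemma sfM x y : F x -> F y -> F (x * y).
Proof. by case: sF => _ _ _ _ [h _]; exact: h. Qed.
Lemma sfV x : F x -> F x^-1. Proof. by case: sF => _ _ _ _ [_ h]; exact: h. Qed.
Lemma sf_div x y : F x -> F y -> F (x / y). Proof. by move=> hx /sfV; exact: sfM. Qed.
Lemma sfX x n : F x -> F (x ^+ n).
Proof. by move=> hx; elim: n => [|n ih]; rewrite ?exprS; [exact: sf1 | exact: sfM]. Qed.
Lemma sf_nat n : F n%:R.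
Proof. by elim: n => [|n ih]; [exact: sf0 | rewrite mulrS; exact: sfD sf1 ih]. Qed.
Lemma sf_int n : F n%:~R.
Proof.
case: n => n; first exact: sf_nat.
by rewrite NegzE rmorphN; apply: sfN; exact: sf_nat.
Qed.
Lemma sf_rat x : x \in Crat -> F x.
Proof.
case/CratP=> a ->; rewrite -[a]divq_num_den fmorph_div /= !ratr_int.
by apply: sf_div; exact: sf_int.
Qed.

Lemma riD x y : ringint F x -> ringint F y -> ringint F (x + y).
Proof. by move=> [? ?] [? ?]; split; [exact: sfD | exact: rpredD]. Qed.
Lemma riN x : ringint F x -> ringint F (- x).
Proof. by move=> [? ?]; split; [exact: sfN | rewrite rpredN]. Qed.
Lemma riB x y : ringint F x -> ringint F y -> ringint F (x - y).
Proof. by move=> ? /riN; exact: riD. Qed.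
Lemma riM x y : ringint F x -> ringint F y -> ringint F (x * y).
Proof. by move=> [? ?] [? ?]; split; [exact: sfM | exact: rpredM]. Qed.
Lemma ri_int n : ringint F n%:~R.
Proof. by split; [exact: sf_int | exact: Aint_int]. Qed.
Lemma ri_nat n : ringint F n%:R.
Proof. exact: (ri_int n). Qed.
Lemma ri0 : ringint F 0. Proof. exact: (ri_int 0). Qed.
Lemma ri1 : ringint F 1. Proof. exact: (ri_int 1). Qed.
End Subfield.

Lemma genfield_subfield S : is_subfield (genfield S).
Proof.
split=> [|| x y hx hy | x hx | ]; last split=> [x y hx hy | x hx];
  move=> F sF hF.
- exact: sf0.
- exact: sf1.
- by apply: sfD => //; [exact: hx | exact: hy].
- by apply: sfN => //; exact: hx.
- by apply: sfM => //; [exact: hx | exact: hy].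
- by apply: sfV => //; exact: hx.
Qed.

Lemma mem_genfield S s : s \in S -> genfield S s.
Proof. by move=> hs F _; exact. Qed.

Lemma genfield_sub S F x : is_subfield F -> (forall s, s \in S -> F s) ->
  genfield S x -> F x.
Proof. by move=> sF hF; exact. Qed.

Lemma Crat_subfield : is_subfield (fun x => x \in Crat).
Proof.
split=> [|| x y ? ? | x ? | ]; last split=> [x y ? ? | x ?];
  [exact: rpred0 | exact: rpred1 | exact: rpredD | by rewrite rpredN |
   exact: rpredM | by rewrite rpredV].
Qed.

(** Reduces an identity between two automorphisms on a generated field to a check on the
    generators. *)
Lemma eq_subfield (u v : {rmorphism algC -> algC}) : is_subfield (fun x => u x = v x).
Proof.
split=> [|| x y hx hy | x hx | ]; last split=> [x y hx hy | x hx].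
- by rewrite !rmorph0.
- by rewrite !rmorph1.
- by rewrite !rmorphD hx hy.
- by rewrite !rmorphN hx.
- by rewrite !rmorphM hx hy.
- by rewrite !fmorphV hx.
Qed.

Definition quad (F : algC -> Prop) (s x : algC) : Prop :=
  exists a b, [/\ F a, F b & x = a + b * s].

Section Quad.
Variables (F : algC -> Prop) (s : algC).
Hypotheses (sF : is_subfield F) (Fs2 : F (s ^+ 2)).

Lemma quad_sub x : F x -> quad F s x.
Proof. by move=> hx; exists x, 0; split=> //; [exact: sf0 | rewrite mul0r addr0]. Qed.

Lemma quad_gen : quad F s s.
Proof. by exists 0, 1; split; [exact: sf0 | exact: sf1 | rewrite add0r mul1r]. Qed.

Lemma quad_subfield : is_subfield (quad F s).
Proof.
split=> [|| x y hx hy | x hx | ]; last split=> [x y hx hy | x hx].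
- exact: quad_sub (sf0 sF).
- exact: quad_sub (sf1 sF).
- case: hx hy => a [b [ha hb ->]] [c [e [hc he ->]]]; exists (a + c), (b + e).
  by split; [exact: sfD | exact: sfD | ring].
- case: hx => a [b [ha hb ->]]; exists (- a), (- b).
  by split; [exact: sfN | exact: sfN | ring].
- case: hx hy => a [b [ha hb ->]] [c [e [hc he ->]]].
  exists (a * c + b * e * s ^+ 2), (a * e + b * c).
  split; last by ring.
    by apply: (sfD sF); [exact: sfM | apply: (sfM sF) => //; exact: sfM].
  by apply: (sfD sF); apply: (sfM sF).
- case: hx => a [b [ha hb ->]].
  have [->|nz] := eqVneq (a + b * s) 0.
    by rewrite invr0; exact: quad_sub (sf0 sF).
  (* If [s] lies in [F], the conjugate of a nonzero element can vanish and rationalizing the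
     denominator fails; the element is then [a + a], already in [F]. *)
  have [e0|nz'] := eqVneq (a - b * s) 0.
    apply: quad_sub; apply: (sfV sF).
    have -> : a + b * s = a + a by move/eqP: e0; rewrite subr_eq0 => /eqP <-.
    exact: sfD.
  pose n := a ^+ 2 - b ^+ 2 * s ^+ 2.
  have Fn : F n by apply: (sfB sF); [exact: sfX | apply: (sfM sF) => //; exact: sfX].
  have nE : n = (a + b * s) * (a - b * s) by rewrite /n; ring.
  have n0 : n != 0 by rewrite nE mulf_neq0.
  exists (a / n), (- b / n); split; first exact: sf_div.
    by apply: sf_div => //; exact: sfN.
  by apply: (mulfI nz); rewrite mulfV // -[LHS](mulfV n0) {1}nE; ring.
Qed.

Lemma quad_min G x : is_subfield G -> (forall y, F y -> G y) -> G s -> quad F s x -> G x.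
Proof.
by move=> sG sub hs [a [b [/sub ha /sub hb ->]]]; apply: (sfD sG) => //; exact: sfM.
Qed.

Variable u : {rmorphism algC -> algC}.
Hypotheses (uF : forall x, F x -> u x = x) (us : u s = - s) (s0 : s != 0).

Lemma quad_fixed x : quad F s x -> u x = x -> F x.
Proof.
case=> a [b [ha hb ->]]; rewrite rmorphD rmorphM us (uF ha) (uF hb) => h.
suff -> : b = 0 by rewrite mul0r addr0.
have : (b * s) *+ 2 = 0.
  by transitivity ((a + b * s) - (a + b * - s)); [ring | rewrite h subrr].
by move/eqP; rewrite mulrn_eq0 mulf_eq0 (negPf s0) orbF /= => /eqP.
Qed.

Lemma quad_stable x : quad F s x -> quad F s (u x).
Proof.
case=> a [b [ha hb ->]]; exists a, (- b); split; [by [] | exact: sfN |].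
by rewrite rmorphD rmorphM us !uF //; ring.
Qed.
End Quad.

Definition Qi : algC -> Prop := quad (fun x => x \in Crat) 'i.

Lemma Qi_subfield : is_subfield Qi.
Proof.
by apply: quad_subfield; [exact: Crat_subfield | rewrite sqrCi rpredN rpred1].
Qed.

Lemma Qi_i : Qi 'i.
Proof. exact: (quad_gen 'i Crat_subfield). Qed.

Lemma Qi_fix (u : {rmorphism algC -> algC}) x : u 'i = 'i -> Qi x -> u x = x.
Proof. by move=> ui [a [b [ha hb ->]]]; rewrite rmorphD rmorphM ui !aut_Crat. Qed.

(** Ideals are predicates; extensionality turns equality of sets into Leibniz equality, so that
    ideal identities can be used for rewriting. *)
Lemma ideal_ext_eq I J : ideal_eq I J -> I = J.
Proof. by move=> h; apply: functional_extensionality => x; apply: propositional_extensionality. Qed.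

Section Ideals.
Variable F : algC -> Prop.
Hypothesis sF : is_subfield F.
Local Notation O := (ringint F).
Local Notation ideal := (is_ideal F).
Local Infix "**" := (ideal_mul F) (at level 40, left associativity).
Local Notation P := (pideal F).
Implicit Types (I J K M : algC -> Prop) (a b c x y z : algC).

Lemma idO I x : ideal I -> I x -> O x. Proof. by case=> h _ _ _; exact: h. Qed.
Lemma id0 I : ideal I -> I 0. Proof. by case. Qed.
Lemma idD I x y : ideal I -> I x -> I y -> I (x + y). Proof. by case=> _ _ h _; exact: h. Qed.
Lemma idMl I r x : ideal I -> O r -> I x -> I (r * x). Proof. by case=> _ _ _ h; exact: h. Qed.
Lemma idMr I r x : ideal I -> O r -> I x -> I (x * r). Proof. by rewrite mulrC; exact: idMl. Qed.
Lemma idN I x : ideal I -> I x -> I (- x).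
Proof. by move=> hI hx; rewrite -mulN1r; apply: idMl => //; exact: riN (ri1 sF). Qed.
Lemma idB I x y : ideal I -> I x -> I y -> I (x - y).
Proof. by move=> hI hx /(idN hI); exact: idD. Qed.

Lemma ideal_O : ideal O.
Proof.
by split=> // [|x y|r x]; [exact: ri0 | exact: riD | exact: riM].
Qed.

Lemma ideal_gen_ideal G : (forall x, G x -> O x) -> ideal (ideal_gen F G).
Proof.
move=> hG; split=> [x|J hJ _|x y hx hy J hJ sub|r x hr hx J hJ sub].
- by apply=> //; exact: ideal_O.
- exact: id0.
- by apply: idD => //; [exact: hx | exact: hy].
- by apply: idMl => //; exact: hx.
Qed.

Lemma mem_gen (G : algC -> Prop) x : G x -> ideal_gen F G x.
Proof. by move=> hx J _; exact. Qed.

Lemma mul_ideal I J : ideal I -> ideal J -> ideal (I ** J).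
Proof.
move=> hI hJ; apply: ideal_gen_ideal => _ [x [y [hx hy ->]]].
by apply: riM => //; [exact: idO hx | exact: idO hy].
Qed.

Lemma mem_mul I J x y : I x -> J y -> (I ** J) (x * y).
Proof. by move=> hx hy; apply: mem_gen; exists x, y. Qed.

Lemma mul_min I J M : ideal M -> (forall x y, I x -> J y -> M (x * y)) ->
  forall z, (I ** J) z -> M z.
Proof. by move=> hM h z; apply=> // _ [x [y [hx hy ->]]]; exact: h. Qed.

Lemma idmulC I J : I ** J = J ** I.
Proof.
suff h I' J' : forall z, (I' ** J') z -> (J' ** I') z by apply: ideal_ext_eq => z; split; exact: h.
move=> z hz M hM sub; apply: hz => // _ [x [y [hx hy ->]]].
by apply: sub; exists y, x; split=> //; rewrite mulrC.
Qed.

(** The device for bilinear arguments: with one factor fixed, the admissible values of the other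
    form an ideal, so it is enough to test generators. *)
Lemma colon_ideal I r : ideal I -> O r -> ideal (fun x => O x /\ I (r * x)).
Proof.
move=> hI hr; split=> [x [] // || x y [ox hx] [oy hy] | s x os [ox hx]].
- by split; [exact: ri0 | rewrite mulr0; exact: id0].
- by split; [exact: riD | rewrite mulrDr; exact: idD].
- by split; [exact: riM | rewrite mulrCA; exact: idMl].
Qed.

Lemma idmulA I J K : ideal I -> ideal J -> ideal K -> I ** (J ** K) = I ** J ** K.
Proof.
have half I' J' K' : ideal I' -> ideal J' -> ideal K' ->
    forall z, (I' ** (J' ** K')) z -> (I' ** J' ** K') z.
  move=> hI hJ hK; have hR := mul_ideal (mul_ideal hI hJ) hK.
  apply: mul_min => // x y hx; have ox := idO hI hx.
  move=> /(@mul_min _ _ _ (colon_ideal hR ox)) [] // {y} y z hy hz.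
  split; first by apply: riM => //; [exact: idO hy | exact: idO hz].
  by rewrite mulrA; do 2!apply: mem_mul => //.
move=> hI hJ hK; apply: ideal_ext_eq => z; split; first exact: half.
by rewrite (idmulC (I ** J)) (idmulC I J) (idmulC I) (idmulC J K); exact: half.
Qed.

Lemma idmulO I : ideal I -> I ** O = I.
Proof.
move=> hI; apply: ideal_ext_eq => z; split.
  by apply: mul_min => // x y hx hy; exact: idMr.
by move=> hz; rewrite -[z]mulr1; apply: mem_mul => //; exact: ri1.
Qed.

Lemma idOmul I : ideal I -> O ** I = I. Proof. by rewrite idmulC; exact: idmulO. Qed.

Lemma idmulAC I J K : ideal I -> ideal J -> ideal K -> I ** J ** K = I ** K ** J.
Proof. by move=> hI hJ hK; rewrite -idmulA // (idmulC J) idmulA. Qed.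

Lemma idmulACA I J K M : ideal I -> ideal J -> ideal K -> ideal M ->
  I ** J ** (K ** M) = I ** K ** (J ** M).
Proof.
move=> hI hJ hK hM; rewrite !idmulA ?(idmulAC hI hJ hK) //; exact: mul_ideal.
Qed.

Lemma pidealP a x : O a -> (P a) x <-> exists2 r, O r & x = a * r.
Proof.
move=> ha; split; last by case=> r hr -> J hJ h; apply: idMr => //; exact: h.
move=> hx; apply: (hx (fun y => exists2 r, O r & y = a * r)); last first.
  by move=> _ ->; exists 1; [exact: ri1 | rewrite mulr1].
split=> [y [r hr ->]||y z [r hr ->] [s hs ->]|r y hr [s hs ->]].
- exact: riM.
- by exists 0; [exact: ri0 | rewrite mulr0].
- by exists (r + s); [exact: riD | rewrite mulrDr].
- by exists (r * s); [exact: riM | rewrite mulrCA].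
Qed.

Lemma pideal_ideal a : O a -> ideal (P a).
Proof. by move=> ha; apply: ideal_gen_ideal => _ ->. Qed.

Lemma mem_pideal a : (P a) a. Proof. exact: mem_gen. Qed.

Lemma pmulP a I x : O a -> ideal I -> ((P a) ** I) x <-> exists2 y, I y & x = a * y.
Proof.
move=> ha hI; split; last by case=> y hy ->; apply: mem_mul => //; exact: mem_pideal.
have hM : ideal (fun x => exists2 y, I y & x = a * y).
  split=> [_ [y /(idO hI) oy ->]|| _ _ [y hy ->] [z hz ->] | r _ hr [y hy ->]].
  - exact: riM.
  - by exists 0; [exact: id0 | rewrite mulr0].
  - by exists (y + z); [exact: idD | rewrite mulrDr].
  - by exists (r * y); [exact: idMl | rewrite mulrCA].
apply: (mul_min hM) => y z /(pidealP _ ha)[r hr ->] hz.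
by exists (r * z); [exact: idMl | rewrite mulrA].
Qed.

Lemma pidealM a b : O a -> O b -> (P a) ** (P b) = (P (a * b)).
Proof.
move=> ha hb; apply: ideal_ext_eq => x.
rewrite (pmulP _ ha (pideal_ideal hb)) (pidealP _ (riM sF ha hb)).
split=> [[y /(pidealP _ hb)[r hr ->] ->]|[r hr ->]]; first by exists r; rewrite ?mulrA.
by exists (b * r); [apply/pidealP => //; exists r | rewrite mulrA].
Qed.

Lemma pideal1 : (P 1) = O.
Proof.
apply: ideal_ext_eq => x; rewrite (pidealP _ (ri1 sF)).
by split=> [[r hr ->]|hx]; [rewrite mul1r | exists x; rewrite ?mul1r].
Qed.

Lemma pideal_unit a u : O a -> O u -> O u^-1 -> u != 0 -> (P (a * u)) = (P a).
Proof.
move=> ha hu hv u0; apply: ideal_ext_eq => x.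
rewrite (pidealP _ (riM sF ha hu)) (pidealP _ ha); split=> [][r hr ->].
  by exists (u * r); [exact: riM | rewrite mulrA].
by exists (u^-1 * r); [exact: riM | rewrite mulrA mulfK].
Qed.

Lemma pideal_eq_unit a b : O a -> O b -> a != 0 -> (P a) = (P b) ->
  [/\ O (b / a), O (a / b) & b != 0].
Proof.
move=> ha hb a0 e.
have : (P b) a by rewrite -e; exact: mem_pideal.
have : (P a) b by rewrite e; exact: mem_pideal.
move=> /(pidealP _ ha)[r hr eb] /(pidealP _ hb)[s hs ea].
have b0 : b != 0 by apply: contraNneq a0 => b0; rewrite ea b0 mul0r.
split=> //; first by rewrite eb mulrC mulKf.
by rewrite {1}ea mulrC mulKf.
Qed.

Lemma pcancel a I J : O a -> a != 0 -> ideal I -> ideal J ->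
  (P a) ** I = (P a) ** J -> I = J.
Proof.
move=> ha a0 hI hJ e.
have half I' J' : ideal I' -> ideal J' -> (P a) ** I' = (P a) ** J' -> forall x, I' x -> J' x.
  move=> hI' hJ' e' x hx.
  have : ((P a) ** J') (a * x) by rewrite -e'; apply: mem_mul => //; exact: mem_pideal.
  by case/(pmulP _ ha hJ') => y hy /(mulfI a0) ->.
by apply: ideal_ext_eq => x; split; exact: half.
Qed.

(** [J] is the fractional ideal [(c / e) I], which the last hypothesis makes integral. New
    representatives of a class are produced this way. *)
Lemma pmul_div I c e : ideal I -> O c -> O e -> c != 0 -> e != 0 ->
  (forall x, I x -> c * x / e \in Aint) ->
  exists J, [/\ ideal J, (P e) ** J = (P c) ** I & forall x, I x -> J (c * x / e)].
Proof.
move=> hI hc he c0 e0 hint.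
pose J y := exists2 x, I x & y = c * x / e.
have hJ : ideal J.
  split=> [_ [x hx ->]|| _ _ [x hx ->] [y hy ->] | r _ hr [x hx ->]].
  - split; last exact: hint.
    by apply: (sf_div sF); [apply: (sfM sF) => //; [case: hc | case: (idO hI hx)] | case: he].
  - by exists 0; [exact: id0 | rewrite mulr0 mul0r].
  - by exists (x + y); [exact: idD | rewrite mulrDr mulrDl].
  - by exists (r * x); [exact: idMl | rewrite -!mulrA mulrCA].
exists J; split=> //; last by move=> x hx; exists x.
apply: ideal_ext_eq => x; rewrite (pmulP _ he hJ) (pmulP _ hc hI).
split=> [[_ [y hy ->] ->]|[y hy ->]]; first by exists y; rewrite // mulrC divfK.
by exists (c * y / e); [exists y | rewrite [RHS]mulrC divfK].
Qed.

Lemma same_class_eq I J a b : O a -> O b -> a != 0 -> b != 0 ->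
  (P a) ** I = (P b) ** J -> same_class F I J.
Proof. by move=> ha hb a0 b0 e; exists a, b; split=> // x; rewrite e. Qed.

Lemma same_classE I J : same_class F I J ->
  exists a b, [/\ O a, O b, a != 0, b != 0 & (P a) ** I = (P b) ** J].
Proof. by case=> a [b [ha hb a0 b0 /ideal_ext_eq e]]; exists a, b. Qed.

Lemma sc_refl I : same_class F I I.
Proof. by apply: (@same_class_eq _ _ 1 1) => //; rewrite ?oner_eq0 //; exact: ri1. Qed.

Lemma sc_sym I J : same_class F I J -> same_class F J I.
Proof. by case/same_classE=> a [b [ha hb a0 b0 e]]; exact: (@same_class_eq _ _ b a). Qed.

Lemma sc_trans I J K : ideal I -> ideal J -> ideal K ->
  same_class F I J -> same_class F J K -> same_class F I K.
Proof.
move=> hI hJ hK /same_classE[a [b [ha hb a0 b0 e]]] /same_classE[c [d [hc hd c0 d0 e']]].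
have pi := pideal_ideal.
apply: (@same_class_eq _ _ (a * c) (b * d)); rewrite ?mulf_neq0 //; try exact: riM.
have ha' := pi _ ha; have hb' := pi _ hb; have hc' := pi _ hc; have hd' := pi _ hd.
rewrite -!pidealM // -(idmulA hb' hd' hK) -e' (idmulA hb' hc' hJ) (idmulAC hb' hc' hJ) -e.
by rewrite (idmulAC ha' hI hc').
Qed.

Lemma sc_mul I I' J J' : ideal I -> ideal I' -> ideal J -> ideal J' ->
  same_class F I I' -> same_class F J J' -> same_class F (I ** J) (I' ** J').
Proof.
move=> hI hI' hJ hJ' /same_classE[a [b [ha hb a0 b0 e]]] /same_classE[c [d [hc hd c0 d0 e']]].
have pi := pideal_ideal.
apply: (@same_class_eq _ _ (a * c) (b * d)); rewrite ?mulf_neq0 //; try exact: riM.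
have ha' := pi _ ha; have hb' := pi _ hb; have hc' := pi _ hc; have hd' := pi _ hd.
by rewrite -!pidealM // (idmulACA ha') // e e' (idmulACA hb').
Qed.

Lemma sc_pideal a : O a -> a != 0 -> same_class F (P a) O.
Proof.
move=> ha a0; apply: (@same_class_eq _ _ 1 a) => //; rewrite ?oner_eq0 //; first exact: ri1.
by rewrite pideal1 idOmul ?idmulO //; exact: pideal_ideal.
Qed.

Lemma nonzero_mul I J : nonzero_ideal F I -> nonzero_ideal F J -> nonzero_ideal F (I ** J).
Proof.
case=> hI [x [hx x0]] [hJ [y [hy y0]]]; split; first exact: mul_ideal.
by exists (x * y); rewrite mulf_neq0 //; split=> //; exact: mem_mul.
Qed.

Lemma nonzero_O : nonzero_ideal F O.
Proof. by split; [exact: ideal_O | exists 1; rewrite oner_eq0; split=> //; exact: ri1]. Qed.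

Lemma is_principalE I : is_principal F I -> exists2 a, O a & I = (P a).
Proof. by case=> a [ha /ideal_ext_eq ->]; exists a. Qed.

Lemma sc_principal I : ideal I -> same_class F I O -> exists2 a, O a & a != 0 /\ I = (P a).
Proof.
move=> hI /same_classE[a [b [ha hb a0 b0]]]; rewrite (idmulO (pideal_ideal hb)) => e.
have : ((P a) ** I) b by rewrite e; exact: mem_pideal.
case/(pmulP _ ha hI) => c hc eb; have oc := idO hI hc.
exists c => //; split; first by apply: contraNneq b0 => c0; rewrite eb c0 mulr0.
apply: (pcancel ha a0 hI); first exact: pideal_ideal.
by rewrite pidealM // e -eb.
Qed.
End Ideals.

(** Composing the minimal polynomial of [x ^+ n] with ['X^n] gives a monic integral polynomial
    vanishing at [x]. Integrality of a quotient is mostly tested on its square below, where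
    relations such as [H^2 = (r)] apply. *)
Lemma Aint_rootn n x : (0 < n)%N -> x ^+ n \in Aint -> x \in Aint.
Proof.
move=> n0 hx; apply: (@root_monic_Aint (minCpoly (x ^+ n) \Po 'X^n)).
- by rewrite rootE horner_comp hornerXn; exact: (root_minCpoly (x ^+ n)).
- rewrite monicE lead_coef_comp ?size_polyXn // lead_coefXn expr1n mulr1.
  by rewrite -monicE; exact: minCpoly_monic.
- by apply: polyOver_comp => //; apply: rpredX; exact: polyOverX.
Qed.

(** * Extension of ideals and capitulation *)

Section Capitulation.
Variables k K : algC -> Prop.
Hypotheses (sk : is_subfield k) (sK : is_subfield K) (kK : forall x, k x -> K x).
Implicit Types (I J : algC -> Prop) (x y : algC).

Lemma ri_sub x : ringint k x -> ringint K x.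
Proof. by case=> hx ?; split=> //; exact: kK. Qed.

Lemma ext_ideal I : is_ideal k I -> is_ideal K (ideal_ext K I).
Proof. by move=> hI; apply: ideal_gen_ideal => // x /(idO hI); exact: ri_sub. Qed.

Lemma mem_ext I x : I x -> ideal_ext K I x. Proof. exact: mem_gen. Qed.

Lemma contract_ideal M : is_ideal K M -> is_ideal k (fun x => ringint k x /\ M x).
Proof.
move=> hM; split=> [x []//||x y [ox hx] [oy hy]|r x hr [ox hx]].
- by split; [exact: ri0 | exact: id0 hM].
- by split; [exact: riD | exact: idD hM _ _].
- by split; [exact: riM | apply: (idMl hM) => //; exact: ri_sub].
Qed.

Lemma ext_min I M : is_ideal K M -> (forall x, I x -> M x) -> forall x, ideal_ext K I x -> M x.
Proof. by move=> hM h x; exact. Qed.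

Lemma ext_elim I M x : is_ideal K M -> ideal_ext K I x -> (forall y, I y -> M y) -> M x.
Proof. by move=> hM hx h; exact: (ext_min hM h). Qed.

Lemma ext_mul I J : is_ideal k I -> is_ideal k J ->
  ideal_ext K (ideal_mul k I J) = ideal_mul K (ideal_ext K I) (ideal_ext K J).
Proof.
move=> hI hJ; have eI := ext_ideal hI; have eJ := ext_ideal hJ.
have eIJ := ext_ideal (mul_ideal sk hI hJ).
apply: ideal_ext_eq => z; split.
  apply: ext_min; first exact: mul_ideal.
  move=> x hx; have := contract_ideal (mul_ideal sK eI eJ).
  move/(@mul_min k I J)/(_ _ x hx) => [] // a b ha hb; split.
    by apply: riM => //; [exact: idO ha | exact: idO hb].
  by apply: mem_mul; exact: mem_ext.
apply: (mul_min eIJ) => x y hx hy.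
have ox := idO eI hx.
(* Both factors lie in extended ideals; they are replaced by generators from [k] one after the
   other, each time through a colon ideal. *)
have [] // : ringint K y /\ ideal_ext K (ideal_mul k I J) (x * y).
apply: (ext_elim (colon_ideal sK eIJ ox) hy) => b hb.
have ob := ri_sub (idO hJ hb); split=> //; rewrite mulrC.
have [] // : ringint K x /\ ideal_ext K (ideal_mul k I J) (b * x).
apply: (ext_elim (colon_ideal sK eIJ ob) hx) => a ha.
split; first exact: ri_sub (idO hI ha).
by rewrite mulrC; apply: mem_ext; exact: mem_mul.
Qed.

Lemma ext_pideal a : ringint k a -> ideal_ext K (pideal k a) = pideal K a.
Proof.
move=> ha; have ha' := ri_sub ha; apply: ideal_ext_eq => z; split.
  apply: ext_min; first exact: pideal_ideal.
  move=> x /(pidealP sk _ ha)[r hr ->]; apply/(pidealP sK) => //.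
  by exists r => //; exact: ri_sub.
case/(pidealP sK _ ha') => r hr ->; apply: (idMr (ext_ideal (pideal_ideal sk ha))) => //.
by apply: mem_ext; exact: mem_pideal.
Qed.

Lemma capitulatesE I : capitulates K I -> exists2 a, ringint K a & ideal_ext K I = pideal K a.
Proof. exact: is_principalE. Qed.

Lemma capitulates_intro I a : ringint K a -> ideal_ext K I = pideal K a -> capitulates K I.
Proof. by move=> ha e; exists a; split=> // x; rewrite e. Qed.

Lemma cap_sc I J : is_ideal k I -> is_ideal k J -> same_class k I J ->
  capitulates K I -> capitulates K J.
Proof.
move=> hI hJ /same_classE[a [b [ha hb a0 b0 e]]] /capitulatesE[c hc ec].
have e' : pideal K (a * c) = ideal_mul K (pideal K b) (ideal_ext K J).
  rewrite -pidealM -?ec -?ext_pideal -?ext_mul ?e //; try exact: pideal_ideal.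
  exact: ri_sub.
have eJ := ext_ideal hJ; have ob := ri_sub hb.
have : (ideal_mul K (pideal K b) (ideal_ext K J)) (a * c) by rewrite -e'; exact: mem_pideal.
case/(pmulP sK _ ob eJ) => d hd ed; have od := idO eJ hd.
apply: (capitulates_intro od); apply: (pcancel sK ob b0 eJ); first exact: pideal_ideal.
by rewrite pidealM // -e' ed.
Qed.

Lemma cap_mul I J : is_ideal k I -> is_ideal k J ->
  capitulates K I -> capitulates K J -> capitulates K (ideal_mul k I J).
Proof.
move=> hI hJ /capitulatesE[a ha ea] /capitulatesE[b hb eb].
apply: (@capitulates_intro _ (a * b)); first exact: riM.
by rewrite ext_mul // ea eb pidealM.
Qed.

Lemma cap_pideal a : ringint k a -> capitulates K (pideal k a).
Proof. by move=> ha; apply: (@capitulates_intro _ a); [exact: ri_sub | exact: ext_pideal]. Qed.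

Lemma cap_O : capitulates K (ringint k).
Proof. by rewrite -(pideal1 sk); apply: cap_pideal; exact: ri1. Qed.

(* An ideal [H] with [H^2 = (r)] becomes principal as soon as [r] is a unit times a square. *)
Lemma cap_sqrt H r b u : is_ideal k H -> ringint k r -> r != 0 ->
  ideal_mul k H H = pideal k r -> K b -> u \in Aint -> u^-1 \in Aint -> u != 0 ->
  b ^+ 2 = r * u -> capitulates K H.
Proof.
move=> hH hr r0 e Kb hu hv u0 eb.
have Ku : K u.
  have -> : u = b ^+ 2 / r by rewrite eb mulrC mulKf.
  by apply: sf_div => //; [exact: sfX | apply: kK; case: hr].
have b0 : b != 0.
  by apply/eqP => bz; move/esym/eqP: eb; rewrite bz expr0n mulf_eq0 (negPf r0) (negPf u0).
have ob : ringint K b.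
  split=> //; apply: (@Aint_rootn 2) => //; rewrite eb.
  by apply: rpredM => //; case: hr.
have sq h : H h -> exists2 s, ringint k s & h ^+ 2 = r * s.
  by move=> hh; apply/(pidealP sk) => //; rewrite -e; exact: mem_mul.
have eH := ext_ideal hH.
apply: (capitulates_intro ob); apply: ideal_ext_eq => z; split.
  apply: ext_min; first exact: pideal_ideal.
  move=> h hh; have [s [_ hs] es] := sq h hh.
  apply/(pidealP sK) => //; exists (h / b); last by rewrite mulrC divfK.
  split; first by apply: sf_div => //; apply: kK; case: (idO hH hh).
  apply: (@Aint_rootn 2) => //; rewrite expr_div_n es eb.
  have -> : r * s / (r * u) = s * u^-1 by field; rewrite ?r0 ?u0.
  exact: rpredM.
suff hb : ideal_ext K H b.
  by case/(pidealP sK _ ob) => s hs ->; exact: (idMr eH).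
have or' := ri_sub hr.
have hM := mul_ideal sK (pideal_ideal sK or') eH.
(* [b] lies in the extension because [b * r] lies in [r] times it: [r] is a sum of products [x * y]
   of elements of [H], and [b * x / r] is integral since its square is [u * s]. *)
have : (fun x => ringint K x /\ ideal_mul K (pideal K r) (ideal_ext K H) (b * x)) r.
  have hc := colon_ideal sK hM ob.
  have : ideal_mul k H H r by rewrite e; exact: mem_pideal.
  move=> h; have [] // := mul_min (contract_ideal hc) _ h => x y hx hy.
  have oxy : ringint k (x * y) by apply: riM => //; [exact: idO hx | exact: idO hy].
  split=> //; split; first exact: ri_sub.
  have [s [_ hs] es] := sq x hx.
  apply/(pmulP sK) => //; exists (b * x / r * y); last by field.
  apply: (idMl eH); last exact: mem_ext.
  split.
    apply: sf_div => //; first by apply: sfM => //; apply: kK; case: (idO hH hx).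
    by case: or'.
  apply: (@Aint_rootn 2) => //; rewrite expr_div_n exprMn es eb.
  have -> : r * u * (r * s) / r ^+ 2 = u * s by field.
  exact: rpredM.
by case=> _ /(pmulP sK _ or' eH)[y hy]; rewrite mulrC => /(mulfI r0) ->.
Qed.
End Capitulation.

(** * Gaussian integers *)

Lemma exists_min (P : nat -> Prop) : (exists n, P n) ->
  exists n, P n /\ forall m, P m -> (n <= m)%N.
Proof.
case=> n; elim/ltn_ind: n => n ih hn.
case: (classic (exists2 m, (m < n)%N & P m)) => [[m lt hm]|h]; first exact: ih hm.
by exists n; split=> // m hm; rewrite leqNgt; apply/negP => lt; apply: h; exists m.
Qed.

Definition gi (a b : int) : algC := a%:~R + b%:~R * 'i.

Lemma giD a b c d : gi a b + gi c d = gi (a + c) (b + d).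
Proof. by rewrite /gi !rmorphD /=; ring. Qed.

Lemma giN a b : - gi a b = gi (- a) (- b).
Proof. by rewrite /gi !rmorphN /=; ring. Qed.

Lemma giM a b c d : gi a b * gi c d = gi (a * c - b * d) (a * d + b * c).
Proof.
have ii : 'i * 'i = -1 :> algC := mulCii _.
rewrite /gi !rmorphD !rmorphN !rmorphM /=.
transitivity (a%:~R * c%:~R + (a%:~R * d%:~R + b%:~R * c%:~R) * 'i + b%:~R * d%:~R * ('i * 'i) : algC).
  by ring.
by rewrite ii; ring.
Qed.

Lemma gi_int a : a%:~R = gi a 0. Proof. by rewrite /gi mul0r addr0. Qed.
Lemma gi_i : 'i = gi 0 1. Proof. by rewrite /gi add0r mul1r. Qed.

Lemma gi_conj a b : (gi a b)^* = gi a (- b).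
Proof. by rewrite /gi rmorphD rmorphM /= !rmorph_int conjCi rmorphN /=; ring. Qed.

Lemma gi_Re a b : 'Re (gi a b) = a%:~R.
Proof. by rewrite /gi mulrC Re_rect // Rreal_int ?intr_int. Qed.
Lemma gi_Im a b : 'Im (gi a b) = b%:~R.
Proof. by rewrite /gi mulrC Im_rect // Rreal_int ?intr_int. Qed.

Lemma gi_inj a b c d : gi a b = gi c d -> a = c /\ b = d.
Proof.
move=> e; split; apply: (@intr_inj algC); first by rewrite -!(gi_Re _ b) e !gi_Re.
by rewrite -!(gi_Im a) e !gi_Im.
Qed.

Lemma gi11_neq0 : 1 + 'i != 0 :> algC.
Proof.
by apply/eqP; rewrite -['i]mul1r -[1 + _]/(gi 1 1) -[0]/(0%:~R) gi_int => /gi_inj[].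
Qed.

Local Notation Zi := (ringint Qi).

Lemma Qi_conj x : Qi x -> Qi x^*.
Proof.
case=> a [b [ha hb ->]]; exists a, (- b); split=> //; first by rewrite rpredN.
by rewrite rmorphD rmorphM /= conjCi !conj_Crat // mulrN mulNr.
Qed.

Lemma Aint_conj x : (x^* \in Aint) = (x \in Aint).
Proof. exact: (Aint_aut Num.conj). Qed.

Lemma Zi_conj x : Zi x -> Zi x^*.
Proof. by case=> /Qi_conj ? ?; split; rewrite // Aint_conj. Qed.

Lemma Aint_i : ('i : algC) \in Aint.
Proof. by apply: (@Aint_rootn 2) => //; rewrite sqrCi rpredN rpred1. Qed.

Lemma Zi_i : Zi 'i. Proof. by split; [exact: Qi_i | exact: Aint_i]. Qed.

Lemma Zi_gi a b : Zi (gi a b).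
Proof.
have sQ := Qi_subfield.
by apply: riD => //; [exact: ri_int | apply: riM => //; [exact: ri_int | exact: Zi_i]].
Qed.

(** [2 * a], [2 * b] and [a ^+ 2 + b ^+ 2] are rational algebraic integers, hence integers; as the
    squares of the first two then sum to a multiple of 4, both are even. *)
Lemma ZiP x : Zi x -> exists a b, x = gi a b.
Proof.
case=> [[a [b [ha hb ->]]] hx].
have ca := conj_Crat ha; have cb := conj_Crat hb.
have hx' : a - b * 'i \in Aint.
  by rewrite -Aint_conj rmorphD rmorphN rmorphM /= conjCi ca cb mulrN opprK.
have Zi2 z : z \in Crat -> z \in Aint -> exists n : int, z = n%:~R.
  by move=> h1 h2; apply/intrP; exact: Cint_rat_Aint.
have [m em] : exists m : int, 2 * a = m%:~R.
  apply: Zi2; first by apply: rpredM => //; exact: rpred_nat.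
  have -> : 2 * a = (a + b * 'i) + (a - b * 'i) by ring.
  exact: rpredD.
have ii : 'i * 'i = -1 :> algC := mulCii _.
have [n en] : exists n : int, 2 * b = n%:~R.
  apply: Zi2; first by apply: rpredM => //; exact: rpred_nat.
  have -> : 2 * b = ((a - b * 'i) - (a + b * 'i)) * 'i.
    transitivity (- 2 * b * ('i * 'i)); last by ring.
    by rewrite ii; ring.
  by apply: rpredM; [exact: rpredB | exact: Aint_i].
have [l el] : exists l : int, a ^+ 2 + b ^+ 2 = l%:~R.
  apply: Zi2; first by apply: rpredD; exact: rpredX.
  have -> : a ^+ 2 + b ^+ 2 = (a + b * 'i) * (a - b * 'i).
    transitivity (a ^+ 2 - b ^+ 2 * ('i * 'i)); last by ring.
    by rewrite ii; ring.
  exact: rpredM.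
have e4 : m ^+ 2 + n ^+ 2 = 4 * l.
  by apply: (@intr_inj algC); rewrite rmorphD !rmorphXn rmorphM /= -em -en -el; ring.
have [m' em'] : exists m', m = 2 * m'.
  exists (m %/ 2)%Z; have := divz_eq m 2; have := divz_eq n 2.
  have := ltz_pmod m (isT : 0 < 2 :> int); have := modz_ge0 m (isT : 2 != 0 :> int).
  have := ltz_pmod n (isT : 0 < 2 :> int); have := modz_ge0 n (isT : 2 != 0 :> int).
  move: (m %/ 2)%Z (m %% 2)%Z (n %/ 2)%Z (n %% 2)%Z => q r q' r'.
  move=> h1 h2 h3 h4 h5 h6; move: e4; rewrite h5 h6; nia.
have [n' en'] : exists n', n = 2 * n'.
  exists (n %/ 2)%Z; have := divz_eq n 2.
  have := ltz_pmod n (isT : 0 < 2 :> int); have := modz_ge0 n (isT : 2 != 0 :> int).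
  move: (n %/ 2)%Z (n %% 2)%Z => q' r'.
  move=> h1 h2 h3; move: e4; rewrite em' h3; nia.
have two : (2 : algC) != 0 by rewrite pnatr_eq0.
exists m', n'; rewrite /gi; congr (_ + _ * _); apply: (mulfI two).
  by rewrite em em' rmorphM.
by rewrite en en' rmorphM.
Qed.

Definition gnorm (a b : int) : int := a ^+ 2 + b ^+ 2.

Lemma gi_norm a b : gi a b * (gi a b)^* = (gnorm a b)%:~R.
Proof. by rewrite gi_conj giM gi_int /gnorm; congr (gi _ _); ring. Qed.

Lemma gi_eq0 a b : (gi a b == 0) = (gnorm a b == 0).
Proof. by rewrite -(intr_eq0 algC) -gi_norm mulf_eq0 fmorph_eq0 orbb. Qed.

Lemma near_quot (u n : int) : 0 < n -> exists q, (2 * (u - q * n)) ^+ 2 <= n ^+ 2.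
Proof.
(* The floor of [u / n + 1/2], that is, the integer nearest to [u / n]. *)
move=> n0; exists ((2 * u + n) %/ (2 * n))%Z.
have n2 : 2 * n != 0 by lia.
have n2' : 0 < 2 * n by lia.
have := divz_eq (2 * u + n) (2 * n).
have := ltz_pmod (2 * u + n) n2'; have := modz_ge0 (2 * u + n) n2.
move: (_ %/ _)%Z (_ %% _)%Z => q r h1 h2 h3.
have -> : 2 * (u - q * n) = r - n by lia.
nia.
Qed.

(** Both coordinates of the exact quotient are rounded, with errors at most 1/2, so the error of the
    quotient has norm at most 1/2. The proof states this after multiplying the remainder by the
    conjugate of the divisor. *)
Lemma gi_euclid a b c d : gi c d != 0 ->
  exists q r, gnorm (a - (c * q - d * r)) (b - (c * r + d * q)) < gnorm c d.
Proof.
rewrite gi_eq0 => nz; have n0 : 0 < gnorm c d by rewrite /gnorm in nz *; nia.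
have [q hq] := near_quot (a * c + b * d) n0; have [r hr] := near_quot (b * c - a * d) n0.
exists q, r; set x := a - _; set y := b - _.
have e : (a * c + b * d - q * gnorm c d) ^+ 2 + (b * c - a * d - r * gnorm c d) ^+ 2
   = gnorm c d * gnorm x y by rewrite /x /y /gnorm; ring.
move: e hq hr; move: (a * c + b * d - _) (b * c - a * d - _) (gnorm x y) => X Y N e hq hr.
nia.
Qed.

Lemma Zi_pid J : nonzero_ideal Qi J -> exists2 g, Zi g & g != 0 /\ J = pideal Qi g.
Proof.
case=> hJ [x [hx x0]].
have [|n [[a [b [hg g0 en]]] hmin]] :=
    @exists_min (fun n => exists a b, [/\ J (gi a b), gi a b != 0 & gnorm a b = n%:Z]).
  have [a [b ex]] := ZiP (idO hJ hx).
  exists `|gnorm a b|%N, a, b; rewrite -ex; split=> //.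
  by rewrite gez0_abs // /gnorm; nia.
exists (gi a b); first exact: Zi_gi.
split=> //; apply: ideal_ext_eq => y; rewrite (pidealP Qi_subfield _ (Zi_gi _ _)).
split; last by case=> r hr ->; exact: (idMr hJ).
move=> hy; have [c [d ey]] := ZiP (idO hJ hy).
have [q [r hqr]] := gi_euclid c d g0.
exists (gi q r); first exact: Zi_gi.
apply/eqP; rewrite -subr_eq0; apply/negPn/negP => nz.
have ez : y - gi a b * gi q r = gi (c - (a * q - b * r)) (d - (a * r + b * q)).
  by rewrite ey giM giN giD.
have hz : J (y - gi a b * gi q r).
  by apply: (idB Qi_subfield hJ hy); apply: (idMr hJ) => //; exact: Zi_gi.
have : (n <= `|gnorm (c - (a * q - b * r)) (d - (a * r + b * q))|)%N.
  apply: hmin.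
  exists (c - (a * q - b * r)), (d - (a * r + b * q)); rewrite -ez; split=> //.
  by rewrite gez0_abs // /gnorm; nia.
move: hqr; rewrite en; have : 0 <= gnorm (c - (a * q - b * r)) (d - (a * r + b * q)).
  by rewrite /gnorm; nia.
move: (gnorm _ _) => N; lia.
Qed.

Definition zdvd (g x : algC) : Prop := exists2 y, ringint Qi y & x = g * y.

Lemma Zi_gcd x y : Zi x -> Zi y -> x != 0 ->
  exists g u v, [/\ Zi g, Zi u /\ Zi v, g = u * x + v * y, g != 0 & zdvd g x /\ zdvd g y].
Proof.
have sQ := Qi_subfield; move=> hx hy x0.
pose J z := exists u v, [/\ Zi u, Zi v & z = u * x + v * y].
have hJ : is_ideal Qi J.
  split=> [_ [u [v [hu hv ->]]] | | _ _ [u [v [hu hv ->]]] [u' [v' [hu' hv' ->]]]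
          | r _ hr [u [v [hu hv ->]]]].
  - by apply: riD => //; exact: riM.
  - by exists 0, 0; split; [exact: ri0 | exact: ri0 | ring].
  - by exists (u + u'), (v + v'); split; [exact: riD | exact: riD | ring].
  - by exists (r * u), (r * v); split; [exact: riM | exact: riM | ring].
have Jx : J x by exists 1, 0; split; [exact: ri1 | exact: ri0 | ring].
have Jy : J y by exists 0, 1; split; [exact: ri0 | exact: ri1 | ring].
have [|g hg [g0 eJ]] := @Zi_pid J; first by split=> //; exists x.
have : J g by rewrite eJ; exact: mem_pideal.
case=> u [v [hu hv eg]]; exists g, u, v; split=> //; split.
  by move: Jx; rewrite eJ => /(pidealP sQ _ hg).
by move: Jy; rewrite eJ => /(pidealP sQ _ hg).
Qed.

Lemma Zi_unit u : Qi u -> u \in Aint -> u^-1 \in Aint -> u != 0 ->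
  [\/ u = 1, u = -1, u = 'i | u = - 'i].
Proof.
move=> Qu hu hv u0.
have [a [b eu]] := ZiP (conj Qu hu).
have [c [d ev]] := ZiP (conj (sfV Qi_subfield Qu) hv).
have : gnorm a b * gnorm c d = 1.
  apply: (@intr_inj algC); rewrite rmorphM /= -!gi_norm -eu -ev mulrACA mulfV // -rmorphM mulfV //.
  by rewrite rmorph1 mulr1.
rewrite /gnorm => e.
have : a ^+ 2 + b ^+ 2 = 1.
  have h1 : 0 <= a ^+ 2 + b ^+ 2 by nia.
  have h2 : 0 <= c ^+ 2 + d ^+ 2 by nia.
  move: e h1 h2; move: (a ^+ 2 + b ^+ 2) (c ^+ 2 + d ^+ 2) => [m|m] [n|n] // /eqP.
  by rewrite -PoszM eqz_nat muln_eq1 => /andP[/eqP ->].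
move=> e1; have : (a = 1 /\ b = 0) \/ (a = -1 /\ b = 0) \/ (a = 0 /\ b = 1) \/ (a = 0 /\ b = -1).
  have : (a == 0) || (a == 1) || (a == -1) by nia.
  case/orP=> [/orP[]|] /eqP ea; move: e1; rewrite ea => e1; last by right; left; nia.
    have : (b == 1) || (b == -1) by nia.
    by case/orP=> /eqP ->; right; right; [left | right].
  by left; nia.
rewrite eu /gi; case=> [[-> ->]|[[-> ->]|[[-> ->]|[-> ->]]]].
- by constructor 1; rewrite mul0r addr0.
- by constructor 2; rewrite mul0r addr0 rmorphN.
- by constructor 3; rewrite mul1r add0r.
- by constructor 4; rewrite rmorphN mulN1r add0r.
Qed.

(** [z] is the gcd [g] of [a] and [c]. That [a / g ^+ 2] is a unit is seen from Bezout relations: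
    [w] and [w'] express this quotient and its inverse as Gaussian integers. *)
Lemma Zi_sqr_factor a b c u v : Zi a -> Zi b -> Zi c -> Zi u -> Zi v -> a != 0 ->
  a * b = c ^+ 2 -> u * a + v * b = 1 ->
  exists w z, [/\ Zi w, Zi w^-1, w != 0, Zi z & a = w * z ^+ 2].
Proof.
have sQ := Qi_subfield; move=> ha hb hc hu hv a0 ec e1.
have [g [s [t [hg [hs ht] eg g0 [[a' ha' ea] [c' hc' ec']]]]]] := Zi_gcd ha hc a0.
pose w := u * a' ^+ 2 + v * c' ^+ 2; pose w' := s ^+ 2 * a + s * t * c * 2 + t ^+ 2 * b.
have hX x n : Zi x -> Zi (x ^+ n).
  by move=> [? ?]; split; [exact: sfX | exact: rpredX].
have hw : Zi w by apply: riD => //; apply: riM => //; exact: hX.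
have hw' : Zi w'.
  apply: riD => //; last by apply: riM => //; exact: hX.
  apply: riD => //; first by apply: riM => //; exact: hX.
  by apply: riM => //; [do 2!apply: riM => // | exact: (ri_nat sQ 2)].
have ew : a = w * g ^+ 2.
  rewrite -[LHS]mulr1 -e1 mulrDr; transitivity (u * a ^+ 2 + v * (a * b)); first by ring.
  by rewrite ec ec' {1}ea /w; ring.
have ew' : g ^+ 2 = a * w'.
  rewrite eg; transitivity (s ^+ 2 * a ^+ 2 + 2 * s * t * a * c + t ^+ 2 * c ^+ 2); first by ring.
  by rewrite -ec /w'; ring.
have ww : w * w' = 1.
  by apply: (mulfI a0); rewrite mulr1 {2}ew ew'; ring.
have w0 : w != 0 by apply: contraNneq (oner_neq0 algC) => w0; rewrite -ww w0 mul0r.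
have ew'' : w^-1 = w' by apply: (mulfI w0); rewrite ww mulfV.
by exists w, g; rewrite ew''.
Qed.

(** * Reduction modulo a Gaussian prime with prime norm *)

Section Reduction.
Variable (p : nat).
Implicit Type r : 'F_p.

(** Reduction of Gaussian integers to ['F_p] with ['i] sent to [r]. The floors make it total on
    [algC]; it is a ring morphism on [Z[i]] once [r ^+ 2 = -1]. *)
Definition phi r (x : algC) : 'F_p :=
  (Num.floor ('Re x))%:~R + (Num.floor ('Im x))%:~R * r.

Lemma phi_gi r a b : phi r (gi a b) = a%:~R + b%:~R * r.
Proof. by rewrite /phi gi_Re gi_Im !intrKfloor. Qed.

Lemma phi_int r (a : int) : phi r a%:~R = a%:~R.
Proof. by rewrite gi_int phi_gi mul0r addr0. Qed.

Lemma phi_nat r (a : nat) : phi r a%:R = a%:R.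
Proof. exact: (phi_int r a). Qed.

Lemma phi_i r : phi r 'i = r.
Proof. by rewrite gi_i phi_gi mul1r add0r. Qed.

Lemma phiD r x y : Zi x -> Zi y -> phi r (x + y) = phi r x + phi r y.
Proof.
by move=> /ZiP[a [b ->]] /ZiP[c [d ->]]; rewrite giD !phi_gi !rmorphD /=; ring.
Qed.

Lemma phiN r x : Zi x -> phi r (- x) = - phi r x.
Proof. by move=> /ZiP[a [b ->]]; rewrite giN !phi_gi !rmorphN /=; ring. Qed.

Lemma phi_conj r x : Zi x -> phi r x^* = phi (- r) x.
Proof. by move=> /ZiP[a [b ->]]; rewrite gi_conj !phi_gi rmorphN /=; ring. Qed.

Lemma phiM r x y : r ^+ 2 = -1 -> Zi x -> Zi y -> phi r (x * y) = phi r x * phi r y.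
Proof.
move=> r2 /ZiP[a [b ->]] /ZiP[c [d ->]]; rewrite giM !phi_gi !rmorphD rmorphN !rmorphM /=.
transitivity (a%:~R * c%:~R + (a%:~R * d%:~R + b%:~R * c%:~R) * r + b%:~R * d%:~R * r ^+ 2).
  by rewrite r2; ring.
by ring.
Qed.

Lemma phiX r x n : r ^+ 2 = -1 -> Zi x -> phi r (x ^+ n) = phi r x ^+ n.
Proof.
move=> r2 hx; have sQ := Qi_subfield; elim: n => [|n ih]; first exact: (phi_nat r 1).
rewrite !exprS phiM // ?ih //.
by case: hx => ? ?; split; [exact: sfX | exact: rpredX].
Qed.

Variables (A B : int).
Hypotheses (pp : prime p) (eAB : p%:Z = A ^+ 2 + B ^+ 2).

Lemma Fp_int_eq0 (n : int) : (n%:~R == 0 :> 'F_p) = (p %| n)%Z.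
Proof. by rewrite (dvdz_pcharf (pchar_Fp pp)). Qed.

Lemma sum2sq_nz : (B%:~R : 'F_p) != 0.
Proof.
rewrite Fp_int_eq0; apply/negP => /dvdzP[b eb].
have p2 : (1 < p)%N := prime_gt1 pp.
have : (p %| A)%Z.
  have : (p %| A ^+ 2)%Z by apply/dvdzP; exists (1 - b ^+ 2 * p); move: eAB; rewrite eb; nia.
  by rewrite !dvdzE abszX Euclid_dvdX // => /andP[].
case/dvdzP=> a ea; have p0 : p%:Z != 0 by lia.
have : (p %| 1)%Z.
  apply/dvdzP; exists (a ^+ 2 + b ^+ 2); apply: (mulfI p0); rewrite mulr1 {1}eAB ea eb; ring.
by rewrite dvdzE dvdn1 /= => /eqP p1; rewrite p1 in p2.
Qed.

(** The image of ['i] forced by [A + B * 'i = 0]. *)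
Definition rt : 'F_p := - A%:~R / B%:~R.

Lemma rt_sqr : rt ^+ 2 = -1.
Proof.
have := sum2sq_nz => B0.
have e : (A%:~R : 'F_p) ^+ 2 = - B%:~R ^+ 2.
  apply/eqP; rewrite -addr_eq0 -!rmorphXn -rmorphD /= -eAB.
  by rewrite Fp_int_eq0; exact: dvdzz.
by rewrite /rt expr_div_n sqrrN e mulNr mulfV // expf_neq0.
Qed.

(** If [x] reduces to 0, both coordinates of [x] times the conjugate of [gi A B] are divisible by
    [p], the norm of [gi A B]; dividing them by [p] gives the quotient. *)
Lemma phi_ker x : Zi x -> phi rt x = 0 -> zdvd (gi A B) x.
Proof.
have B0 := sum2sq_nz; case/ZiP=> u [v ->]; rewrite phi_gi => e.
have e1 : (u%:~R * B%:~R : 'F_p) = v%:~R * A%:~R.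
  move/eqP: e; rewrite addr_eq0 => /eqP ->; rewrite /rt; field.
  exact: B0.
have d1 : (p %| v * A - u * B)%Z.
  by rewrite -Fp_int_eq0 rmorphB !rmorphM /= e1 subrr.
have d2 : (p %| u * A + v * B)%Z.
  rewrite -Fp_int_eq0 -(mulIr_eq0 _ (mulIf B0)) -rmorphM /=.
  have -> : (u * A + v * B) * B = (u * B) * A + v * B ^+ 2 by ring.
  rewrite rmorphD rmorphM [X in X * _]rmorphM /= e1 -!rmorphM -rmorphD Fp_int_eq0.
  by apply/dvdzP; exists v; rewrite eAB; ring.
have [c ec] := dvdzP d2; have [d ed] := dvdzP d1.
have p0 : (p%:Z%:~R : algC) != 0 by rewrite intr_eq0; have := prime_gt0 pp; lia.
exists (gi c d); first exact: Zi_gi.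
apply: (mulfI p0); rewrite !gi_int !giM eAB.
move: ec ed; rewrite eAB => ec ed; congr (gi _ _).
  by transitivity (A * (u * A + v * B) - B * (v * A - u * B)); [ring | rewrite ec ed; ring].
by transitivity (B * (u * A + v * B) + A * (v * A - u * B)); [ring | rewrite ec ed; ring].
Qed.

Lemma phi_pi : phi rt (gi A B) = 0.
Proof. by rewrite phi_gi /rt mulrC divfK ?subrr // sum2sq_nz. Qed.
End Reduction.

(** * Quadratic symbols and Gauss sums *)

Section Legendre.
Variable p : nat.
Hypotheses (pp : prime p) (p2 : (2 < p)%N).
Local Notation n := (p.-1)./2.

Lemma half_pred_gt0 : (0 < n)%N. Proof. by have := p2; lia. Qed.

Lemma Fp_fermat (x : 'F_p) : x != 0 -> x ^+ p.-1 = 1.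
Proof.
move=> x0; apply: (mulfI x0); rewrite -exprS prednK ?prime_gt0 // mulr1.
by rewrite -[X in _ ^+ X](card_Fp pp) expf_card.
Qed.

Lemma Fp_prim_root : exists g : 'F_p, (p.-1).-primitive_root g.
Proof.
have h : (0 < p.-1)%N by have := p2; lia.
have := @has_prim_root _ p.-1 (enum [set~ (0 : 'F_p)]) h.
have u : all (p.-1).-unity_root (enum [set~ (0 : 'F_p)]).
  by apply/allP => x; rewrite mem_enum !inE unity_rootE => x0; rewrite Fp_fermat.
rewrite u enum_uniq -cardE cardsC1 card_Fp // => /(_ isT isT (leqnn _)) /hasP[g _ hg].
by exists g.
Qed.

Hypothesis podd : odd p.

Lemma double_half_pred : (n * 2)%N = p.-1.
Proof. by have := podd; have := p2; lia. Qed.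

Lemma two_nz : (2 : 'F_p) != 0.
Proof. by rewrite -(dvdn_pcharf (pchar_Fp pp)); apply/negP => /dvdn_leq; have := p2; lia. Qed.

Lemma one_neqN1 : (1 : 'F_p) != -1.
Proof. by rewrite -subr_eq0 opprK two_nz. Qed.

Lemma chi_pm1 (x : 'F_p) : x != 0 -> x ^+ n = 1 \/ x ^+ n = -1.
Proof.
move=> x0; have /eqP : (x ^+ n) ^+ 2 = 1 by rewrite -exprM double_half_pred Fp_fermat.
by rewrite sqrf_eq1 => /orP[] /eqP; [left | right].
Qed.

Lemma chi_sqr (x : 'F_p) : x != 0 -> x ^+ n = 1 -> exists y, x = y ^+ 2.
Proof.
move=> x0 hx; have [g hg] := Fp_prim_root.
have [i ei] := prim_rootP hg (Fp_fermat x0).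
have : (n * 2 %| n * i)%N.
  by rewrite double_half_pred (prim_order_dvd hg) mulnC exprM -ei hx.
rewrite dvdn_pmul2l ?half_pred_gt0 // => /dvdnP[j ej].
by exists (g ^+ j); rewrite ei ej exprM.
Qed.

(** The Legendre symbol through Euler's criterion, which makes multiplicativity immediate;
    [legendreE] identifies it with the definition by residues. *)
Definition leg (x : 'F_p) : int := if x == 0 then 0 else if x ^+ n == 1 then 1 else -1.

Lemma leg0 : leg 0 = 0. Proof. by rewrite /leg eqxx. Qed.
Lemma leg1 : leg 1 = 1. Proof. by rewrite /leg oner_eq0 expr1n eqxx. Qed.

Lemma legM (x y : 'F_p) : leg (x * y) = leg x * leg y.
Proof.
rewrite /leg mulf_eq0; have [//=|x0] := eqVneq x 0; rewrite ?mul0r //=.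
have [//=|y0] := eqVneq y 0; rewrite ?mulr0 //= exprMn.
have := one_neqN1; rewrite eq_sym => /negPf h.
have [->|->] := chi_pm1 x0; have [->|->] := chi_pm1 y0; rewrite ?mulr1 ?mul1r ?mulrNN ?mulr1 ?eqxx ?h ?mulrN ?mulr1 //.
Qed.

Lemma leg_sqr (y : 'F_p) : y != 0 -> leg (y ^+ 2) = 1.
Proof.
by move=> y0; rewrite /leg expf_eq0 (negPf y0) andbF -exprM mulnC double_half_pred Fp_fermat // eqxx.
Qed.

Lemma leg_pm1 (x : 'F_p) : x != 0 -> leg x = 1 \/ leg x = -1.
Proof. by move=> x0; rewrite /leg (negPf x0); case: ifP; [left | right]. Qed.

Lemma leg_eq0 (x : 'F_p) : (leg x == 0) = (x == 0).
Proof. by rewrite /leg; case: ifP => //; case: ifP. Qed.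

Lemma legendreE (a : nat) : legendre a p = leg a%:R.
Proof.
rewrite /legendre /leg (dvdn_pcharf (pchar_Fp pp)); case: eqVneq => // a0.
have -> : [exists x : 'I_p, ((x * x) %% p == a %% p)%N] = ((a%:R : 'F_p) ^+ n == 1).
  apply/existsP/eqP => [[x /eqP ex]|/(chi_sqr a0)[y ey]].
    have e : (a%:R : 'F_p) = x%:R ^+ 2.
      by rewrite -natrX expnS expn1 -(Fp_nat_mod pp a) -ex Fp_nat_mod.
    rewrite e -exprM mulnC double_half_pred Fp_fermat //.
    by apply: contraNneq a0 => x0; rewrite e x0 expr0n.
  have hy : (y < p)%N by rewrite -{2}(Fp_cast pp).
  exists (Ordinal hy) => /=; rewrite -!val_Fp_nat // natrM; apply/eqP; congr (nat_of_ord _).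
  by rewrite ey expr2 natr_Zp.
by [].
Qed.

Lemma leg_nonres : exists c : 'F_p, leg c = -1.
Proof.
have [g hg] := Fp_prim_root; exists g.
have g0 : g != 0.
  apply/eqP => g0; have := prim_expr_order hg; rewrite g0 expr0n.
  by have := p2; case: (p) => [|[|?]] //= _ /eqP; rewrite eq_sym oner_eq0.
have [|//] := leg_pm1 g0; rewrite /leg (negPf g0); case: ifP => // /eqP /eqP.
by rewrite -(prim_order_dvd hg) => /dvdn_leq; have := half_pred_gt0; have := double_half_pred; lia.
Qed.

Lemma leg_N1 : (p %% 4 = 1)%N -> leg (-1) = 1.
Proof.
move=> p4; rewrite /leg oppr_eq0 oner_eq0 -signr_odd.
have -> : odd n = false by lia.
by rewrite expr0 eqxx.
Qed.

Section GaussSum.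
Variable z : algC.
Hypothesis hz : p.-primitive_root z.

(** The additive character of ['F_p] attached to [z]. *)
Definition ech (a : 'F_p) : algC := z ^+ a.

Lemma ech_nat (a : nat) : ech a%:R = z ^+ a.
Proof. by rewrite /ech val_Fp_nat // prim_expr_mod. Qed.

Lemma echD a b : ech (a + b) = ech a * ech b.
Proof. by rewrite -[a]natr_Zp -[b]natr_Zp -natrD !ech_nat exprD. Qed.

Lemma ech0 : ech 0 = 1. Proof. exact: (ech_nat 0). Qed.

Lemma echX a m : ech a ^+ m = ech (m%:R * a).
Proof. by rewrite -[a]natr_Zp -natrM !ech_nat -exprM mulnC. Qed.

Lemma ech_Aint a : ech a \in Aint.
Proof. by apply: rpredX; exact: Aint_prim_root hz. Qed.

Lemma sum_ech : \sum_a ech a = 0.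
Proof.
have h : \sum_a ech a = z * \sum_a ech a.
  rewrite [LHS](reindex (fun a => 1 + a)) /=; last first.
    by exists (fun a => a - 1) => a _; ring.
  by rewrite mulr_sumr; apply: eq_bigr => a _; rewrite echD (ech_nat 1).
have z1 : z != 1.
  apply/eqP => z1; have := prim_order_dvd hz 1; rewrite z1 expr1n eqxx dvdn1.
  by have := p2; lia.
apply/eqP; move/eqP: h; rewrite -subr_eq0 -{1}[\sum_a _]mul1r -mulrBl mulf_eq0 subr_eq0.
by rewrite eq_sym (negPf z1).
Qed.

Lemma sum_echM c : \sum_a ech (c * a) = if c == 0 then p%:R else 0.
Proof.
case: eqVneq => [->|c0].
  under eq_bigr do rewrite mul0r ech0.
  by rewrite big_const -Monoid.iteropE /= card_Fp.
rewrite -[RHS]sum_ech [RHS](reindex (fun a => c * a)) //.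
by exists (fun a => c^-1 * a) => a _; rewrite ?mulKf ?mulVKf.
Qed.

Definition gauss : algC := \sum_a (leg a)%:~R * ech a.

Lemma gauss_Aint : gauss \in Aint.
Proof. by apply: rpred_sum => a _; apply: rpredM; [exact: Aint_int | exact: ech_Aint]. Qed.

Lemma sum_leg : \sum_a leg a = 0.
Proof.
have [c hc] := leg_nonres.
have c0 : c != 0 by apply: contra_eqT hc => /negPn /eqP ->; rewrite leg0.
have h : \sum_a leg a = - \sum_a leg a.
  rewrite {1}(reindex (fun a => c * a)) /=; last first.
    by exists (fun a => c^-1 * a) => a _; rewrite ?mulKf ?mulVKf.
  by rewrite -sumrN; apply: eq_bigr => a _; rewrite legM hc mulN1r.
by move: (\sum_a _) h => s; lia.
Qed.

Lemma gauss_twist (c : 'F_p) : c != 0 -> \sum_a (leg a)%:~R * ech (c * a) = (leg c)%:~R * gauss.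
Proof.
move=> c0; rewrite /gauss [in RHS](reindex (fun a => c * a)) /=; last first.
  by exists (fun a => c^-1 * a) => a _; rewrite ?mulKf ?mulVKf.
rewrite mulr_sumr; apply: eq_bigr => a _; rewrite legM rmorphM /= !mulrA -!rmorphM /=.
by rewrite -[leg c * leg c]legM -expr2 leg_sqr // mul1r.
Qed.

Hypothesis p4 : (p %% 4 = 1)%N.

(** Substituting [a * b] for the second summation variable makes the symbol of [a] disappear. The
    missing terms [a = 0] can be added because the symbols sum to zero; then only [b = -1]
    contributes, with value [p], as -1 is a square. *)
Lemma gauss_sqr : gauss ^+ 2 = p%:R.
Proof.
have -> : gauss ^+ 2 = \sum_b \sum_a (leg b)%:~R * ech ((1 + b) * a) - (leg 0)%:~R.
  rewrite expr2 {1}/gauss mulr_suml.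
  transitivity (\sum_a \sum_b (if a == 0 then 0 else (leg b)%:~R * ech ((1 + b) * a))).
    apply: eq_bigr => a _; case: eqVneq => [->|a0].
      by rewrite leg0 !mul0r big1.
    rewrite mulr_sumr (reindex (fun b => a * b)) /=; last first.
      by exists (fun b => a^-1 * b) => b _; rewrite ?mulKf ?mulVKf.
    apply: eq_bigr => b _; rewrite legM rmorphM /=.
    transitivity ((leg a * leg a)%:~R * (leg b)%:~R * (ech a * ech (a * b))).
      by rewrite rmorphM /=; ring.
    by rewrite -legM -expr2 leg_sqr // mul1r -echD; congr (_ * ech _); ring.
  rewrite exchange_big /= leg0 subr0.
  transitivity (\sum_b (\sum_a (leg b)%:~R * ech ((1 + b) * a) - (leg b)%:~R)).
    apply: eq_bigr => b _; rewrite (bigD1 0) //= ?eqxx add0r [in RHS](bigD1 0) //= mulr0 ech0 mulr1.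
    by rewrite [RHS]addrC addKr; apply: eq_bigr => a /negPf ->.
  by rewrite sumrB -rmorph_sum sum_leg subr0.
rewrite leg0 subr0.
under eq_bigr do rewrite -mulr_sumr sum_echM.
rewrite (bigD1 (-1)) //= subrr eqxx leg_N1 // mul1r big1 ?addr0 // => b hb.
by rewrite addrC addr_eq0 (negPf hb) mulr0.
Qed.
End GaussSum.
End Legendre.

Arguments leg : clear implicits.

(** * Reciprocity, and automorphisms changing the sign of one square root *)

Lemma Aint_FrobeniusD q x y : prime q -> x \in Aint -> y \in Aint ->
  ((x + y) ^+ q == x ^+ q + y ^+ q %[mod q])%A.
Proof.
move=> pq hx hy; rewrite /eqAmod exprDn.
case: q pq => // q pq; rewrite big_ord_recl big_ord_recr /= subn0 expr0 mulr1 bin0 mulr1n.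
rewrite /bump /= add1n subnn expr0 mul1r binn mulr1n.
set S := \sum_(i < q) _.
have -> : x ^+ q.+1 + (S + y ^+ q.+1) - (x ^+ q.+1 + y ^+ q.+1) = S by ring.
apply: rpred_sum => i _; rewrite -[_ *+ 'C(_, _)]mulr_natr.
have /dvdnP[c ->] : (q.+1 %| 'C(q.+1, bump 0 i))%N by apply: prime_dvd_bin => //; rewrite /bump leq0n add1n !ltnS /=.
rewrite natrM mulrA -eqAmod0 eqAmodMl0 //.
by apply: rpredM; [apply: rpredM; exact: rpredX | exact: rpred_nat].
Qed.

Lemma Aint_Frobenius_sum q (I : finType) (f : I -> algC) : prime q ->
  (forall i, f i \in Aint) ->
  ((\sum_i f i) ^+ q == \sum_i f i ^+ q %[mod q])%A.
Proof.
move=> pq hf; elim: (index_enum I) => [|i s ih]; first by rewrite !big_nil expr0n gtn_eqF ?prime_gt0.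
rewrite !big_cons; apply: eqAmod_trans (Aint_FrobeniusD pq (hf i) _) _.
  by apply: rpred_sum => j _.
by rewrite eqAmodDl.
Qed.

Lemma dvdA_int (q : nat) (a : int) : (0 < q)%N -> (q %| a%:~R)%A -> (q %| a)%Z.
Proof.
move=> q0; rewrite unfold_in pnatr_eq0 gtn_eqF // => h.
have /intrP[c ec] : (a%:~R / q%:R : algC) \is a Num.int.
  by apply: Cint_rat_Aint h; apply: rpred_div; [exact: rpred_int | exact: rpred_nat].
apply/dvdzP; exists c; apply: (@intr_inj algC); rewrite rmorphM /= -ec divfK //.
by rewrite pnatr_eq0 -lt0n.
Qed.

Section OnePrime.
Variable p : nat.
Hypotheses (pp : prime p) (p4 : (p %% 4 = 1)%N).

Lemma p1mod4_gt2 : (2 < p)%N.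
Proof. by have := prime_gt1 pp; have := p4; case: (p) => [|[|[|?]]]. Qed.
Let p2 := p1mod4_gt2.
Lemma p1mod4_odd : odd p. Proof. by have := p4; lia. Qed.
Let po := p1mod4_odd.

Lemma leg_int q (a : int) : prime q -> (2 < q)%N -> odd q -> a%:~R ^+ q.-1./2 = (leg q a%:~R)%:~R :> 'F_q.
Proof.
move=> pq q2 qo; rewrite /leg; case: eqVneq => [->|a0].
  by rewrite expr0n gtn_eqF //; lia.
by case: eqP => // h; have [|->] := chi_pm1 pq q2 qo a0.
Qed.

(** [G ^+ q] is computed modulo [q] twice: by Frobenius and a change of variable, and from
    [G ^+ 2 = p]. Multiplying the comparison by [G] gives a congruence between integers; a
    difference of two signs divisible by the odd [q] is zero. *)
Lemma leg_reciprocity q : prime q -> (2 < q)%N -> p != q -> odd q ->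
  leg p q%:R = leg q p%:R.
Proof.
move=> pq q2 npq qo.
have [z hz] := C_prim_root_exists (prime_gt0 pp).
have q0 : (q%:R : 'F_p) != 0.
  by rewrite -(dvdn_pcharf (pchar_Fp pp)) dvdn_prime2.
set G := gauss p z.
have GA : G \in Aint by exact: gauss_Aint.
have sq : G ^+ 2 = p%:R by exact: gauss_sqr.
have e1 : (G ^+ q == (leg p q%:R)%:~R * G %[mod q])%A.
  rewrite -gauss_twist //; apply: eqAmod_trans (Aint_Frobenius_sum pq _) _.
    by move=> a; apply: rpredM; [exact: Aint_int | exact: ech_Aint].
  under eq_bigr => a _.
    have -> : ((leg p a)%:~R * ech z a) ^+ q = (leg p a)%:~R * ech z (q%:R * a).
      rewrite exprMn echX //; congr (_ * _).
      have [->|a0] := eqVneq a 0; first by rewrite leg0 expr0n gtn_eqF ?prime_gt0.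
      have [->|->] := leg_pm1 a0; first by rewrite expr1n.
      by rewrite rmorphN -signr_odd qo.
  over.
  exact: eqAmod_refl.
have hq : q = (q.-1./2 * 2).+1 by rewrite double_half_pred // prednK // prime_gt0.
have e2 : (G ^+ q == (leg q p%:R)%:~R * G %[mod q])%A.
  have -> : G ^+ q = p%:R ^+ q.-1./2 * G by rewrite -sq -exprM -exprSr mulnC -hq.
  apply: eqAmodMr => //.
  rewrite /eqAmod -natrX -[(_ ^ _)%:R]/((p ^ q.-1./2)%N%:Z%:~R) -rmorphB /=.
  have /dvdzP[c ->] : (q %| (p ^ q.-1./2)%N%:Z - leg q p%:R)%Z.
    rewrite (dvdz_pcharf (pchar_Fp pq)) rmorphB /= subr_eq0 -(leg_int p) //.
    by rewrite -[_%:~R]/((p ^ q.-1./2)%N%:R) natrX.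
  by rewrite rmorphM /= -eqAmod0 eqAmodMl0 // Aint_int.
have e3 : ((leg p q%:R)%:~R * G == (leg q p%:R)%:~R * G %[mod q])%A.
  by apply: eqAmod_trans e2; rewrite eqAmod_sym.
have : (q %| ((leg p q%:R - leg q p%:R) * p)%:~R)%A.
  have -> : ((leg p q%:R - leg q p%:R) * p)%:~R =
      (((leg p q%:R)%:~R * G) - ((leg q p%:R)%:~R * G)) * G.
    by rewrite rmorphM rmorphB /= -[p%:~R]sq; ring.
  by have := eqAmodMr GA e3; rewrite /eqAmod mulrBl.
move/(dvdA_int (prime_gt0 pq)); rewrite dvdzE abszM Euclid_dvdM //.
have -> : (`|q| %| `|p|)%N = false by rewrite /= dvdn_prime2 // eq_sym (negPf npq).
rewrite orbF /=.
have p0 : (p%:R : 'F_q) != 0.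
  by rewrite -(dvdn_pcharf (pchar_Fp pq)) dvdn_prime2 // eq_sym.
have [->|->] := leg_pm1 q0; have [->|->] := leg_pm1 p0 => //.
  by move/dvdn_leq => /(_ isT); rewrite leqNgt q2.
by move/dvdn_leq => /(_ isT); rewrite leqNgt q2.
Qed.

Lemma sqrt_gauss z : p.-primitive_root z ->
  exists e : int, sqrtC p%:R = e%:~R * gauss p z.
Proof.
move=> hz; have /eqP := gauss_sqr pp p2 po hz p4.
rewrite -[p%:R in X in X -> _]sqrtCK eqf_sqr => /orP[] /eqP ->.
  by exists 1; rewrite mul1r.
by exists (-1); rewrite rmorphN mulNr mul1r opprK.
Qed.

Lemma sqrt_fixed (u : {rmorphism algC -> algC}) :
  (forall z, z ^+ p = 1 -> u z = z) -> u (sqrtC p%:R) = sqrtC p%:R.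
Proof.
move=> hu; have [z hz] := C_prim_root_exists (prime_gt0 pp).
have [e ->] := sqrt_gauss hz.
rewrite rmorphM rmorph_int rmorph_sum; congr (_ * _); apply: eq_bigr => a _.
by rewrite rmorphM rmorph_int rmorphXn /= hu // prim_expr_order.
Qed.

(** The square root of [p] is, up to sign, a Gauss sum, and raising [p]-th roots of unity to a power
    [t] multiplies this sum by the symbol of [t]. The Chinese remainder theorem provides a [t] that
    is a nonresidue modulo [p] and 1 modulo [m]. *)
Lemma flip_aut m : (0 < m)%N -> coprime p m ->
  exists u : {rmorphism algC -> algC},
    u (sqrtC p%:R) = - sqrtC p%:R /\ forall z, z ^+ m = 1 -> u z = z.
Proof.
move=> m0 cpm; have [c hc] := leg_nonres pp p2 po.
have c0 : c != 0 by apply: contra_eqT hc => /negPn /eqP ->; rewrite leg0.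
pose t := chinese p m c 1.
have tp : (t%:R : 'F_p) = c by rewrite -(Fp_nat_mod pp) chinese_modl // Fp_nat_mod // natr_Zp.
have tm : t = 1 %[mod m] by exact: chinese_modr.
have ct : coprime t (p * m).
  rewrite coprimeMr; apply/andP; split.
    by rewrite coprime_sym prime_coprime // (dvdn_pcharf (pchar_Fp pp)) tp.
  by rewrite -coprime_modl tm coprime_modl coprime1n.
have [u hu] := Qn_aut_exists ct.
have [z hz] := C_prim_root_exists (prime_gt0 pp).
exists u; split; last first.
  move=> y hy; rewrite hu; last by rewrite mulnC exprM hy expr1n.
  have modE j : y ^+ (j %% m) = y ^+ j.
    by rewrite {2}(divn_eq j m) exprD mulnC exprM hy expr1n mul1r.
  by rewrite -modE tm modE expr1.
have [e ->] := sqrt_gauss hz.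
rewrite rmorphM rmorph_int -mulrN; congr (_ * _).
have -> : u (gauss p z) = \sum_a (leg p a)%:~R * ech z (c * a).
  rewrite rmorph_sum; apply: eq_bigr => a _.
  rewrite rmorphM rmorph_int /=; congr (_ * _).
  rewrite -tp -(echX pp hz) hu //.
  by rewrite /ech -exprM mulnCA exprM (prim_expr_order hz) expr1n.
by rewrite gauss_twist // hc rmorphN mulNr mul1r.
Qed.
End OnePrime.

(** For a square root [w] of ['i], an eighth root of unity, [w + w^-1] is a square root of 2. *)
Lemma aut_i8 (u : {rmorphism algC -> algC}) :
  (forall z, z ^+ 8 = 1 -> u z = z) -> u 'i = 'i /\ u (sqrtC 2) = sqrtC 2.
Proof.
move=> hu; have i4 : ('i : algC) ^+ 4 = 1 by rewrite (exprM _ 2 2) sqrCi sqrrN expr1n.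
pose w : algC := sqrtC 'i; have w2 : w ^+ 2 = 'i by rewrite sqrtCK.
have w8 : w ^+ 8 = 1 by rewrite (exprM _ 2 4) w2.
have uw := hu _ w8.
split; first by rewrite -w2 rmorphXn /= uw.
have w0 : w != 0 by rewrite sqrtC_eq0 neq0Ci.
have e : (w + w^-1) ^+ 2 = 2.
  rewrite sqrrD mulfV // exprVn w2.
  by rewrite invCi; ring.
have uf : u (w + w^-1) = w + w^-1 by rewrite rmorphD fmorphV /= uw.
have : sqrtC 2 ^+ 2 == (w + w^-1) ^+ 2 by rewrite e sqrtCK.
rewrite eqf_sqr => /orP[] /eqP -> //.
by rewrite rmorphN /= uf.
Qed.

(** Pigeonhole: the fractional parts of [y * s] for [0 <= y <= Q] fall into [Q] intervals of length
    [1 / Q]. *)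
Lemma dirichlet_approx (R : archiRealFieldType) (s : R) (Q : nat) : (0 < Q)%N ->
  exists X Y : int, [/\ 0 < Y, Y <= Q & `|X%:~R - Y%:~R * s| * Q%:R < 1].
Proof.
move=> Q0; pose fr (y : nat) := y%:R * s - (Num.floor (y%:R * s))%:~R.
have fr_itv y : 0 <= fr y < 1.
  by rewrite /fr; have := floor_itv (y%:R * s); rewrite rmorphD /=; lra.
pose b (y : nat) := Num.floor (Q%:R * fr y).
have Qr : 0 < Q%:R :> R by rewrite ltr0n.
have b_itv y : 0 <= b y < Q.
  rewrite /b; have := floor_itv (Q%:R * fr y); have := fr_itv y => /andP[h1 h2].
  rewrite rmorphD /= => /andP[h3 h4].
  have h5 : Q%:R * fr y < Q%:Z%:~R by rewrite -[ltRHS]mulr1 ltr_pM2l.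
  have h6 : 0 <= Q%:R * fr y by rewrite mulr_ge0 // ltW.
  apply/andP; split; last by rewrite -(ltr_int R); lra.
  by rewrite -ltzD1 -(ltr_int R) rmorphD /=; lra.
have bl (y : 'I_Q.+1) : (`|b y| < Q)%N by have := b_itv y; lia.
pose c (y : 'I_Q.+1) : 'I_Q := Ordinal (bl y).
have [i [j [lt eij]]] : exists i j : 'I_Q.+1, (i < j)%N /\ b i = b j.
  have /injectivePn[i [j ne e]] : ~~ injectiveb c.
    apply/negP => /injectiveP /leq_card; rewrite !card_ord; lia.
  have e' : b i = b j.
    by have := congr1 val e; rewrite /=; have := b_itv i; have := b_itv j; lia.
  case: (ltngtP i j) => h; [by exists i, j | by exists j, i | ].
  by case/eqP: ne; apply: val_inj.
exists (Num.floor (j%:R * s) - Num.floor (i%:R * s)), (j%:Z - i%:Z); split.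
- by lia.
- by have := ltn_ord j; lia.
have -> : (Num.floor (j%:R * s) - Num.floor (i%:R * s))%:~R - (j%:Z - i%:Z)%:~R * s = fr i - fr j.
  by rewrite /fr !rmorphB /=; ring.
have := floor_itv (Q%:R * fr i); have := floor_itv (Q%:R * fr j).
rewrite -/(b i) -/(b j) eij => h1 h2.
rewrite -[X in _ * X](@ger0_norm _ Q%:R) ?ltW // -normrM ltr_norml.
move: h1 h2; rewrite rmorphD /=; lra.
Qed.

(** * Units of norm -1 *)

Section PellEquation.
Variables (D : nat) (R : archiRealFieldType) (s : R).
Hypotheses (nsq : forall x y : int, x ^+ 2 = D%:Z * y ^+ 2 -> y = 0)
  (s_ge0 : 0 <= s) (sqr_s : s ^+ 2 = D%:R).

Lemma pell_err (X Y : int) : Y != 0 -> 0 < `|X%:~R - Y%:~R * s|.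
Proof.
move=> Y0; rewrite normr_gt0 subr_eq0; apply/eqP => e; case/eqP: Y0.
apply: (@nsq X); apply: (@intr_inj R).
by rewrite rmorphXn /= e exprMn sqr_s rmorphM rmorphXn /= mulrC.
Qed.

(** An integer above [2 * s + 1], the classical bound for the norm of a Dirichlet approximation: its
    error [d] satisfies [Y * |d| < 1], and its conjugate is at most [|d| + 2 * Y * s]. *)
Definition pell_bound : nat := `|Num.floor (2 * s + 1)|.+1.

Lemma pell_near (X Y : int) (Q : nat) : 0 < Y -> Y <= Q -> `|X%:~R - Y%:~R * s| * Q%:R < 1 ->
  `|X ^+ 2 - D%:Z * Y ^+ 2| <= pell_bound%:Z.
Proof.
move=> Y0 YQ h; have s0 := s_ge0.
set d := X%:~R - Y%:~R * s in h.
have Yr : 1 <= Y%:~R :> R by rewrite -[1]/(1%:~R) ler_int; lia.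
have YQr : Y%:~R <= Q%:R :> R by rewrite -[Q%:R]/(Q%:Z%:~R) ler_int.
have h1 : `|d| * Y%:~R < 1 by apply: le_lt_trans h; apply: ler_wpM2l.
have e : (X ^+ 2 - D%:Z * Y ^+ 2)%:~R = d * (d + 2 * Y%:~R * s) :> R.
  rewrite rmorphB rmorphXn [X in _ - X]rmorphM rmorphXn /=.
  have -> : (D%:Z%:~R : R) = s ^+ 2 by rewrite sqr_s.
  by rewrite /d; ring.
have h3 : `|(X ^+ 2 - D%:Z * Y ^+ 2)%:~R| < 2 * s + 1 :> R.
  rewrite e normrM; have h4 : `|d + 2 * Y%:~R * s| <= `|d| + 2 * Y%:~R * s.
    apply: le_trans (ler_normD _ _) _; rewrite lerD2l ger0_norm //.
    by rewrite !mulr_ge0 //; lra.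
  apply: le_lt_trans (ler_wpM2l (normr_ge0 _) h4) _.
  have d0 := normr_ge0 d; nra.
have [f1 f2] := andP (floor_itv (2 * s + 1)).
have f0 : 0 <= Num.floor (2 * s + 1).
  by rewrite -ltzD1 -(ltr_int R); lra.
have -> : pell_bound%:Z = Num.floor (2 * s + 1) + 1 by rewrite /pell_bound; lia.
by rewrite -(ler_int R) intr_norm; lra.
Qed.

(** No pair of the list approximates [s] within [1 / Q], whereas the next Dirichlet pair does; it is
    therefore new. *)
Lemma pell_list m : exists (l : seq (int * int)) (Q : nat), [/\ size l = m, uniq l,
    (0 < Q)%N,
    (forall x, x \in l -> 1 <= `|x.1%:~R - x.2%:~R * s| * Q%:R) &
    (forall x, x \in l -> 0 < x.2 /\ `|x.1 ^+ 2 - D%:Z * x.2 ^+ 2| <= pell_bound%:Z)].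
Proof.
elim: m => [|m [l [Q [hs hu Q0 hQ hl]]]]; first by exists [::], 1%N.
have [X [Y [Y0 YQ hXY]]] := dirichlet_approx s Q0.
have err : 0 < `|X%:~R - Y%:~R * s| by apply: pell_err; lia.
set e := `|_| in hXY err.
have [f1 f2] := andP (floor_itv e^-1).
(* The increment exceeds the inverse of the error [e] of the new pair, so the invariant holds for
   old and new pairs alike. *)
exists ((X, Y) :: l), (Q + `|Num.floor e^-1|.+1)%N; split.
- by rewrite /= hs.
- rewrite /= hu andbT; apply/negP => /hQ /=; rewrite -/e; lra.
- by lia.
- move=> x; rewrite inE natrD mulrDr => /orP[/eqP -> /=|/hQ h]; last first.
    by apply: le_trans h _; rewrite lerDl mulr_ge0.
  rewrite -/e; apply: (@le_trans _ _ (e * `|Num.floor e^-1|.+1%:R)); last first.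
    by rewrite lerDr mulr_ge0 // ltW.
  rewrite -ler_pdivrMl // mulr1.
  have f0 : 0 <= Num.floor e^-1.
    by rewrite -ltzD1 -(ltr_int R); apply: le_lt_trans f2; rewrite invr_ge0 ltW.
  have -> : (`|Num.floor e^-1|.+1%:R : R) = (Num.floor e^-1 + 1)%:~R.
    by rewrite -[_%:R]/(_%:Z%:~R); congr (_%:~R); lia.
  exact: ltW.
- move=> x; rewrite inE => /orP[/eqP -> /=|/hl //]; split=> //.
  exact: (pell_near Y0 YQ).
Qed.

Lemma pigeonhole (T : eqType) (C : finType) (c : T -> C) (l : seq T) :
  uniq l -> (#|C| < size l)%N -> exists x y, [/\ x \in l, y \in l, x != y & c x = c y].
Proof.
move=> hu hs; apply: NNPP => h.
have inj : {in l &, injective c}.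
  move=> x y hx hy e; apply/eqP; apply: contraT => ne; case: h.
  by exists x, y.
have : uniq (map c l) by rewrite map_inj_in_uniq.
move/card_uniqP; rewrite size_map => e; move: hs; rewrite -e ltnNge.
by rewrite max_card.
Qed.

(** Two different pairs with the same norm [N], congruent modulo [N], have a quotient with integral
    coordinates and norm 1. *)
Lemma pell_exists_aux : exists x y : int, 0 < y /\ x ^+ 2 = D%:Z * y ^+ 2 + 1.
Proof.
(* [M] factorial is divisible by every possible norm, so one modulus serves for all of them. The
   colour records the norm, shifted by [M] to be nonnegative, and both coordinates modulo [L]. *)
pose M := pell_bound; pose L := M`!; have L0 : (0 < L)%N := fact_gt0 M.
pose c (x : int * int) : 'I_(2 * M).+1 * 'I_L.-1.+1 * 'I_L.-1.+1 :=
  (inord `|(x.1 ^+ 2 - D%:Z * x.2 ^+ 2) + M%:Z|, inord `|(x.1 %% L%:Z)%Z|, inord `|(x.2 %% L%:Z)%Z|).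
have [l [Q [hs hu _ _ hl]]] := pell_list #|{: 'I_(2 * M).+1 * 'I_L.-1.+1 * 'I_L.-1.+1}|.+1.
have [|[X Y] [[X' Y'] [hx hy ne exy]]] := pigeonhole c hu; first by rewrite hs.
have /= [Y0 hN] := hl _ hx; have /= [Y0' hN'] := hl _ hy; rewrite -/M in hN hN'.
have /eqP : c (X, Y) = c (X', Y') by [].
rewrite !xpair_eqE /= => /andP[/andP[/eqP e1 /eqP e2] /eqP e3].
set N := X ^+ 2 - D%:Z * Y ^+ 2 in e1 hN; set N' := X' ^+ 2 - _ in e1 hN'.
have eN : N = N'.
  have := congr1 val e1; rewrite /= !inordK; try lia.
have modL (z : int) : `|(z %% L%:Z)%Z|%N%:Z = (z %% L%:Z)%Z.
  by rewrite gez0_abs // modz_ge0 // eqz_nat -lt0n.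
have modL' (z : int) : (`|(z %% L%:Z)%Z| < L.-1.+1)%N.
  by rewrite prednK // -ltz_nat modL ltz_pmod.
have eX : (X = X' %[mod L%:Z])%Z.
  by have := congr1 val e2; rewrite /= !inordK // => h; rewrite -(modL X) h modL.
have eY : (Y = Y' %[mod L%:Z])%Z.
  by have := congr1 val e3; rewrite /= !inordK // => h; rewrite -(modL Y) h modL.
have N0 : N != 0.
  apply/eqP => h; have : Y = 0 by apply: (nsq (x := X)); move: h; rewrite /N => /eqP; rewrite subr_eq0 => /eqP.
  by move=> e; rewrite e ltxx in Y0.
have dL : (N %| L%:Z)%Z.
  by rewrite dvdzE; apply: dvdn_fact; rewrite absz_gt0 N0 -lez_nat.
have dX : (N %| X' - X)%Z by apply: dvdz_trans dL _; rewrite -eqz_mod_dvd; apply/eqP.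
have dY : (N %| Y' - Y)%Z by apply: dvdz_trans dL _; rewrite -eqz_mod_dvd; apply/eqP.
have [a ea] := dvdzP dX; have [b eb] := dvdzP dY.
have eX' : X' = X + a * N by rewrite -ea; ring.
have eY' : Y' = Y + b * N by rewrite -eb; ring.
(* The coordinates of [(X' + Y' s)(X - Y s) / N = 1 + (a + b s)(X - Y s)]. *)
pose x := 1 + X * a - D%:Z * Y * b; pose y := X * b - a * Y.
have e : x ^+ 2 - D%:Z * y ^+ 2 = 1.
  apply: (mulfI (mulf_neq0 N0 N0)); rewrite mulr1 {4}eN.
  by rewrite /N' eX' eY' /x /y /N; ring.
have y0 : y != 0.
  apply/eqP => y0; case/eqP: ne.
  have hxy : X * Y' = X' * Y.
    have : X * Y' - X' * Y = N * y by rewrite eX' eY' /y; ring.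
    by rewrite y0 mulr0 => /eqP; rewrite subr_eq0 => /eqP.
  have eYY : Y ^+ 2 = Y' ^+ 2.
    apply: (mulfI N0); rewrite {1}eN; transitivity ((X' * Y) ^+ 2 - D%:Z * (Y * Y') ^+ 2).
      by rewrite /N'; ring.
    by rewrite -hxy /N; ring.
  have eY1 : Y = Y'.
    move/eqP: eYY; rewrite eqf_sqr => /orP[/eqP //|/eqP h].
    by move: Y0; rewrite h oppr_gt0 ltNge (ltW Y0').
  congr (_, _) => //; apply: (mulIf (x := Y)); first by rewrite gt_eqF.
  by rewrite -hxy eY1.
exists x, `|y|; rewrite normr_gt0 y0; split=> //.
by rewrite real_normK ?num_real // -e addrC subrK.
Qed.

End PellEquation.

Lemma pell_exists (D : nat) : (forall x y : int, x ^+ 2 = D%:Z * y ^+ 2 -> y = 0) ->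
  exists x y : int, 0 < y /\ x ^+ 2 = D%:Z * y ^+ 2 + 1.
Proof.
move=> nsq; apply: (@pell_exists_aux D realalg (Num.sqrt D%:R) nsq); first exact: sqrtr_ge0.
by rewrite sqr_sqrtr // ler0n.
Qed.

(** * Descent from norm 1 to norm -1 *)

Lemma coprime_mul_sqr (u w v : nat) : coprime u w -> (u * w = v ^ 2)%N -> exists a, (u = a ^ 2)%N.
Proof.
move=> cuw e; exists (gcdn u v).
have -> : (gcdn u v ^ 2 = u * gcdn (gcdn u v) (gcdn v w))%N.
  by rewrite expnS expn1 muln_gcdl !muln_gcdr [(v * u)%N]mulnC [(v * v)%N]mulnn -e.
suff -> : gcdn (gcdn u v) (gcdn v w) = 1%N by rewrite muln1.
apply/eqP; rewrite -dvdn1 -(eqP cuw) dvdn_gcd; apply/andP; split.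
  exact: dvdn_trans (dvdn_gcdl _ _) (dvdn_gcdl _ _).
exact: dvdn_trans (dvdn_gcdr _ _) (dvdn_gcdr _ _).
Qed.

Lemma coprime_mul_sqr_split (D u w v : nat) : (0 < D)%N -> coprime u w -> (u * w = D * v ^ 2)%N ->
  exists A B a b, [/\ (A * B = D)%N, (u = A * a ^ 2)%N & (w = B * b ^ 2)%N].
Proof.
move=> D0 cuw e; have [A0 B0] : (0 < gcdn u D)%N /\ (0 < gcdn w D)%N by rewrite !gcdn_gt0 D0 !orbT.
have eAB : (gcdn u D * gcdn w D = D)%N.
  apply/eqP; rewrite eqn_dvd; apply/andP; split.
    rewrite Gauss_dvd ?dvdn_gcdr //.
    by apply: coprime_dvdl (dvdn_gcdl _ _) _; apply: coprime_dvdr (dvdn_gcdl _ _) _.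
  rewrite muln_gcdl !muln_gcdr !dvdn_gcd e.
  by rewrite (dvdn_mulr _ (dvdnn D)) (dvdn_mull u (dvdnn D)) !(dvdn_mulr _ (dvdnn D)).
have [u' eu] := dvdnP (dvdn_gcdl u D); have [w' ew] := dvdnP (dvdn_gcdl w D).
set A := gcdn u D in A0 eAB eu; set B := gcdn w D in B0 eAB ew.
have e' : (u' * w' = v ^ 2)%N.
  apply/eqP; rewrite -(eqn_pmul2l D0) -{1}eAB -e eu ew; apply/eqP; nia.
have cu : coprime u' w'.
  apply: (@coprime_dvdl _ u); first by rewrite eu dvdn_mulr.
  by apply: (@coprime_dvdr _ w) => //; rewrite ew dvdn_mulr.
have [a ea] := coprime_mul_sqr cu e'.
have [b eb] : exists b, (w' = b ^ 2)%N.
  by apply: (@coprime_mul_sqr _ u' v); rewrite 1?coprime_sym // mulnC.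
by exists A, B, a, b; split; rewrite // -?ea -?eb mulnC.
Qed.

(** The valuation at [q] is even on the left and odd on the right unless [y] vanishes. *)
Lemma nonsquare_prime_mul (q m : nat) : prime q -> ~~ (q %| m)%N ->
  forall x y : int, x ^+ 2 = (q * m)%N%:Z * y ^+ 2 -> y = 0.
Proof.
move=> pq nd x y e; apply/eqP; apply: contraT => y0.
have m0 : (0 < m)%N by case: (m) nd; rewrite ?dvdn0.
have e1 : (`|x| ^ 2 = q * m * `|y| ^ 2)%N by rewrite -!abszX e abszM.
have y1 : (0 < `|y|)%N by rewrite absz_gt0.
have x1 : (0 < `|x|)%N.
  rewrite lt0n; apply: contraTneq y1 => x0; move: e1; rewrite x0 exp0n // => /esym/eqP.
  by have := prime_gt0 pq; move: m0; rewrite !muln_eq0; lia.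
have := congr1 (logn q) e1; rewrite !lognM ?muln_gt0 ?expn_gt0 ?x1 ?y1 ?m0 ?prime_gt0 //.
by rewrite (logn_prime q pq) eqxx (lognE q m) (negPf nd) !andbF; lia.
Qed.

(** In a solution with minimal [y], write [x = 2 u + 1] and [y = 2 v]: then [u (u + 1) = D v^2] with
    coprime factors, which splits [D] as [A * B]. The case [B = 1] would be a solution of Pell's
    equation with [a < y]. *)
Lemma pell_descent (D : nat) : (forall x y : int, x ^+ 2 = D%:Z * y ^+ 2 -> y = 0) ->
  (D %% 4 = 1 \/ D %% 4 = 2)%N ->
  exists A B a b : nat, [/\ (A * B = D)%N, B != 1%N & (B * b ^ 2 = A * a ^ 2 + 1)%N].
Proof.
move=> nsq D4; have [x0 [y0 [y0_gt0 e0]]] := pell_exists nsq.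
have D0 : (0 < D)%N by case: D4; case: (D).
have [|y [[y_gt0 [x e]] hmin]] := @exists_min (fun y => (0 < y)%N /\ exists x, (x ^ 2 = D * y ^ 2 + 1)%N).
  exists `|y0|%N; split; first by rewrite absz_gt0 gt_eqF.
  exists `|x0|%N; apply/eqP; rewrite -eqz_nat PoszD PoszM -!abszX !abszE !ger0_norm ?sqr_ge0 //.
  by rewrite e0.
(* An odd [y] would give [x ^ 2] congruent to [D + 1], which is 2 or 3 modulo 4. *)
have oy : ~~ odd y.
  apply/negP => oy; have ey := odd_double_half y; rewrite oy in ey.
  have ex := odd_double_half x; have eD := divn_eq D 4.
  move: e; rewrite -ey -ex eD; move: (y./2) (x./2) (D %/ 4)%N => h k m.
  by case: D4 => ->; case: (odd x); nia.
have ox : odd x.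
  have : odd (x ^ 2) by rewrite e oddD oddM oddX /= (negPf oy) andbF.
  by rewrite oddX.
have ey := odd_double_half y; rewrite (negPf oy) in ey.
have ex := odd_double_half x; rewrite ox in ex.
move: (y./2) (x./2) ey ex => v u; rewrite !add0n => ey ex.
have euv : (u * u.+1 = D * v ^ 2)%N by move: e; rewrite -ey -ex; nia.
have [A [B [a [b [eAB ea eb]]]]] := coprime_mul_sqr_split D0 (coprimenS u) euv.
exists A, B, a, b; split=> //; last by rewrite -eb -ea addn1.
apply/eqP => B1; move: eAB; rewrite B1 muln1 => AD.
rewrite B1 mul1n in eb.
have a0 : (0 < a)%N.
  rewrite lt0n; apply/eqP => a0; move: ea euv; rewrite a0 muln0 => -> /esym/eqP.
  by rewrite muln_eq0 expn_eq0 /= andbT; move: D0 y_gt0; rewrite -ey; lia.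
have : (y <= a)%N by apply: hmin; split=> //; exists b; rewrite -eb ea -AD addn1.
have : (v ^ 2 = a ^ 2 * b ^ 2)%N.
  by apply/eqP; rewrite -(eqn_pmul2l D0) -euv eb ea AD mulnA.
rewrite -expnMn => /eqP; rewrite eqn_sqr => /eqP ev.
have b0 : (0 < b)%N by case: (b) eb => //; rewrite exp0n.
have : (a <= a * b)%N by rewrite leq_pmulr.
by move: ey; rewrite ev; move: (a * b)%N => m; lia.
Qed.

Lemma neg_pell_prime (p : nat) : prime p -> (p %% 4 = 1)%N ->
  exists x y : int, x ^+ 2 + 1 = p%:Z * y ^+ 2.
Proof.
move=> pp p4; have [||A [B [a [b [eAB B1 e]]]]] := @pell_descent p.
- rewrite -[p]muln1; apply: nonsquare_prime_mul => //.
  by rewrite dvdn1; apply/eqP => p1; rewrite p1 in pp.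
- by left.
have dB : (B %| p)%N by rewrite -eAB dvdn_mull.
have eB : B = p by apply/(prime_nt_dvdP pp B1).
have eA : A = 1%N by apply/eqP; rewrite -(eqn_pmul2r (prime_gt0 pp)) -{1}eB eAB mul1n.
exists a%:Z, b%:Z; have := congr1 (fun n : nat => n%:R : int) e.
by rewrite eA eB mul1n natrD natrM !natrX !natz.
Qed.

Lemma leg_two_terms (p A B a b : nat) : prime p -> (p %% 4 = 1)%N ->
  (B * b ^ 2 = A * a ^ 2 + 1)%N ->
  ((p %| A)%N -> leg p B%:R = 1) /\ ((p %| B)%N -> leg p A%:R = 1).
Proof.
move=> pp p4 e; have p2 := p1mod4_gt2 pp p4; have po := p1mod4_odd pp p4.
have e' : B%:R * b%:R ^+ 2 = A%:R * a%:R ^+ 2 + 1 :> 'F_p.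
  by rewrite -!natrX -!natrM e natrD.
split; rewrite (dvdn_pcharf (pchar_Fp pp)) => /eqP h.
  rewrite h mul0r add0r in e'; have b0 : b%:R != 0 :> 'F_p.
    by apply/eqP => b0; move/eqP: e'; rewrite b0 expr0n mulr0 eq_sym oner_eq0.
  by have := congr1 (leg p) e'; rewrite legM // leg_sqr // mulr1 leg1.
rewrite h mul0r in e'; have {}e' : A%:R * a%:R ^+ 2 = -1 :> 'F_p.
  by apply/eqP; rewrite -addr_eq0 -e'.
have a0 : a%:R != 0 :> 'F_p.
  by apply/eqP => a0; move/eqP: e'; rewrite a0 expr0n mulr0 eq_sym oppr_eq0 oner_eq0.
by have := congr1 (leg p) e'; rewrite legM // leg_sqr // mulr1 leg_N1.
Qed.

Lemma muln_eq2 r s : (r * s = 2)%N -> (r = 1 /\ s = 2 \/ r = 2 /\ s = 1)%N.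
Proof.
move=> h; have r2 : (r <= 2)%N by apply: dvdn_leq => //; rewrite -h dvdn_mulr.
by move: r r2 h => [|[|[|//]]] _ h; [lia | left; lia | right; lia].
Qed.

(** The descent gives [A * B = 2 p q] with [B] different from 1. In each splitting with [A]
    different from 1, reduction modulo [p] and [q] makes two symbols, or products of symbols, equal
    to 1, against the hypothesis. [A = 1] is the equation sought. *)
Lemma neg_pell_two_primes (p q : nat) : prime p -> prime q -> p != q ->
  (p %% 4 = 1)%N -> (q %% 4 = 1)%N ->
  [\/ leg p q%:R = -1 /\ leg p 2 = -1, leg p q%:R = -1 /\ leg q 2 = -1
    | leg p 2 = -1 /\ leg q 2 = -1] ->
  exists x y : int, x ^+ 2 + 1 = (2 * p * q)%N%:Z * y ^+ 2.
Proof.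
move=> pp pq npq p4 q4 hc.
have p2 := p1mod4_gt2 pp p4; have po := p1mod4_odd pp p4.
have q2 := p1mod4_gt2 pq q4; have qo := p1mod4_odd pq q4.
have hr : leg q p%:R = leg p q%:R by rewrite (leg_reciprocity pp p4).
have [||A [B [a [b [eAB B1 e]]]]] := @pell_descent (2 * p * q).
- by rewrite -mulnA; apply: nonsquare_prime_mul => //; rewrite dvdn2 oddM po qo.
- have opq : odd (p * q) by rewrite oddM po qo.
  by right; rewrite -mulnA; move: (p * q)%N opq => m; lia.
have [hpA hpB] := leg_two_terms pp p4 e.
have [hqA hqB] := leg_two_terms pq q4 e.
suff eA : A = 1%N.
  exists a%:Z, b%:Z; move: eAB (congr1 (fun n : nat => n%:R : int) e); rewrite eA !mul1n => ->.
  by rewrite natrD natrM !natrX !natz.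
have q0 : (0 < q)%N := prime_gt0 pq; have p0 : (0 < p)%N := prime_gt0 pp.
have dp : (p %| A)%N || (p %| B)%N by rewrite -Euclid_dvdM // eAB mulnAC dvdn_mull.
have dq : (q %| A)%N || (q %| B)%N by rewrite -Euclid_dvdM // eAB dvdn_mull.
have npq' : coprime p q by rewrite prime_coprime // dvdn_prime2.
have legD (r s t : nat) : prime r -> (2 < r)%N -> odd r -> leg r (s * t)%:R = leg r s%:R * leg r t%:R.
  by move=> *; rewrite natrM legM.
case/orP: dp => hp; case/orP: dq => hq.
- have /dvdnP[c ec] : (p * q %| A)%N by rewrite Gauss_dvd // hp hq.
  have : (c * B = 2)%N.
    by apply/eqP; rewrite -(eqn_pmul2r p0) -(eqn_pmul2r q0) -eAB ec; apply/eqP; ring.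
  move/muln_eq2 => [[_ B2]|[_ B2]]; last by rewrite B2 in B1.
  by move: (hpA hp) (hqA hq); rewrite B2 => h1 h2; move: hc; rewrite h1 h2; case=> -[].
- have /dvdnP[c ec] := hp; have /dvdnP[d ed] := hq.
  have cd : (c * d = 2)%N.
    by apply/eqP; rewrite -(eqn_pmul2r p0) -(eqn_pmul2r q0) -eAB ec ed; apply/eqP; ring.
  move: (hpA hp) (hqB hq); rewrite ec ed.
  case: (muln_eq2 cd) => -[-> ->]; rewrite ?mul1n ?legD // hr => h1 h2; move: hc h1 h2; move: (leg p 2) (leg q 2) (leg p q%:R) => x y t; clear; case=> -[e1 e2]; rewrite ?e1 ?e2; lia.
- have /dvdnP[c ec] := hp; have /dvdnP[d ed] := hq.
  have cd : (c * d = 2)%N.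
    by apply/eqP; rewrite -(eqn_pmul2r p0) -(eqn_pmul2r q0) -eAB ec ed; apply/eqP; ring.
  move: (hpB hp) (hqA hq); rewrite ec ed.
  case: (muln_eq2 cd) => -[-> ->]; rewrite ?mul1n ?legD // hr => h1 h2; move: hc h1 h2; move: (leg p 2) (leg q 2) (leg p q%:R) => x y t; clear; case=> -[e1 e2]; rewrite ?e1 ?e2; lia.
- have /dvdnP[c ec] : (p * q %| B)%N by rewrite Gauss_dvd // hp hq.
  have : (c * A = 2)%N.
    by apply/eqP; rewrite -(eqn_pmul2r p0) -(eqn_pmul2r q0) -eAB ec; apply/eqP; ring.
  move/muln_eq2 => [[_ A2]|[_ //]].
  by move: (hpB hp) (hqB hq); rewrite A2 => h1 h2; move: hc; rewrite h1 h2; case=> -[].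
Qed.

(** [p] is the product of [X^2 - t X + n] with its complex conjugate; its coefficients are rational
    integers. *)
Lemma Aint_quad t n x : Zi t -> Zi n -> x ^+ 2 = t * x - n -> x \in Aint.
Proof.
move=> ht hn ex; have hint z : z \in Crat -> z \in Aint -> z \is a Num.int := @Cint_rat_Aint z.
have self z : Zi z -> z + z^* \is a Num.int /\ z * z^* \is a Num.int.
  move=> /ZiP[a [b ->]]; rewrite gi_norm gi_conj giD subrr -gi_int.
  by rewrite !intr_int.
have cross z w : Zi z -> Zi w -> z * w^* + z^* * w \is a Num.int.
  move=> /ZiP[a [b ->]] /ZiP[c [e ->]]; rewrite !gi_conj !giM giD.
  have -> : a * - e + b * c + (a * e + - b * c) = 0 by ring.
  by rewrite -gi_int intr_int.
have [t1 t2] := self _ ht; have [n1 n2] := self _ hn; have c1 := cross _ _ ht hn.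
pose p : {poly algC} := 'X^4 + (- (t + t^*))%:P * 'X^3 + (n + n^* + t * t^*)%:P * 'X^2
   + (- (t * n^* + t^* * n))%:P * 'X + (n * n^*)%:P.
apply: (@root_monic_Aint p).
- rewrite rootE /p !(hornerD, hornerM, hornerXn, hornerC, hornerX); apply/eqP.
  transitivity ((x ^+ 2 - t * x + n) * (x ^+ 2 - t^* * x + n^*)); first by ring.
  by rewrite ex; ring.
- rewrite monicE /p -!addrA lead_coefDl ?lead_coefXn // size_polyXn ltnS.
  apply: leq_trans (size_polyD _ _) _; rewrite geq_max; apply/andP; split.
    by apply: leq_trans (size_polyMleq _ _) _; rewrite size_polyXn addn4 /= size_polyC; case: (_ != _).
  apply: leq_trans (size_polyD _ _) _; rewrite geq_max; apply/andP; split.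
    by apply: leq_trans (size_polyMleq _ _) _; rewrite size_polyXn size_polyC; case: (_ != _).
  apply: leq_trans (size_polyD _ _) _; rewrite geq_max; apply/andP; split.
    by apply: leq_trans (size_polyMleq _ _) _; rewrite size_polyX size_polyC; case: (_ != _).
  by rewrite size_polyC; case: (_ != _).
- have i1 : - (t + t^*) \is a Num.int by rewrite rpredN.
  have i2 : n + n^* + t * t^* \is a Num.int by rewrite rpredD.
  have i3 : - (t * n^* + t^* * n) \is a Num.int by rewrite rpredN.
  apply/polyOverP => j; rewrite /p !(coefD, coefCM, coefXn, coefX, coefC).
  by do !apply: rpredD; rewrite ?(rpredM i1) ?(rpredM i2) ?(rpredM i3) ?rpred_nat //; case: ifP => // _; rewrite rpred0.
Qed.

(** * Genus theory over the Gaussian integers *)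

Section QuadraticOverQi.
Variables (k : algC -> Prop) (s : algC) (tau : {rmorphism algC -> algC}).
Hypotheses (sk : is_subfield k) (kE : forall x, k x <-> quad Qi s x) (Zs2 : Zi (s ^+ 2)).
Hypotheses (tau_i : tau 'i = 'i) (tau_s : tau s = - s) (s0 : s != 0).
Local Notation O := (ringint k).
Local Notation ideal := (is_ideal k).
Local Infix "**" := (ideal_mul k) (at level 40, left associativity).
Local Notation P := (pideal k).
Local Notation sQ := Qi_subfield.
Implicit Types (I J : algC -> Prop) (x y : algC).

Lemma tau_Qi x : Qi x -> tau x = x. Proof. exact: Qi_fix. Qed.

Lemma Qi_k x : Qi x -> k x. Proof. by move=> hx; apply/kE; exact: quad_sub sQ _ hx. Qed.

Lemma s_k : k s. Proof. by apply/kE; exact: quad_gen s sQ. Qed.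

Lemma tau_k x : k x -> k (tau x).
Proof. by move/kE => h; apply/kE; apply: (quad_stable sQ tau_Qi tau_s h). Qed.

Lemma tau_fixed x : k x -> tau x = x -> Qi x.
Proof. by move/kE; exact: (quad_fixed tau_Qi tau_s s0). Qed.

Lemma tauK x : k x -> tau (tau x) = x.
Proof.
by case/kE => a [b [ha hb ->]]; rewrite !(rmorphD, rmorphM) /= tau_s rmorphN /= tau_s opprK !tau_Qi.
Qed.

Lemma tau_O x : O x -> O (tau x).
Proof. by case=> hx ax; split; [exact: tau_k | rewrite Aint_aut]. Qed.

Lemma Zi_O x : Zi x -> O x. Proof. by case=> hx ax; split=> //; exact: Qi_k. Qed.

Lemma s_O : O s.
Proof. by split; [exact: s_k | apply: (@Aint_rootn 2) => //; case: Zs2]. Qed.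

Lemma trace_Zi x : O x -> Zi (x + tau x).
Proof.
move=> hx; have ht := tau_O hx; have [h1 h2] := riD sk hx ht; have [kx _] := hx.
by split; [apply: (tau_fixed h1); rewrite rmorphD /= (tauK kx) addrC | exact: h2].
Qed.

Lemma norm_Zi x : O x -> Zi (x * tau x).
Proof.
move=> hx; have ht := tau_O hx; have [h1 h2] := riM sk hx ht; have [kx _] := hx.
by split; [apply: (tau_fixed h1); rewrite rmorphM /= (tauK kx) mulrC | exact: h2].
Qed.

Lemma O_crit x : k x -> Zi (x + tau x) -> Zi (x * tau x) -> O x.
Proof. by move=> hx ht hn; split=> //; apply: (Aint_quad ht hn); ring. Qed.

Definition tau_ideal I : algC -> Prop := fun x => I (tau x).

Lemma tau_ideal_ideal I : ideal I -> ideal (fun x => k x /\ tau_ideal I x).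
Proof.
move=> hI; split=> [x [hx /(idO hI) [_]]||x y [kx hx] [ky hy]|r x hr [kx hx]].
- by rewrite Aint_aut.
- by split; [exact: sf0 | rewrite /tau_ideal rmorph0; exact: (id0 hI)].
- by split; [exact: sfD | rewrite /tau_ideal rmorphD; exact: (idD hI)].
- split; first by apply: sfM => //; case: hr.
  by rewrite /tau_ideal rmorphM; apply: (idMl hI) => //; exact: tau_O.
Qed.

(* [I * tau I] is generated by its intersection with [Z[i]], which is principal. *)
Lemma invertible I : nonzero_ideal k I -> exists J n,
  [/\ ideal J, Zi n, n != 0, I ** J = P n & forall x, k x -> J x <-> I (tau x)].
Proof.
case=> hI [x0 [hx0 x00]]; pose J x := k x /\ tau_ideal I x.
have hJ : ideal J by exact: tau_ideal_ideal.
have JT x : I x -> J (tau x).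
  by move=> hx; have [hk _] := idO hI hx; split; [exact: tau_k | rewrite /tau_ideal (tauK hk)].
have hIJ := mul_ideal sk hI hJ.
pose M z := Zi z /\ (I ** J) z.
have hM : is_ideal Qi M.
  split=> [z [] //||z w [zz hz] [zw hw]|r z zr [zz hz]].
  - by split; [exact: (ri0 sQ) | exact: (id0 hIJ)].
  - by split; [exact: (riD sQ) | exact: (idD hIJ)].
  - by split; [exact: (riM sQ) | apply: (idMl hIJ) => //; exact: Zi_O].
have Mtr x y : I x -> I y -> M (x * tau y + tau x * y).
  move=> hx hy; have ox := idO hI hx; have oy := idO hI hy; split.
    have -> : x * tau y + tau x * y = x * tau y + tau (x * tau y).
      by rewrite rmorphM /= tauK //; case: oy.
    by apply: trace_Zi; apply: riM => //; exact: tau_O.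
  by apply: (idD hIJ); [|rewrite mulrC]; apply: mem_mul => //; exact: JT.
have Mnm x : I x -> M (x * tau x).
  by move=> hx; split; [exact: norm_Zi (idO hI hx) | apply: mem_mul => //; exact: JT].
have [|n hn [n0 eM]] := @Zi_pid M.
  split=> //; exists (x0 * tau x0); split; first exact: Mnm.
  by rewrite mulf_neq0 // fmorph_eq0.
have on := Zi_O hn.
exists J, n; split=> //; last by move=> x hx; split=> [[]|].
apply: ideal_ext_eq => z; split; last first.
  case/(pidealP sk _ on) => r hr ->; apply: (idMr hIJ) => //.
  by have : M n by [rewrite eM; exact: mem_pideal]; case.
have dvdM w : M w -> Zi (w / n).
  by rewrite eM => /(pidealP sQ _ hn)[r hr ->]; rewrite mulrC mulKf.
apply: (mul_min (pideal_ideal sk on)) => x y hx [ky hy].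
have ox := idO hI hx; have [kx _] := ox; have oy := idO hI hy.
apply/(pidealP sk _ on); exists (x * y / n); last by rewrite [RHS]mulrC divfK.
have [Qn _] := hn; have kn := Qi_k Qn.
have ety : y = tau (tau y) by rewrite tauK.
(* The trace of [x * y / n] is an element of [M] divided by [n], and its norm is a product of two
   such quotients; [n] generates [M]. *)
apply: O_crit; first by apply: sf_div => //; exact: sfM.
  rewrite !rmorphM fmorphV /= (tau_Qi Qn) -mulrDl; apply: dvdM.
  by rewrite {1}ety; exact: Mtr.
rewrite !rmorphM fmorphV /= (tau_Qi Qn).
have -> : x * y / n * (tau x * tau y / n) = (x * tau x / n) * (tau y * y / n) by ring.
apply: (riM sQ); apply: dvdM; first exact: Mnm.
by rewrite {2}ety; exact: Mnm.
Qed.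

(** With [J ** J1 = (n)], the product of [x] in [I] and [y] in [J1] has its square in [(n ^+ 2)], so
    [(x * y) / n] is integral. Thus [I ** J1] lies in [(n)], and multiplying by [J] gives that [I]
    lies in [J]. *)
Lemma sqr_inj I J : nonzero_ideal k I -> nonzero_ideal k J -> I ** I = J ** J -> I = J.
Proof.
have half I' J' : nonzero_ideal k I' -> nonzero_ideal k J' -> I' ** I' = J' ** J' ->
    forall x, I' x -> J' x.
  move=> nI nJ e; have [hI _] := nI; have [hJ _] := nJ.
  have [J1 [n [hJ1 hn n0 eJ _]]] := invertible nJ.
  have on := Zi_O hn; have hIJ1 := mul_ideal sk hI hJ1.
  have sub z : (I' ** J1) z -> P n z.
    apply: (mul_min (pideal_ideal sk on)) => x y hx hy.
    have : (P n ** P n) ((x * y) ^+ 2).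
      rewrite -eJ (idmulACA sk hJ hJ1 hJ hJ1) -e exprMn !expr2.
      by apply: mem_mul; apply: mem_mul.
    rewrite (pidealM sk on on) => /(pidealP sk _ (riM sk on on))[r [_ ar] er].
    apply/(pidealP sk _ on); exists (x * y / n); last by rewrite [RHS]mulrC divfK.
    have [kx _] := idO hI hx; have [ky _] := idO hJ1 hy; have [kn _] := on.
    split; first by apply: sf_div => //; exact: sfM.
    by apply: (@Aint_rootn 2) => //; rewrite expr_div_n er -expr2 mulrC mulKf ?expf_neq0.
  move=> x hx; have : (P n ** J') (n * x).
    have : (P n ** I') (n * x) by apply: mem_mul => //; exact: mem_pideal.
    have -> : P n ** I' = I' ** J1 ** J' by rewrite idmulC -eJ (idmulC _ J') idmulA.
    move=> hh.
    apply: (mul_min (mul_ideal sk (pideal_ideal sk on) hJ) _ hh) => y z hy hz.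
    by apply: mem_mul => //; exact: sub.
  by case/(pmulP sk _ on hJ) => y hy /(mulfI n0) ->.
by move=> nI nJ e; apply: ideal_ext_eq => x; split; exact: half.
Qed.
End QuadraticOverQi.

Definition is_unit4 (u : algC) : Prop := [\/ u = 1, u = -1, u = 'i | u = - 'i].

Lemma unit4_Zi u : is_unit4 u -> Zi u.
Proof.
have sQ := Qi_subfield.
by case=> ->; [exact: ri1 | exact: (riN sQ (ri1 sQ)) | exact: Zi_i | exact: (riN sQ Zi_i)].
Qed.

(** [(1 + z) ^+ 2 = 2 * z], so 2 and [z] have the same symbol. *)
Lemma leg_sqrtN1 r (z : 'F_r) : prime r -> (r %% 4 = 1)%N -> z ^+ 2 = -1 -> leg r z = leg r 2.
Proof.
move=> pr r4 hz; have r2 := p1mod4_gt2 pr r4; have ro := p1mod4_odd pr r4.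
have z1 : 1 + z != 0.
  apply/eqP => /eqP; rewrite addrC addr_eq0 => /eqP ez; move/eqP: hz.
  by rewrite ez sqrrN expr1n (negPf (one_neqN1 pr r2 ro)).
have : leg r 2 * leg r z = 1.
  rewrite -legM // -(leg_sqr pr r2 ro z1); congr (leg r _).
  by rewrite sqrrD hz expr1n; ring.
have z0 : z != 0 by apply: contra_eq_neq hz => ->; rewrite expr0n eq_sym oppr_eq0 oner_eq0.
by have [->|->] := leg_pm1 z0; have [->|->] := leg_pm1 (two_nz pr r2 ro).
Qed.

(** The Boolean tells whether [u] is ['i] or [- 'i]. It is chosen before the prime, which ties
    together the symbols of one unit at different primes. *)
Lemma leg_unit4 u : is_unit4 u -> exists b : bool, forall r (z : 'F_r),
  prime r -> (r %% 4 = 1)%N -> z ^+ 2 = -1 -> leg r (phi z u) = if b then leg r 2 else 1.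
Proof.
have sQ := Qi_subfield.
move=> hu; exists ((u == 'i) || (u == - 'i)) => r z pr r4 hz.
have r2 := p1mod4_gt2 pr r4; have ro := p1mod4_odd pr r4.
have i1 : ('i : algC) != 1 by apply/eqP => h; have := sqrCi algC; rewrite h expr1n => /eqP; rewrite -subr_eq0 opprK (_ : 1 + 1 = 2%:R) // pnatr_eq0.
have iN1 : ('i : algC) != - 1 by apply/eqP => h; have := sqrCi algC; rewrite h sqrrN expr1n => /eqP; rewrite -subr_eq0 opprK (_ : 1 + 1 = 2%:R) // pnatr_eq0.
have legN y : leg r (- y) = leg r y by rewrite -mulN1r legM // leg_N1 // mul1r.
case: hu => ->.
- by rewrite eq_sym (negPf i1) -eqr_oppLR eq_sym (negPf iN1) (phi_nat z 1) leg1.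
- by rewrite eq_sym (negPf iN1) eqr_opp eq_sym (negPf i1) phiN ?(phi_nat z 1) ?legN ?leg1 //; exact: ri1.
- by rewrite eqxx phi_i leg_sqrtN1.
- by rewrite eqxx orbT phiN ?phi_i ?legN ?leg_sqrtN1 //; exact: Zi_i.
Qed.

Lemma leg_phi_i u r (z : 'F_r) : prime r -> (r %% 4 = 1)%N -> z ^+ 2 = -1 -> u = 'i \/ u = - 'i ->
  leg r (phi z u) = leg r 2.
Proof.
move=> pr r4 hz [] ->; first by rewrite phi_i leg_sqrtN1.
by rewrite phiN ?phi_i ?leg_sqrtN1 ?sqrrN //; exact: Zi_i.
Qed.

Section Genus.
Variables (k : algC -> Prop) (s : algC) (tau : {rmorphism algC -> algC}).
Hypotheses (sk : is_subfield k) (kE : forall x, k x <-> quad Qi s x) (Zs2 : Zi (s ^+ 2)).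
Hypotheses (tau_i : tau 'i = 'i) (tau_s : tau s = - s) (s0 : s != 0).
Local Notation O := (ringint k).
Local Notation sQ := Qi_subfield.
Variables (r : nat) (A B : int) (m : algC).
Hypotheses (pr : prime r) (r4 : (r %% 4 = 1)%N) (eAB : r%:Z = A ^+ 2 + B ^+ 2).
Hypotheses (hm : Zi m) (s2E : s ^+ 2 = gi A B * m).
Local Notation ph := (phi (rt r A B)).
Hypothesis (phm : ph m != 0).
Let r2 := p1mod4_gt2 pr r4.
Let ro := p1mod4_odd pr r4.
Local Notation hr := (rt_sqr pr eAB).

(* With [g = gi A B], the Gaussian integer [s * (x - tau x)] is divisible by [g], so [g^2] divides its
   square [g * m * (t^2 - 4 n)], where [t] and [n] are the trace and norm of [x]. *)
Lemma genus_trace x : O x -> ph (x + tau x) ^+ 2 = 4 * ph (x * tau x).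
Proof.
move=> hx; have [kx _] := hx.
have tZ := trace_Zi sk kE tau_i tau_s s0 hx; have nZ := norm_Zi sk kE tau_i tau_s s0 hx.
set t := x + tau x in tZ *; set n := x * tau x in nZ *.
pose v := (x - tau x) * s.
have tK := tauK kE tau_i tau_s kx.
have ov : O v by apply: riM => //; [apply: riB => //; exact: (tau_O kE tau_i tau_s) | exact: (s_O kE Zs2)].
have Zv : Zi v.
  split; last by case: ov.
  apply: (tau_fixed kE tau_i tau_s s0); first by case: ov.
  by rewrite /v !(rmorphM, rmorphB) /= tK tau_s; ring.
have Zt2 : Zi (t ^+ 2 - 4 * n).
  by apply: (riB sQ); [rewrite expr2; exact: (riM sQ) | apply: (riM sQ) => //; exact: (ri_nat sQ 4)].
have ev : v ^+ 2 = (t ^+ 2 - 4 * n) * m * gi A B.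
  transitivity ((t ^+ 2 - 4 * n) * s ^+ 2); first by rewrite /v /t /n; ring.
  by rewrite s2E; ring.
have pv : ph v = 0.
  have : ph (v ^+ 2) = 0.
    by rewrite ev phiM ?phi_pi ?mulr0 //; [exact: hr | exact: (riM sQ) | exact: Zi_gi].
  by rewrite phiX //; [move/eqP; rewrite expf_eq0 => /eqP | exact: hr].
have [w hw evw] := phi_ker pr eAB Zv pv.
have g0 : gi A B != 0.
  rewrite gi_eq0 /gnorm -eAB; have := prime_gt0 pr; lia.
have : ph ((t ^+ 2 - 4 * n) * m) = 0.
  have -> : (t ^+ 2 - 4 * n) * m = gi A B * w ^+ 2.
    by apply: (mulIf g0); rewrite -ev evw; ring.
  rewrite phiM ?phi_pi ?mul0r //; [exact: hr | exact: Zi_gi | rewrite expr2; exact: (riM sQ)].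
rewrite phiM //; last exact: hr.
move/eqP; rewrite mulf_eq0 (negPf phm) orbF => /eqP.
clear ev pv evw; clearbody t n; have Z4 := ri_nat sQ 4.
rewrite phiD ?phiN ?phiM ?phiX //; try exact: hr; try exact: (riM sQ); try by apply: (riN sQ); exact: (riM sQ).
by rewrite phi_nat => /eqP; rewrite subr_eq0 => /eqP.
Qed.

Lemma genus_leg x : O x -> ph (x * tau x) != 0 -> leg r (ph (x * tau x)) = 1.
Proof.
move=> hx n0; have h := genus_trace hx; have h2 := two_nz pr r2 ro.
have t0 : ph (x + tau x) / 2 != 0.
  rewrite mulf_neq0 ?invr_eq0 //; apply: contraNneq n0 => t0; move/eqP: h.
  by rewrite t0 expr0n eq_sym mulf_eq0 (_ : 4 = 2 * 2) ?mulf_eq0 ?(negPf h2) //; ring.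
rewrite -(leg_sqr pr r2 ro t0); congr (leg r _).
have e4 : 4 = 2 ^+ 2 :> 'F_r by ring.
by rewrite expr_div_n h e4 [RHS]mulrC mulKf ?expf_neq0.
Qed.

(** When [gi A B] does not divide [n], this is [genus_leg]. When it does, it also divides the trace
    of [x] by [genus_trace], so [x / gi A B] is again integral and [n] is replaced by a quotient of
    smaller norm; [l] bounds the norm of [n]. *)
Lemma genus_norm_unit x u n : O x -> Zi u -> Zi n -> n != 0 -> ph u != 0 ->
  x * tau x = u * n ^+ 2 -> leg r (ph u) = 1.
Proof.
move=> hx hu hn n0 u0; have [a [b en]] := ZiP hn.
move: {2}(`|gnorm a b|%N) (leqnn `|gnorm a b|%N) => l.
elim: l x n a b hx hn n0 en => [|l ih] x n a b hx hn n0 en hl ex.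
  by move: n0; rewrite en gi_eq0; move: hl; rewrite leqn0 absz_eq0 => ->.
have Zn2 : Zi (n ^+ 2) by rewrite expr2; exact: (riM sQ).
have [pn|pn] := eqVneq (ph n) 0; last first.
  have := genus_leg hx; rewrite ex phiM ?phiX //; try exact: hr.
  by rewrite mulf_neq0 ?expf_neq0 // => /(_ isT); rewrite legM // leg_sqr // mulr1.
have [n' hn' en'] := phi_ker pr eAB hn pn.
have n'0 : n' != 0 by apply: contraNneq n0 => h; rewrite en' h mulr0.
have tZ := trace_Zi sk kE tau_i tau_s s0 hx.
have pt : ph (x + tau x) = 0.
  have := genus_trace hx; rewrite ex phiM ?phiX //; try exact: hr.
  by rewrite pn expr0n mulr0 mulr0 => /eqP; rewrite expf_eq0 => /eqP.
have [t' ht' et'] := phi_ker pr eAB tZ pt.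
have [a' [b' en'']] := ZiP hn'.
have g0 : gi A B != 0.
  rewrite gi_eq0 /gnorm -eAB; have := prime_gt0 pr; lia.
have tg : tau (gi A B) = gi A B by apply: Qi_fix => //; case: (Zi_gi A B).
have e1 : (x / gi A B) * tau (x / gi A B) = u * n' ^+ 2.
  rewrite rmorphM fmorphV /= tg mulrACA ex en'; field; exact: g0.
have hx' : O (x / gi A B).
  apply: (@O_crit k tau).
  - apply: (sf_div sk); first by case: hx.
    by apply: (Qi_k kE); case: (Zi_gi A B).
  - by rewrite rmorphM fmorphV /= tg -mulrDl et' mulrC mulKf.
  - by rewrite e1; apply: (riM sQ) => //; rewrite expr2; exact: (riM sQ).
apply: (ih _ _ _ _ hx' hn' n'0 en'' _ e1).
have eN : gnorm a b = r%:Z * gnorm a' b'.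
  by apply: (@intr_inj algC); rewrite rmorphM /= -!gi_norm -en -en'' en' eAB -[A ^+ 2 + _]/(gnorm A B) -gi_norm rmorphM /=; ring.
have N0 : gnorm a' b' != 0 by rewrite -gi_eq0 -en''.
rewrite -ltnS; apply: leq_trans hl; rewrite eN abszM /=.
by rewrite -{1}[`|gnorm a' b'|%N]mul1n ltn_pmul2r ?absz_gt0 // prime_gt1.
Qed.
End Genus.

Section PrincipalRoots.
Variables (k : algC -> Prop) (s : algC) (tau : {rmorphism algC -> algC}).
Hypotheses (sk : is_subfield k) (kE : forall x, k x <-> quad Qi s x) (Zs2 : Zi (s ^+ 2)).
Hypotheses (tau_i : tau 'i = 'i) (tau_s : tau s = - s) (s0 : s != 0).
Local Notation O := (ringint k).
Local Notation sQ := Qi_subfield.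

(** If [H = (a)], then [a ^+ 2] is [rho] times a unit [w] of [k]; hence the square of
    [a * tau a / rho] is the norm of [w], and [a * tau a / rho] is a unit of [Z[i]]. *)
Lemma principal_norm H rho : Zi rho -> rho != 0 ->
  ideal_mul k H H = pideal k rho -> is_principal k H ->
  exists a u w, [/\ O a, is_unit4 u, a * tau a = rho * u, w \in Aint & a ^+ 2 = rho * w].
Proof.
move=> hr r0 eH /is_principalE[a ha eHa]; have hr' := Zi_O kE hr.
rewrite eHa (pidealM sk ha ha) in eH.
have [h1 h2 a20] := pideal_eq_unit sk hr' (riM sk ha ha) r0 (esym eH).
have a0 : a != 0 by move: a20; rewrite mulf_eq0 orbb.
have tr : tau rho = rho by apply: Qi_fix => //; case: hr.
exists a, (a * tau a / rho), (a * a / rho).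
have ta0 : tau a != 0 by rewrite fmorph_eq0.
split=> //; [ | by rewrite [RHS]mulrC divfK | by case: h1 | by rewrite [RHS]mulrC divfK].
have Qn : Qi (a * tau a / rho).
  by apply: (sf_div sQ); [case: (norm_Zi sk kE tau_i tau_s s0 ha) | case: hr].
apply: (Zi_unit Qn); rewrite ?mulf_neq0 ?invr_eq0 //.
  apply: (@Aint_rootn 2) => //.
  have -> : (a * tau a / rho) ^+ 2 = (a * a / rho) * tau (a * a / rho).
    by rewrite !rmorphM fmorphV /= tr; ring.
  by apply: rpredM; [case: h1 | rewrite Aint_aut; case: h1].
apply: (@Aint_rootn 2) => //.
have -> : (a * tau a / rho)^-1 ^+ 2 = (rho / (a * a)) * tau (rho / (a * a)).
  rewrite rmorphM fmorphV rmorphM /= tr; field.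
  by rewrite r0 a0 ta0.
by apply: rpredM; [case: h2 | rewrite Aint_aut; case: h2].
Qed.

Variables (r : nat) (A B : int) (m : algC).
Hypotheses (pr : prime r) (r4 : (r %% 4 = 1)%N) (eAB : r%:Z = A ^+ 2 + B ^+ 2).
Hypotheses (hm : Zi m) (s2E : s ^+ 2 = gi A B * m).
Local Notation ph := (phi (rt r A B)).
Hypothesis (phm : ph m != 0).

Lemma gi_prime_neq0 : gi A B != 0.
Proof. by rewrite gi_eq0 /gnorm -eAB; have := prime_gt0 pr; clear; lia. Qed.

Lemma unit4_phi u : is_unit4 u -> ph u != 0.
Proof.
have r2 := p1mod4_gt2 pr r4; have ro := p1mod4_odd pr r4.
move=> /leg_unit4[b hb]; rewrite -leg_eq0 hb //; last exact: (rt_sqr pr eAB).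
by case: b {hb} => //; rewrite leg_eq0; exact: two_nz.
Qed.

Lemma genus_coprime a u rho : O a -> is_unit4 u -> Zi rho -> ph rho != 0 ->
  a * tau a = rho * u -> leg r (ph rho) * leg r (ph u) = 1.
Proof.
move=> ha hu hr r0 e; have r2 := p1mod4_gt2 pr r4; have ro := p1mod4_odd pr r4.
have u0 := unit4_phi hu; have eM : ph (rho * u) = ph rho * ph u.
  by apply: phiM => //; [exact: (rt_sqr pr eAB) | exact: unit4_Zi].
rewrite -legM // -eM -e.
by apply: (genus_leg sk kE Zs2 tau_i tau_s s0 pr r4 eAB hm s2E phm ha); rewrite e eM mulf_neq0.
Qed.

(** The norm of [a] vanishes modulo [gi A B], so its symbol says nothing. The integer
    [a * s / gi A B] has norm [- (m * rho) * u] instead, prime to [gi A B]. *)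
Lemma genus_ramified a u w rho : O a -> is_unit4 u -> Zi rho -> ph rho != 0 ->
  a * tau a = gi A B * rho * u -> w \in Aint -> a ^+ 2 = gi A B * rho * w ->
  leg r (ph m) * leg r (ph rho) * leg r (ph u) = 1.
Proof.
move=> ha hu hr r0 e hw ew; have r2 := p1mod4_gt2 pr r4; have ro := p1mod4_odd pr r4.
have g0 := gi_prime_neq0.
have hx : O (a * s / gi A B).
  split; first by apply: (sf_div sk); [apply: (sfM sk); [case: ha | exact: (s_k kE)] |
    apply: (Qi_k kE); case: (Zi_gi A B)].
  apply: (@Aint_rootn 2) => //; rewrite expr_div_n exprMn ew s2E.
  have -> : gi A B * rho * w * (gi A B * m) / gi A B ^+ 2 = rho * w * m by field; exact: g0.
  by apply: rpredM; [apply: rpredM => // | ]; [case: hr | case: hm].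
have tg : tau (gi A B) = gi A B by apply: Qi_fix => //; case: (Zi_gi A B).
have hmr : Zi (m * rho) by exact: (riM sQ).
have eN : (a * s / gi A B) * tau (a * s / gi A B) = (- (m * rho)) * u.
  rewrite !rmorphM fmorphV /= tg tau_s.
  transitivity (- (a * tau a) * s ^+ 2 / gi A B ^+ 2); first by field; exact: g0.
  by rewrite e s2E; field; exact: g0.
have sq := rt_sqr pr eAB.
have pN : ph (- (m * rho)) = - (ph m * ph rho) by rewrite phiN // phiM.
have := genus_coprime hx hu (riN sQ hmr) _ eN; rewrite pN oppr_eq0 mulf_neq0 // => /(_ isT).
by rewrite -mulN1r !legM // leg_N1 // mul1r.
Qed.
End PrincipalRoots.

Section Cofactor.
Variables (p q : nat) (A B : int).
Hypotheses (pp : prime p) (npq : ~~ (p %| q)%N) (p4 : (p %% 4 = 1)%N).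
Hypotheses (eAB : p%:Z = A ^+ 2 + B ^+ 2).
Local Notation sQ := Qi_subfield.
Local Notation ph := (phi (rt p A B)).

(** The quotient of [2 * p * q] by [gi A B], in the role of [m] in the genus lemmas. *)
Definition cofactor : algC := 2 * gi A (- B) * q%:R.

Lemma gi_mul_conj : gi A B * gi A (- B) = p%:R.
Proof. by rewrite -gi_conj gi_norm /gnorm -eAB. Qed.

Lemma Zi_cofactor : Zi cofactor.
Proof.
apply: (riM sQ); [apply: (riM sQ) | exact: (ri_nat sQ)]; [exact: (ri_nat sQ 2) | exact: Zi_gi].
Qed.

Lemma cofactorE : (2 * p * q)%N%:R = gi A B * cofactor.
Proof. by rewrite /cofactor !natrM -gi_mul_conj; ring. Qed.

Lemma phi_conj_neq0 : ph (gi A (- B)) != 0.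
Proof.
have p2 := p1mod4_gt2 pp p4; have po := p1mod4_odd pp p4.
have A0 : (A%:~R : 'F_p) != 0 by apply: (@sum2sq_nz p B) => //; rewrite addrC.
have -> : ph (gi A (- B)) = 2 * A%:~R.
  have := phi_pi pp eAB; rewrite !phi_gi rmorphN /= => h.
  transitivity (2 * A%:~R - (A%:~R + B%:~R * rt p A B)); first by ring.
  by rewrite h subr0.
by rewrite mulf_neq0 // two_nz.
Qed.

Lemma phi_cofactor : ph cofactor = 2 * ph (gi A (- B)) * q%:R.
Proof.
have sq := rt_sqr pp eAB.
have Z2 := ri_nat sQ 2; have Zg := Zi_gi A (- B); have Zq := ri_nat sQ q.
by rewrite /cofactor !phiM ?(phi_nat _ 2) ?phi_nat //; exact: (riM sQ).
Qed.

Lemma phi_cofactor_neq0 : ph cofactor != 0.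
Proof.
have p2 := p1mod4_gt2 pp p4; have po := p1mod4_odd pp p4.
rewrite phi_cofactor !mulf_neq0 ?phi_conj_neq0 ?two_nz //.
by rewrite -(dvdn_pcharf (pchar_Fp pp)).
Qed.

Lemma rt_opp : rt p A (- B) = - rt p A B.
Proof. by rewrite /rt rmorphN /= invrN mulrN. Qed.
End Cofactor.

Lemma pm1_cancel (T S a R U R' : int) : T * S * a * R * U = 1 -> S * R' * U = 1 ->
  S ^+ 2 = 1 -> U * U = 1 -> T * a * (R * R') = 1.
Proof.
move=> h1 h2 hS hU; transitivity (T * a * (R * R') * S ^+ 2 * (U * U)).
  by rewrite hS hU !mulr1.
by transitivity ((T * S * a * R * U) * (S * R' * U)); [ring | rewrite h1 h2].
Qed.

(** * Ramified ideals that are not principal *)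

Section NonPrincipal.
Variables (p q : nat) (A B C D : int) (s : algC) (k : algC -> Prop) (tau : {rmorphism algC -> algC}).
Hypotheses (pp : prime p) (pq : prime q) (npq : p != q) (p4 : (p %% 4 = 1)%N) (q4 : (q %% 4 = 1)%N).
Hypotheses (eAB : p%:Z = A ^+ 2 + B ^+ 2) (eCD : q%:Z = C ^+ 2 + D ^+ 2).
Hypotheses (s2 : s ^+ 2 = (2 * p * q)%N%:R).
Hypotheses (sk : is_subfield k) (kE : forall x, k x <-> quad Qi s x).
Hypotheses (tau_i : tau 'i = 'i) (tau_s : tau s = - s) (s0 : s != 0).
Hypothesis genus : [\/ leg p q%:R = -1 /\ leg p 2 = -1, leg p q%:R = -1 /\ leg q 2 = -1
    | leg p 2 = -1 /\ leg q 2 = -1].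
Local Notation sQ := Qi_subfield.
Let p2 := p1mod4_gt2 pp p4.
Let po := p1mod4_odd pp p4.
Let q2 := p1mod4_gt2 pq q4.
Let qo := p1mod4_odd pq q4.

Lemma Zi_s2 : Zi (s ^+ 2). Proof. by rewrite s2; exact: (ri_nat sQ). Qed.

Lemma ndvd_pq : ~~ (p %| q)%N /\ ~~ (q %| p)%N.
Proof. by rewrite !dvdn_prime2 // [q == p]eq_sym npq. Qed.

Lemma leg_rec : leg q p%:R = leg p q%:R.
Proof. by rewrite (leg_reciprocity pp p4). Qed.

Lemma eABN : p%:Z = A ^+ 2 + (- B) ^+ 2. Proof. by rewrite sqrrN. Qed.
Lemma eCDN : q%:Z = C ^+ 2 + (- D) ^+ 2. Proof. by rewrite sqrrN. Qed.

Lemma s2_p : s ^+ 2 = gi A B * cofactor q A B.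
Proof. by rewrite s2; exact: (cofactorE q eAB). Qed.
Lemma s2_pN : s ^+ 2 = gi A (- B) * cofactor q A (- B).
Proof. by rewrite s2; exact: (cofactorE q eABN). Qed.
Lemma s2_q : s ^+ 2 = gi C D * cofactor p C D.
Proof. by rewrite s2 mulnAC; exact: (cofactorE p eCD). Qed.
Lemma s2_qN : s ^+ 2 = gi C (- D) * cofactor p C (- D).
Proof. by rewrite s2 mulnAC; exact: (cofactorE p eCDN). Qed.

Lemma leg_unit_sqr b (r : nat) : prime r -> (r %% 4 = 1)%N ->
  (if b then leg r 2 else 1) * (if b then leg r 2 else 1) = 1.
Proof.
move=> pr r4; case: b => //.
by rewrite -expr2; have [->|->] := leg_pm1 (two_nz pr (p1mod4_gt2 pr r4) (p1mod4_odd pr r4)).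
Qed.

(** A generator has to satisfy one genus condition at each of the four odd ramified Gaussian primes.
    Multiplying the two conditions above [p], and the two above [q], squares the symbol of the
    unknown unit away. The cases needed are [rho = 1] and [rho = gi 1 1], with norms [n] equal to 1
    and 2. *)
Lemma nonprincipal_half H rho (n : nat) : Zi rho -> rho * rho^* = n%:R -> (0 < n < 3)%N ->
  ideal_mul k H H = pideal k (gi A B * rho) -> is_principal k H ->
  leg p 2 * leg p q%:R * leg p n%:R = 1 /\ leg p q%:R * leg q n%:R = 1.
Proof.
move=> hr en n3 eH hH; have [npq1 npq2] := ndvd_pq.
have Zg := Zi_gi A B; have ZgN := Zi_gi A (- B); have hrc := Zi_conj hr.
have g0 : gi A B != 0 by exact: (@gi_prime_neq0 p).
have r0 : rho != 0.
  by apply/eqP => r0; move/eqP: en; rewrite r0 mul0r eq_sym pnatr_eq0; case: n n3.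
have nz r : prime r -> (2 < r)%N -> (n%:R : 'F_r) != 0.
  move=> pr r2; rewrite -(dvdn_pcharf (pchar_Fp pr)).
  by apply/negP => /dvdn_leq; move: n3 r2; clear; lia.
have [a [u [w [ha hu eN hw ew]]]] := principal_norm sk kE tau_i tau_s s0 (riM sQ Zg hr) (mulf_neq0 g0 r0) eH hH.
have [b hb] := leg_unit4 hu.
have sqp := rt_sqr pp eAB; have sqpN := rt_sqr pp eABN.
have sqq := rt_sqr pq eCD; have sqqN := rt_sqr pq eCDN.
have conjp x : Zi x -> phi (rt p A (- B)) x = phi (rt p A B) x^*.
  by move=> hx; rewrite rt_opp phi_conj.
have conjq x : Zi x -> phi (rt q C (- D)) x = phi (rt q C D) x^*.
  by move=> hx; rewrite rt_opp phi_conj.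
have nrp : phi (rt p A B) rho * phi (rt p A B) rho^* = n%:R.
  by rewrite -phiM // en phi_nat.
have nrq : phi (rt q C D) rho * phi (rt q C D) rho^* = n%:R.
  by rewrite -phiM // en phi_nat.
have /norP[rp rpc] : ~~ ((phi (rt p A B) rho == 0) || (phi (rt p A B) rho^* == 0)).
  by rewrite -mulf_eq0 nrp nz.
have /norP[rq rqc] : ~~ ((phi (rt q C D) rho == 0) || (phi (rt q C D) rho^* == 0)).
  by rewrite -mulf_eq0 nrq nz.
have S0 : phi (rt p A B) (gi A (- B)) != 0 by exact: phi_conj_neq0.
have ngq : phi (rt q C D) (gi A B) * phi (rt q C D) (gi A (- B)) = p%:R.
  by rewrite -phiM // (gi_mul_conj eAB) phi_nat.
have /norP[gq gqc] : ~~ ((phi (rt q C D) (gi A B) == 0) || (phi (rt q C D) (gi A (- B)) == 0)).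
  by rewrite -mulf_eq0 ngq -(dvdn_pcharf (pchar_Fp pq)).
have mulr_conj : (gi A B * rho)^* = gi A (- B) * rho^* by rewrite rmorphM /= gi_conj.
have Zgr : Zi (gi A B * rho) by exact: (riM sQ).
have mp := Zi_cofactor q A B; have mpN := Zi_cofactor q A (- B).
have mq := Zi_cofactor p C D; have mqN := Zi_cofactor p C (- D).
have n2 : phi (rt p A (- B)) (gi A B * rho) != 0.
  by rewrite conjp // mulr_conj phiM // mulf_neq0.
have n3' : phi (rt q C D) (gi A B * rho) != 0 by rewrite phiM // mulf_neq0.
have n4 : phi (rt q C (- D)) (gi A B * rho) != 0.
  by rewrite conjq // mulr_conj phiM // mulf_neq0.
have h1 := genus_ramified sk kE Zi_s2 tau_i tau_s s0 pp p4 eAB mp s2_p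
  (phi_cofactor_neq0 pp npq1 p4 eAB) ha hu hr rp eN hw ew.
have h2 := genus_coprime sk kE Zi_s2 tau_i tau_s s0 pp p4 eABN mpN s2_pN
  (phi_cofactor_neq0 pp npq1 p4 eABN) ha hu Zgr n2 eN.
have h3 := genus_coprime sk kE Zi_s2 tau_i tau_s s0 pq q4 eCD mq s2_q
  (phi_cofactor_neq0 pq npq2 q4 eCD) ha hu Zgr n3' eN.
have h4 := genus_coprime sk kE Zi_s2 tau_i tau_s s0 pq q4 eCDN mqN s2_qN
  (phi_cofactor_neq0 pq npq2 q4 eCDN) ha hu Zgr n4 eN.
have kp := congr1 (leg p) nrp; have kq := congr1 (leg q) nrq; have kg := congr1 (leg q) ngq.
move: h1 h2 h3 h4 kp kq kg.
rewrite (conjp _ Zgr) (conjq _ Zgr) !mulr_conj !(hb _ _ pp p4) // !(hb _ _ pq q4) //.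
rewrite (phi_cofactor _ pp eAB) !phiM // !legM // leg_rec.
have SS : leg p (phi (rt p A B) (gi A (- B))) ^+ 2 = 1 by have [->|->] := leg_pm1 S0.
have UU := leg_unit_sqr b pp p4; have UUq := leg_unit_sqr b pq q4.
move=> h1 h2 h3 h4 kp kq kg; rewrite -kp -kq; split.
  exact: pm1_cancel h1 h2 SS UU.
rewrite -kg; move: h3 h4 UUq; move: (if b then _ else _) => U.
move: (leg q _) (leg q _) (leg q _) (leg q _) => R' GN R G h3 h4 hU.
transitivity (G * GN * (R * R') * (U * U)); first by rewrite hU mulr1; ring.
by transitivity ((G * R * U) * (GN * R' * U)); [ring | rewrite h3 h4].
Qed.

Lemma nonprincipal_pi H : ideal_mul k H H = pideal k (gi A B) -> ~ is_principal k H.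
Proof.
move=> eH hH.
have e1 : 1 * 1^* = 1%:R :> algC by rewrite rmorph1 mulr1.
have eH1 : ideal_mul k H H = pideal k (gi A B * 1) by rewrite mulr1.
have [] := nonprincipal_half (ri1 sQ) e1 isT eH1 hH.
rewrite !leg1 !mulr1 => h1 h2; rewrite h2 mulr1 in h1.
by move: genus; rewrite h1 h2; case=> -[].
Qed.

Lemma nonprincipal_pi0 H : ideal_mul k H H = pideal k (gi A B * gi 1 1) -> ~ is_principal k H.
Proof.
move=> eH hH.
have e2 : gi 1 1 * (gi 1 1)^* = 2%:R by rewrite gi_norm.
have [] := nonprincipal_half (Zi_gi 1 1) e2 isT eH hH.
move=> h1 h2.
have hT : leg p 2 * leg p 2 = 1 by have [->|->] := leg_pm1 (two_nz pp p2 po).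
have h3 : leg p q%:R = 1 by rewrite -h1 mulrAC hT mul1r.
by move: h2; rewrite h3 mul1r => h2; move: genus; rewrite h2 h3; case=> -[].
Qed.

(** The generator is divisible by both primes above [p]. One condition at [p] and one at [q] are
    used; the symbol of the unit remains in them, so units [1], [-1] and units ['i], [- 'i] are
    excluded separately. *)
Lemma nonprincipal_p H : ideal_mul k H H = pideal k p%:R -> ~ is_principal k H.
Proof.
move=> eH hH; have [npq1 npq2] := ndvd_pq.
have Zg := Zi_gi A B; have ZgN := Zi_gi A (- B).
have p0 : (p%:R : algC) != 0 by rewrite pnatr_eq0; case: (p) pp.
have [a [u [w [ha hu eN hw ew]]]] := principal_norm sk kE tau_i tau_s s0 (ri_nat sQ p) p0 eH hH.
have [b hb] := leg_unit4 hu.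
have sqp := rt_sqr pp eAB; have sqq := rt_sqr pq eCD.
have S0 : phi (rt p A B) (gi A (- B)) != 0 by exact: phi_conj_neq0.
have n3 : phi (rt q C D) p%:R != 0 by rewrite phi_nat -(dvdn_pcharf (pchar_Fp pq)).
have h3 := genus_coprime sk kE Zi_s2 tau_i tau_s s0 pq q4 eCD (Zi_cofactor p C D) s2_q
  (phi_cofactor_neq0 pq npq2 q4 eCD) ha hu (ri_nat sQ p) n3 eN.
rewrite -(gi_mul_conj eAB) in eN ew.
have h1 := genus_ramified sk kE Zi_s2 tau_i tau_s s0 pp p4 eAB (Zi_cofactor q A B) s2_p
  (phi_cofactor_neq0 pp npq1 p4 eAB) ha hu ZgN S0 eN hw ew.
move: h1 h3; rewrite !(hb _ _ pp p4) // !(hb _ _ pq q4) // (phi_cofactor _ pp eAB) !legM // phi_nat leg_rec.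
have SS : leg p (phi (rt p A B) (gi A (- B))) ^+ 2 = 1 by have [->|->] := leg_pm1 S0.
have UU := leg_unit_sqr b pp p4.
move: SS; move: (leg p (phi _ _)) => S SS h1 h3.
have {}h1 : leg p 2 * leg p q%:R * (if b then leg p 2 else 1) = 1.
  by rewrite -[RHS]h1; transitivity (leg p 2 * leg p q%:R * (if b then leg p 2 else 1) * S ^+ 2);
    [rewrite SS mulr1 | ring].
case: b {hb UU} h1 h3; last first.
  by rewrite !mulr1 => h1 h3; rewrite h3 mulr1 in h1; move: genus; rewrite h1 h3; case=> -[].
have hT : leg p 2 * leg p 2 = 1 by have [->|->] := leg_pm1 (two_nz pp p2 po).
rewrite mulrAC hT mul1r => h1; rewrite h1 mul1r => h3.
by move: genus; rewrite h1 h3; case=> -[].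
Qed.
End NonPrincipal.

(** * Classes of order two *)

Definition prime_elt (q : algC) : Prop :=
  forall x y, Zi x -> Zi y -> zdvd q (x * y) -> zdvd q x \/ zdvd q y.

Lemma gi_prime_elt (r : nat) A B : prime r -> r%:Z = A ^+ 2 + B ^+ 2 -> prime_elt (gi A B).
Proof.
move=> pr e x y hx hy [z hz exy]; have sq := rt_sqr pr e.
have : phi (rt r A B) (x * y) = 0 by rewrite exy phiM ?phi_pi ?mul0r //; exact: Zi_gi.
rewrite phiM // => /eqP; rewrite mulf_eq0 => /orP[] /eqP h; [left | right];
  exact: (phi_ker pr e).
Qed.

Section Torsion.
Variables (k : algC -> Prop) (s : algC) (tau : {rmorphism algC -> algC}).
Hypotheses (sk : is_subfield k) (kE : forall x, k x <-> quad Qi s x) (Zs2 : Zi (s ^+ 2)).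
Hypotheses (tau_i : tau 'i = 'i) (tau_s : tau s = - s) (s0 : s != 0).
Local Notation O := (ringint k).
Local Notation ideal := (is_ideal k).
Local Infix "**" := (ideal_mul k) (at level 40, left associativity).
Local Notation P := (pideal k).
Local Notation sQ := Qi_subfield.

Lemma tau_sqr I J g : ideal I -> ideal J -> (forall x, k x -> J x <-> I (tau x)) ->
  O g -> I ** I = P g -> J ** J = P (tau g).
Proof.
move=> hI hJ hIJ og eI; have otg := tau_O kE tau_i tau_s og.
have tK x : k x -> tau (tau x) = x by exact: (tauK kE tau_i tau_s).
have hJJ := mul_ideal sk hJ hJ.
apply: ideal_ext_eq => z; split.
  apply: (mul_min (pideal_ideal sk otg)) => x y hx hy.
  have [kx _] := idO hJ hx; have [ky _] := idO hJ hy.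
  have : (I ** I) (tau x * tau y).
    by apply: mem_mul; [apply/(hIJ _ kx) | apply/(hIJ _ ky)].
  rewrite eI => /(pidealP sk _ og)[t ht et]; apply/(pidealP sk _ otg).
  exists (tau t); first exact: (tau_O kE tau_i tau_s).
  by rewrite -rmorphM -et rmorphM /= !tK.
case/(pidealP sk _ otg) => t ht ->; apply: (idMr hJJ) => //.
have hM := tau_ideal_ideal sk kE tau_i tau_s hJJ.
have : (I ** I) g by rewrite eI; exact: mem_pideal.
suff sub : forall x y, I x -> I y -> k (x * y) /\ tau_ideal tau (J ** J) (x * y).
  by move/(mul_min hM sub) => [].
move=> x y hx hy; have [kx _] := idO hI hx; have [ky _] := idO hI hy.
split; first exact: sfM.
rewrite /tau_ideal rmorphM; apply: mem_mul.
  by apply/hIJ; [exact: (tau_k kE tau_i tau_s) | rewrite tK].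
by apply/hIJ; [exact: (tau_k kE tau_i tau_s) | rewrite tK].
Qed.

Lemma nonzero_sqr I g : ideal I -> O g -> g != 0 -> I ** I = P g -> nonzero_ideal k I.
Proof.
move=> hI og g0 eI; split=> //; exists g; split=> //.
have : (I ** I) g by rewrite eI; exact: mem_pideal.
by apply: (mul_min hI) => x y hx hy; apply: (idMr hI) => //; exact: (idO hI).
Qed.

Hypothesis unit_norm : forall g n u, O g -> Zi n -> n != 0 -> is_unit4 u ->
  g * tau g = u * n ^+ 2 -> u = 1 \/ u = -1.

(* If [I^2 = (g)] with [g * tau g = n^2], Hilbert 90 reads [(g + n)^2 = g * c] with
   [c = tr g + 2 n] in [Z[i]]; so [J = c I / (g + n)] satisfies [J^2 = (c)]. *)
Lemma reduce_square I g : nonzero_ideal k I -> O g -> I ** I = P g ->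
  exists J c, [/\ ideal J, Zi c, c != 0, J ** J = P c & same_class k I J].
Proof.
move=> nI og eI; have [hI [x0 [hx0 x00]]] := nI.
have g0 : g != 0.
  apply: contraNneq x00 => g0; have : (I ** I) (x0 * x0) by exact: mem_mul.
  rewrite eI => /(pidealP sk _ og)[t _ /eqP]; rewrite g0 mul0r mulf_eq0 orbb => /eqP ->.
  exact: eqxx.
have [J1 [n [hJ1 hn n0 eIJ hIJ]]] := invertible sk kE tau_i tau_s s0 nI.
have on := Zi_O kE hn; have otg := tau_O kE tau_i tau_s og.
have eJ1 := tau_sqr hI hJ1 hIJ og eI.
have eN : P (g * tau g) = P (n * n).
  by rewrite -!pidealM // -eI -eJ1 (idmulACA sk) // eIJ.
have [g' [og' eP eg']] : exists g', [/\ O g', P g' = P g & g' * tau g' = n ^+ 2].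
  have tg0 : tau g != 0 by rewrite fmorph_eq0.
  have [h1 h2 _] := pideal_eq_unit sk (riM sk og otg) (riM sk on on) (mulf_neq0 g0 tg0) eN.
  have u4 : is_unit4 (g * tau g / (n * n)).
    apply: Zi_unit; [|by case: h2|by rewrite invf_div; case: h1|by rewrite !mulf_neq0 ?invr_eq0 ?mulf_neq0].
    by apply: (sf_div sQ); [case: (norm_Zi sk kE tau_i tau_s s0 og) | apply: (sfM sQ); case: hn].
  have eu : g * tau g = g * tau g / (n * n) * n ^+ 2 by rewrite -expr2 divfK // expf_neq0.
  case: (unit_norm og hn n0 u4 eu) => e; rewrite e in eu.
    by exists g; rewrite eu mul1r.
  (* When the norm is [- n ^+ 2], the generator is multiplied by ['i], whose norm to [Q(i)] is
     -1. *)
  have oi : O 'i := Zi_O kE Zi_i.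
  have i2 : 'i * 'i = -1 :> algC := mulCii _.
  have iV : ('i : algC)^-1 = - 'i := invCi _.
  exists (g * 'i); split; first exact: riM.
    by apply: pideal_unit => //; [rewrite iV; exact: riN | exact: neq0Ci].
  by rewrite rmorphM /= tau_i mulrACA eu i2; ring.
rewrite -eP in eI => {eN eJ1}.
have g'0 : g' != 0.
  by apply: contraNneq n0 => h; move/eqP: eg'; rewrite h mul0r eq_sym expf_eq0.
(* The Hilbert 90 element degenerates exactly when [g' = - n]; then [g'] is already a Gaussian
   integer. *)
have [e0|e0] := eqVneq (g' + n) 0.
  have eg : g' = - n by apply/eqP; rewrite -addr_eq0 e0.
  exists I, g'; split=> //; last exact: sc_refl.
  by rewrite eg; exact: (riN sQ).
pose c := g' + tau g' + 2 * n.
have hc : Zi c.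
  apply: (riD sQ); first exact: (trace_Zi sk kE tau_i tau_s s0).
  by apply: (riM sQ) => //; exact: (ri_nat sQ 2).
have oc := Zi_O kE hc; have oe : O (g' + n) by exact: riD.
have ec : (g' + n) ^+ 2 = g' * c.
  transitivity (g' ^+ 2 + 2 * g' * n + n ^+ 2); first by ring.
  by rewrite -eg' /c; ring.
have c0 : c != 0.
  by apply: contraNneq e0 => h; move/eqP: ec; rewrite h mulr0 expf_eq0.
have [x hx|J [hJ eJ _]] := pmul_div sk hI oc oe c0 e0.
  have : (I ** I) (x * x) by exact: mem_mul.
  rewrite eI => /(pidealP sk _ og')[r [_ hr] er].
  apply: (@Aint_rootn 2) => //; rewrite expr_div_n ec exprMn expr2 [x ^+ 2]expr2 er.
  have -> : c * c * (g' * r) / (g' * c) = c * r by field; rewrite c0 g'0.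
  by apply: rpredM => //; case: hc.
exists J, c; split=> //; last by apply: (same_class_eq oc oe c0 e0); rewrite eJ.
have oee : O ((g' + n) * (g' + n)) by exact: riM.
apply: (pcancel sk oee); rewrite ?mulf_neq0 //; try exact: mul_ideal; try exact: pideal_ideal.
have pe := pideal_ideal sk oe; have pc := pideal_ideal sk oc.
rewrite -[in LHS](pidealM sk oe oe) (idmulACA sk pe pe hJ hJ) eJ (idmulACA sk pc hI pc hI) eI.
rewrite !(pidealM sk) //; try exact: riM.
by congr (P _); rewrite -[(g' + n) * _]expr2 ec; ring.
Qed.

(* After dividing [J] by its content in [Z[i]], [J] is [tau]-stable and [J^2 = (r)] with
   [J] inter [Z[i]] equal to [(r)]; then [2 s J^2] is contained in [r J], so [r] divides [(2 s)^2]. *)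
Lemma reduce_conductor J c : nonzero_ideal k J -> Zi c -> c != 0 -> J ** J = P c ->
  exists J' l, [/\ nonzero_ideal k J', Zi l, l != 0, J' ** J' = P l /\ zdvd l (4 * s ^+ 2)
    & same_class k J J'].
Proof.
move=> nJ hc c0 eJ; have [hJ _] := nJ; have oc := Zi_O kE hc.
have Jc : J c.
  have : (J ** J) c by rewrite eJ; exact: mem_pideal.
  by apply: (mul_min hJ) => x y hx hy; apply: (idMr hJ) => //; exact: (idO hJ).
have hM : is_ideal Qi (fun z => Zi z /\ J z).
  split=> [z [] //||x y [zx hx] [zy hy]|r x zr [zx hx]].
  - by split; [exact: (ri0 sQ) | exact: (id0 hJ)].
  - by split; [exact: (riD sQ) | exact: (idD hJ)].
  - by split; [exact: (riM sQ) | apply: (idMl hJ) => //; exact: (Zi_O kE)].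
have [|t ht [t0 eM]] := @Zi_pid _ (conj hM _); first by exists c.
have inM z : Zi z -> J z -> zdvd t z.
  by move=> h1 h2; have : pideal Qi t z by [rewrite -eM]; move/(pidealP sQ _ ht).
have [m hm em] := inM c hc Jc.
have Jt : J t by have : pideal Qi t t by [exact: mem_pideal]; rewrite -eM => -[].
have ot := Zi_O kE ht; have om := Zi_O kE hm.
have m0 : m != 0 by apply: contraNneq c0 => h; rewrite em h mulr0.
(* From [c = t * m] and [t ^+ 2 = c * r] follow [t = m * r] and [c = m ^+ 2 * r]: the content to
   divide out is [m], and the new square is [(r)]. *)
have [r hr er] : zdvd c (t * t).
  have : (J ** J) (t * t) by exact: mem_mul.
  rewrite eJ => /(pidealP sk _ oc)[r [kr ar] er]; exists r => //; split=> //.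
  have -> : r = t * t / c by rewrite er mulrC mulKf.
  by apply: (sf_div sQ); [apply: (sfM sQ); case: ht | case: hc].
have etm : t = m * r by apply: (mulfI t0); rewrite er em mulrA.
have ecm : c = m * m * r by rewrite em {1}etm; ring.
have o_r := Zi_O kE hr.
have r0 : r != 0 by apply: contraNneq t0 => h; rewrite etm h mulr0.
have [|x hx|J' [hJ' eJ' _]] := pmul_div sk hJ (ri1 sk) om _ m0; rewrite ?oner_eq0 //.
  have : (J ** J) (x * x) by exact: mem_mul.
  rewrite eJ => /(pidealP sk _ oc)[w [_ hw] ew].
  apply: (@Aint_rootn 2) => //; rewrite mul1r expr_div_n expr2 ew ecm.
  have -> : m * m * r * w / m ^+ 2 = r * w by field; exact: m0.
  by apply: rpredM => //; case: hr.
rewrite (pideal1 sk) (idOmul sk hJ) in eJ'.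
have pm := pideal_ideal sk om; have omm := riM sk om om.
have hJJ' := mul_ideal sk hJ' hJ'.
have eJJ : J' ** J' = P r.
  apply: (pcancel sk omm) => //; rewrite ?mulf_neq0 //; first exact: pideal_ideal.
  by rewrite -[in LHS](pidealM sk om om) (idmulACA sk pm pm hJ' hJ') eJ' eJ (pidealM sk) // ecm.
have nJ' := nonzero_sqr hJ' o_r r0 eJJ.
have inJ' z : Zi z -> J' z -> zdvd r z.
  move=> zz hz; have hmz : J (m * z) by rewrite -eJ'; apply: mem_mul => //; exact: mem_pideal.
  have [y hy ey] := inM _ (riM sQ hm zz) hmz; exists y => //.
  by apply: (mulfI m0); rewrite ey etm mulrA.
have tr : tau r = r by apply: Qi_fix => //; case: hr.
have [J1 [n [hJ1 hn n0 eJ1 hJJ1]]] := invertible sk kE tau_i tau_s s0 nJ'.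
have eJ1J1 := tau_sqr hJ' hJ1 hJJ1 o_r eJJ; rewrite tr in eJ1J1.
(* The conjugate of [J'] has the same square, because [r] is fixed by [tau]. *)
have eqJ1 : J1 = J'.
  apply: (sqr_inj sk kE tau_i tau_s s0) => //; last by rewrite eJJ.
  exact: nonzero_sqr eJ1J1.
have tauJ x : J' x -> J' (tau x).
  by move=> hx; have [kx _] := idO hJ' hx; apply/(hJJ1 _ kx); rewrite eqJ1.
have os := s_O kE Zs2.
have trJ x : J' x -> zdvd r (x + tau x).
  move=> hx; apply: inJ'; first exact: (trace_Zi sk kE tau_i tau_s s0 (idO hJ' hx)).
  by apply: (idD hJ') => //; exact: tauJ.
have o2s : O (2 * s) by apply: riM => //; exact: (ri_nat sk 2).
have pr := pideal_ideal sk o_r.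
have hPJ := mul_ideal sk pr hJ'.
have : (P r ** J') (2 * s * r).
  have : (J' ** J') r by rewrite eJJ; exact: mem_pideal.
  move/(mul_min (colon_ideal sk hPJ o2s)) => h; suff sub : forall x y, J' x -> J' y ->
      O (x * y) /\ (P r ** J') (2 * s * (x * y)) by case: (h sub).
  move=> x y hx hy; have ox := idO hJ' hx; have oy := idO hJ' hy; split; first exact: riM.
  have [w1 hw1 ew1] := trJ x hx.
  have [w2 hw2 ew2] := trJ (x * s) (idMr hJ' os hx).
  rewrite mulrA; apply: mem_mul => //; apply/(pidealP sk _ o_r).
  (* [2 * s * x] is [s] times the trace of [x] plus the trace of [x * s], since [tau s = - s]; both
     traces are multiples of [r]. *)
  exists (w1 * s + w2).
    by apply: riD => //; [apply: riM => //; exact: (Zi_O kE) | exact: (Zi_O kE)].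
  rewrite mulrDr -ew2 mulrA -ew1 rmorphM /= tau_s; ring.
case/(pmulP sk _ o_r hJ') => w hw; rewrite mulrC => /(mulfI r0) ew.
rewrite -ew in hw.
exists J', r; split=> //; last first.
  by apply: (same_class_eq (ri1 sk) om); rewrite ?oner_eq0 ?(pideal1 sk) ?(idOmul sk).
split=> //.
have : (J' ** J') (2 * s * (2 * s)) by exact: mem_mul.
rewrite eJJ => /(pidealP sk _ o_r)[y [ky ay] ey].
have e4 : 4 * s ^+ 2 = r * y by rewrite -ey; ring.
exists y => //; split=> //.
have -> : y = 4 * s ^+ 2 / r by rewrite e4 mulrC mulKf.
by apply: (sf_div sQ); [apply: (sfM sQ); [exact: (sf_nat sQ 4) | case: Zs2] | case: hr].
Qed.

(** Squares of elements of [I] lie in [(q)], hence in the prime [H], so [I] is contained in [H] and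
    [I ** H] in [(q)]; [J] is [I ** H] divided by [q]. *)
Lemma strip_ramified I H q c : ideal I -> prime_ideal k H -> Zi q -> q != 0 -> H ** H = P q ->
  Zi c -> c != 0 -> I ** I = P (q * c) -> exists J, [/\ ideal J, J ** J = P c & I = J ** H].
Proof.
move=> hI [[hH _] _ pH] hq q0 eH hc c0 eI; have oq := Zi_O kE hq; have oc := Zi_O kE hc.
have oqc := riM sk oq oc.
have IH x : I x -> H x.
  move=> hx; have ox := idO hI hx; suff : H (x * x) by case/(pH _ _ ox ox).
  have : (I ** I) (x * x) by exact: mem_mul.
  rewrite eI => /(pidealP sk _ oqc)[r hr ->].
  have : (H ** H) q by rewrite eH; exact: mem_pideal.
  rewrite -mulrA => h; apply: (idMr hH); first exact: riM.
  by apply: (mul_min hH) h => x' y' hx' hy'; apply: (idMr hH) => //; exact: (idO hH).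
have hIH := mul_ideal sk hI hH.
have sub z : (I ** H) z -> P q z.
  apply: (mul_min (pideal_ideal sk oq)) => x y hx hy.
  by rewrite -eH; apply: mem_mul => //; exact: IH.
have [|x hx|J [hJ eJ _]] := pmul_div sk hIH (ri1 sk) oq _ q0; rewrite ?oner_eq0 //.
  by have [r [_ hr] ->] := (proj1 (pidealP sk _ oq) (sub _ hx)); rewrite mul1r mulrC mulKf.
rewrite (pideal1 sk) (idOmul sk hIH) in eJ.
have pq := pideal_ideal sk oq; have pc := pideal_ideal sk oc.
have hJJ := mul_ideal sk hJ hJ; have hJH := mul_ideal sk hJ hH.
exists J; split=> //.
  apply: (pcancel sk (riM sk oq oq)) => //; rewrite ?mulf_neq0 //.
  rewrite -(pidealM sk oq oq) (idmulACA sk pq pq hJ hJ) eJ (idmulACA sk hI hH hI hH) eI eH.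
  by rewrite -(pidealM sk oq oc) (idmulAC sk pq pc pq).
apply: (pcancel sk oq) => //.
by rewrite (idmulA sk pq hJ hH) eJ -(idmulA sk hI hH hH) eH (idmulC _ I).
Qed.

(** A list with multiplicities of ramified primes, each with the generator of its square, such that
    multiplication by each prime preserves the property [C]. *)
Fixpoint ramified_list (C : (algC -> Prop) -> Prop) (hs : seq ((algC -> Prop) * algC)) : Prop :=
  if hs is h :: hs' then
    [/\ prime_ideal k h.1, Zi h.2 /\ prime_elt h.2, h.2 != 0, h.1 ** h.1 = P h.2
      & (forall I, ideal I -> C I -> C (I ** h.1)) /\ ramified_list C hs']
  else True.

(** The first prime element of the list divides [c], and then its ideal is split off from [I], or it
    divides [c'] and is cancelled there. At the end [c] is a unit and [I] has square [O], so
    [I = O]. *)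
Lemma strip_all C hs : C O -> ramified_list C hs -> forall I c c', ideal I -> Zi c -> Zi c' ->
  c != 0 -> I ** I = P c -> c * c' = \prod_(h <- hs) h.2 -> C I.
Proof.
move=> CO; elim: hs => [|[H q] hs ih] hr I c c' hI hc hc' c0 eI; rewrite ?big_nil ?big_cons /=.
  move=> e1; suff -> : I = O by [].
  have oc := Zi_O kE hc; have oc' := Zi_O kE hc'.
  have c'0 : c' != 0 by apply/eqP => h; move/eqP: e1; rewrite h mulr0 eq_sym oner_eq0.
  apply: (sqr_inj sk kE tau_i tau_s s0); [exact: nonzero_sqr eI | exact: nonzero_O |].
  rewrite eI (idmulO sk (ideal_O sk)) -(pideal1 sk) -e1 pideal_unit //.
  have -> : c'^-1 = c by apply: (mulIf c'0); rewrite e1 mulVf.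
  by [].
case: hr => /= pH [hq pq] q0 eH [CH hr] e.
have [[c1 hc1 ec]|[c1 hc1 ec]] : zdvd q c \/ zdvd q c'.
- apply: pq => //; exists (\prod_(j <- hs) j.2) => //.
  elim: hs hr {ih e} => [|h hs ih] /=; first by rewrite big_nil => _; exact: (ri1 sQ).
  by case=> _ [hh _] _ _ [_ hr]; rewrite big_cons; apply: (riM sQ) => //; exact: ih.
- have c10 : c1 != 0 by apply: contraNneq c0 => h; rewrite ec h mulr0.
  rewrite ec in eI; have [J [hJ eJ ->]] := strip_ramified hI pH hq q0 eH hc1 c10 eI.
  apply: CH => //; apply: (ih hr J c1 c') => //.
  by apply: (mulfI q0); rewrite -e ec mulrA.
apply: (ih hr I c c1) => //.
by apply: (mulfI q0); rewrite -e ec mulrCA.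
Qed.
End Torsion.

(** * Capitulation *)

Section CapitulationNorm.
Variables (k K : algC -> Prop) (sg : {rmorphism algC -> algC}).
Hypotheses (sk : is_subfield k) (sK : is_subfield K) (kK : forall x, k x -> K x).
Hypotheses (sg_k : forall x, k x -> sg x = x) (sg_fix : forall x, K x -> sg x = x -> k x).
Hypotheses (sg_K : forall x, K x -> K (sg x)) (sg_sg : forall x, K x -> sg (sg x) = x).
Hypothesis inv_k : forall I, nonzero_ideal k I -> exists J n,
  [/\ is_ideal k J, ringint k n, n != 0 & ideal_mul k I J = pideal k n].
Local Notation O := (ringint k).
Local Infix "**" := (ideal_mul k) (at level 40, left associativity).
Local Notation P := (pideal k).

(* If [I] extends to [(a)], then [I^2] is generated by the norm of [a]. *)
Lemma cap_norm I : nonzero_ideal k I -> capitulates K I -> exists2 g, O g & I ** I = P g.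
Proof.
move=> nI /capitulatesE[a ha ea]; have [hI [x0 [hx0 x00]]] := nI.
have [Ka aa] := ha; have Ksa := sg_K Ka.
pose g := a * sg a.
have kg : k g.
  by apply: sg_fix; [exact: sfM | rewrite /g rmorphM /= sg_sg // mulrC].
have og : O g by split=> //; apply: rpredM; rewrite ?Aint_aut.
have dv x : I x -> exists2 r, ringint K r & x = a * r.
  by move=> hx; apply/(pidealP sK _ ha); rewrite -ea; exact: mem_ext.
have a0 : a != 0.
  by have [r _ e] := dv _ hx0; apply: contraNneq x00 => h; rewrite e h mul0r.
have sa0 : sg a != 0 by rewrite fmorph_eq0.
have g0 : g != 0 by rewrite mulf_neq0.
exists g => //; apply: ideal_ext_eq => z; split.
  apply: (mul_min (pideal_ideal sk og)) => x y hx hy.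
  have [r [_ hr] er] := dv x hx; have [t [Kt ht] et] := dv y hy.
  have [kx _] := idO hI hx; have [ky _] := idO hI hy.
  apply/(pidealP sk _ og); exists (x * y / g); last by rewrite [RHS]mulrC divfK.
  split; first by apply: sf_div => //; exact: sfM.
  (* [y] is fixed by [sg], so [x * y / g] is [x / a] times the image under [sg] of [y / a]. *)
  have -> : x * y / g = r * sg t.
    rewrite -(sg_k ky) er et rmorphM /= /g; field; by rewrite a0 sa0.
  by apply: rpredM; rewrite ?Aint_aut.
have hII := mul_ideal sk hI hI.
(* With [I ** J = (n)], each [a * y] for [y] in [J] is a multiple of [n], so [g] times [J ** J] lies
   in [(n ^+ 2)]. Multiplying by [I ** I] puts [g * n ^+ 2] into [n ^+ 2] times [I ** I]. *)
suff hg : (I ** I) g by case/(pidealP sk _ og) => t ht ->; exact: (idMr hII).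
have [J [n [hJ on n0 eIJ]]] := inv_k nI.
have onn := riM sk on on; have [kn _] := on; have On' := ri_sub kK on.
have aJ y : J y -> exists2 w, ringint K w & a * y = n * w.
  move=> hy; have oy := idO hJ hy; have oy' := ri_sub kK oy.
  have : ideal_ext K I a by rewrite ea; exact: mem_pideal.
  have pn := pideal_ideal sK On'.
  move/(ext_elim (colon_ideal sK pn oy')) => h; suff sub : forall x, I x -> ringint K x /\ pideal K n (y * x).
    have [_] := h sub; rewrite mulrC; case/(pidealP sK _ On') => w hw ew.
    by exists w.
  move=> x hx; split; first exact: (ri_sub kK (idO hI hx)).
  have : P n (x * y) by rewrite -eIJ; exact: mem_mul.
  case/(pidealP sk _ on) => w hw ew; apply/(pidealP sK _ On'); exists w; first exact: (ri_sub kK hw).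
  by rewrite mulrC.
have hJJ := mul_ideal sk hJ hJ.
have sub z' : (P g ** (J ** J)) z' -> P (n * n) z'.
  case/(pmulP sk _ og hJJ) => w hw ->.
  have hM := colon_ideal sk (pideal_ideal sk onn) og.
  suff sub : forall x y, J x -> J y -> O (x * y) /\ P (n * n) (g * (x * y)).
    by have [] := mul_min hM sub hw.
  move=> x y hx hy; have ox := idO hJ hx; have oy := idO hJ hy; split; first exact: riM.
  have [w1 [Kw1 hw1] e1] := aJ x hx; have [w2 [Kw2 hw2] e2] := aJ y hy.
  have [kx _] := ox; have [ky _] := oy.
  apply/(pidealP sk _ onn); exists (g * (x * y) / (n * n)); last by rewrite [RHS]mulrC divfK // mulf_neq0.
  split; first exact: (sf_div sk (sfM sk kg (sfM sk kx ky)) (sfM sk kn kn)).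
  have -> : g * (x * y) / (n * n) = w1 * sg w2.
    apply: (mulIf (mulf_neq0 n0 n0)); rewrite divfK ?mulf_neq0 //.
    transitivity ((a * x) * (sg a * sg y)); first by rewrite (sg_k ky) /g; ring.
    by rewrite -rmorphM /= e1 e2 rmorphM /= (sg_k kn); ring.
  by apply: rpredM; rewrite ?Aint_aut.
have pg := pideal_ideal sk og; have pnn := pideal_ideal sk onn.
have e : P g ** (J ** J) ** (I ** I) = P g ** P (n * n).
  by rewrite -idmulA // (idmulACA sk hJ hJ hI hI) (idmulC _ J) eIJ (pidealM sk on on).
have : (P (n * n) ** (I ** I)) (g * (n * n)).
  have : (P g ** (J ** J) ** (I ** I)) (g * (n * n)).
    by rewrite e; apply: mem_mul; exact: mem_pideal.
  apply: (mul_min (mul_ideal sk pnn hII)) => x y hx hy.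
  by apply: mem_mul => //; exact: sub.
by case/(pmulP sk _ onn hII) => w hw; rewrite mulrC => /(mulfI (mulf_neq0 n0 n0)) ->.
Qed.
End CapitulationNorm.

(** * Factorization of Gaussian integers prime to their conjugate *)

Section Peel.
Local Notation sQ := Qi_subfield.

(** Bezout form of coprimality of [a] and its conjugate. It passes to divisors, and makes [a] a unit
    times a square as soon as its norm is a square. *)
Definition conj_coprime (a : algC) : Prop := exists u v, [/\ Zi u, Zi v & u * a + v * a^* = 1].

Lemma conj_coprime_div g a : Zi g -> conj_coprime (g * a) -> conj_coprime a.
Proof.
move=> hg [u [v [hu hv e]]]; exists (u * g), (v * g^*); split.
- exact: (riM sQ).
- by apply: (riM sQ) => //; exact: Zi_conj.
- by rewrite -e rmorphM /=; ring.
Qed.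

(** [gi A B] is prime and divides the norm of [a], so it divides [a] or its conjugate; in the second
    case [gi A (- B)] divides [a]. The choice of sign cannot be controlled. *)
Lemma peel (r : nat) (A B m : int) a : prime r -> r%:Z = A ^+ 2 + B ^+ 2 -> Zi a ->
  a * a^* = (r%:Z * m)%:~R -> conj_coprime a ->
  exists B' a', [/\ B' = B \/ B' = - B, Zi a', a = gi A B' * a', a' * a'^* = m%:~R & conj_coprime a'].
Proof.
move=> pr er ha ea ca; have hac := Zi_conj ha.
have rg B' : B' = B \/ B' = - B -> gi A B' * (gi A B')^* = r%:Z%:~R.
  by case=> ->; rewrite gi_norm /gnorm er ?sqrrN.
have r0 : (r%:Z%:~R : algC) != 0 by rewrite intr_eq0 eqz_nat -lt0n prime_gt0.
have fin B' a' : B' = B \/ B' = - B -> Zi a' -> a = gi A B' * a' ->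
    exists B' a', [/\ B' = B \/ B' = - B, Zi a', a = gi A B' * a', a' * a'^* = m%:~R & conj_coprime a'].
  move=> hB' ha' e; exists B', a'; split=> //.
    apply: (mulfI r0); transitivity (a * a^*); last by rewrite ea rmorphM.
    by rewrite e -(rg _ hB') rmorphM /=; ring.
  by apply: (conj_coprime_div (Zi_gi A B')); rewrite -e.
have : zdvd (gi A B) (a * a^*).
  exists ((gi A B)^* * m%:~R); last by rewrite ea rmorphM /= -(rg B) ?mulrA //; left.
  by apply: (riM sQ); [apply: Zi_conj; exact: Zi_gi | exact: (ri_int sQ)].
case/(gi_prime_elt pr er ha hac) => -[a' ha' e].
  by apply: (fin B a') => //; left.
apply: (fin (- B) a'^*); [by right | exact: Zi_conj|].
by rewrite -[LHS]conjCK e rmorphM /= gi_conj.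
Qed.

Lemma conj_coprime_sqr (y : int) a : Zi a -> a != 0 -> a * a^* = (y ^+ 2)%:~R -> conj_coprime a ->
  exists w z, [/\ Zi w, Zi w^-1, w != 0, Zi z & a = w * z ^+ 2].
Proof.
move=> ha a0 ea [u [v [hu hv e]]].
apply: (Zi_sqr_factor ha (Zi_conj ha) (ri_int sQ y) hu hv a0 _ e).
by rewrite ea rmorphXn.
Qed.

(** An ideal containing 2 and an odd norm contains 1. *)
Lemma conj_coprime_odd a (n : int) u v : Zi u -> Zi v -> a * a^* = (2 * n + 1)%:~R -> Zi a ->
  u * a + v * a^* = 2 -> conj_coprime a.
Proof.
move=> hu hv ea ha e; exists (a^* - n%:~R * u), (- (n%:~R * v)).
have hn := ri_int sQ n; split.
- by apply: (riB sQ); [exact: Zi_conj | exact: (riM sQ)].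
- by apply: (riN sQ); exact: (riM sQ).
- transitivity (a * a^* - n%:~R * (u * a + v * a^*)); first by ring.
  by rewrite e ea rmorphD rmorphM /=; ring.
Qed.
End Peel.

(* With [e = x + y t] of norm [-1], Hilbert 90 for [i e] reads [(1 + i e)^2 = i (1 + i)^2 e (x - i)]. *)
Lemma sqrt_from_neg_pell (K : algC -> Prop) t (x y : int) rho w z : is_subfield K ->
  K 'i -> K t -> t \in Aint -> x%:~R ^+ 2 + 1 = t ^+ 2 * y%:~R ^+ 2 ->
  Zi w -> Zi w^-1 -> w != 0 -> Zi z -> K z -> x%:~R - 'i = rho * (w * z ^+ 2) ->
  exists b u, [/\ K b, u \in Aint, u^-1 \in Aint, u != 0 & b ^+ 2 = rho * u].
Proof.
move=> sK Ki Kt At exy hw hwV w0 hz Kz e.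
have i2 : 'i * 'i = -1 :> algC := mulCii _.
pose ep := x%:~R + y%:~R * t; pose ep' := y%:~R * t - x%:~R.
have ee : ep * ep' = 1.
  transitivity (t ^+ 2 * y%:~R ^+ 2 - x%:~R ^+ 2); first by rewrite /ep /ep'; ring.
  by rewrite -exy; ring.
have ep0 : ep != 0 by apply/eqP => h; move/eqP: ee; rewrite h mul0r eq_sym oner_eq0.
have epV : ep^-1 = ep' by apply: (mulfI ep0); rewrite mulfV.
have Aep : ep \in Aint by apply: rpredD; [exact: Aint_int | apply: rpredM => //; exact: Aint_int].
have Aep' : ep' \in Aint by apply: rpredB; [apply: rpredM => //; exact: Aint_int | exact: Aint_int].
have xi0 : x%:~R - 'i != 0 :> algC.
  rewrite subr_eq0; apply/eqP => h; have := sqrCi algC; rewrite -h -rmorphXn /= => h2.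
  have : x ^+ 2 = -1 by apply: (@intr_inj algC); rewrite h2 rmorphN.
  by have := sqr_ge0 x; clear; lia.
have z0 : z != 0 by apply: contraNneq xi0 => h; rewrite e h expr0n mulr0 mulr0.
have i1 := gi11_neq0.
have Kx : K x%:~R := sf_int sK x; have Ky : K y%:~R := sf_int sK y.
have Kep : K ep by apply: (sfD sK) => //; exact: (sfM sK).
exists ((1 + 'i * ep) / ((1 + 'i) * z)), ('i * ep * w); split.
- apply: (sf_div sK); last by apply: (sfM sK) => //; apply: (sfD sK) => //; exact: (sf1 sK).
  by apply: (sfD sK); [exact: (sf1 sK) | exact: (sfM sK)].
- by apply: rpredM; [apply: rpredM => //; exact: Aint_i | case: hw].
- rewrite !invfM epV; apply: rpredM; last by case: hwV.
  apply: rpredM => //.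
  by rewrite invCi rpredN Aint_i.
- by rewrite !mulf_neq0 ?neq0Ci.
have h : (1 + 'i * ep) ^+ 2 = 'i * (1 + 'i) ^+ 2 * ep * (x%:~R - 'i).
  have ep2 : ep * ep = 2 * x%:~R * ep + 1.
    by transitivity (2 * x%:~R * ep + ep * ep'); [rewrite /ep /ep'; ring | rewrite ee].
  transitivity (1 + 2 * 'i * ep + ('i * 'i) * (ep * ep)); first by ring.
  transitivity (- 2 * ep * (x%:~R - 'i)); first by rewrite i2 ep2; ring.
  transitivity (('i + 2 * ('i * 'i) + 'i * ('i * 'i)) * ep * (x%:~R - 'i)); last by ring.
  by rewrite i2; ring.
rewrite expr_div_n exprMn h e; field; by rewrite z0 i1.
Qed.

Lemma Zi_real_int x : Zi x -> x^* = x -> exists n : int, x = n%:~R.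
Proof.
case/ZiP=> a [b ->]; rewrite gi_conj => /gi_inj[_ hb]; exists a.
by rewrite gi_int; congr gi; move: hb; clear; lia.
Qed.

Lemma unit4_X4 u : is_unit4 u -> u ^+ 4 = 1.
Proof.
by case=> ->; rewrite (exprM _ 2 2) ?sqrrN ?sqrCi ?sqrrN !expr1n.
Qed.

Lemma Zi_norm1 n : Zi n -> n * n^* = 1 -> is_unit4 n.
Proof.
move=> hn e; have n0 : n != 0 by apply/eqP => h; move/eqP: e; rewrite h mul0r eq_sym oner_eq0.
have [Qn An] := hn; apply: Zi_unit => //.
have -> : n^-1 = n^* by apply: (mulfI n0); rewrite e mulfV.
by rewrite Aint_conj.
Qed.

(** * Integers of absolute value one in a quadratic extension of [Q(i)] *)

Section Kronecker.
Variables (s : algC) (u : {rmorphism algC -> algC}).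
Hypotheses (Qs2 : Qi (s ^+ 2)) (s0 : s != 0) (s_real : s^* = s).
Hypotheses (ui : u 'i = 'i) (us : u s = - s) (u48 : forall z, z ^+ 48 = 1 -> u z = z).
Local Notation sQ := Qi_subfield.

Lemma quad_conj x : quad Qi s x -> quad Qi s x^* /\ u x^* = (u x)^*.
Proof.
case=> a [b [ha hb ->]]; have uQ := Qi_fix ui.
rewrite !(rmorphD, rmorphM) /= s_real us rmorphN /= s_real !uQ //; last exact: Qi_conj; last exact: Qi_conj.
by split; [exists a^*, b^*; split=> //; exact: Qi_conj | ring].
Qed.

(* [x^2 = n v] with [n = x * u x] a unit of [Z[i]] and [v = x * (u x)^*]; the trace of [v] is an
   integer of absolute value at most 2, so [v] is a root of unity, and [u v = v^-1]. *)
Lemma norm1_root8 x : quad Qi s x -> x \in Aint -> x * x^* = 1 -> x ^+ 8 = 1.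
Proof.
move=> hx ax ex; have sK := quad_subfield sQ Qs2; have uQ z := @Qi_fix u z ui.
have [hxc comm] := quad_conj hx.
have hux := quad_stable sQ uQ us hx.
have uu : u (u x) = x.
  case: hx => a [b [ha hb ->]].
  by rewrite !(rmorphD, rmorphM) /= us rmorphN /= us !uQ // opprK.
have fixQ := quad_fixed uQ us s0.
have x0 : x != 0 by apply/eqP => h; move/eqP: ex; rewrite h mul0r eq_sym oner_eq0.
have eux : u x * (u x)^* = 1 by rewrite -comm -rmorphM ex rmorph1.
have ux0 : u x != 0 by rewrite fmorph_eq0.
have xV : x^-1 = x^* by apply: (mulfI x0); rewrite ex mulfV.
have uxV : (u x)^-1 = (u x)^* by apply: (mulfI ux0); rewrite eux mulfV.
pose n := x * u x.
have hn : Zi n.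
  split; last by apply: rpredM; rewrite ?Aint_aut.
  by apply: fixQ; [exact: (sfM sK) | rewrite /n rmorphM /= uu mulrC].
have n4 : n ^+ 4 = 1.
  by apply/unit4_X4/Zi_norm1 => //; rewrite /n rmorphM /= mulrACA ex eux mulr1.
pose v := x * (u x)^*.
have v0 : v != 0 by rewrite mulf_neq0 // -uxV invr_eq0.
have Av : v \in Aint by apply: rpredM; rewrite ?Aint_conj ?Aint_aut.
have uv : u v = v^-1.
  have cu : u (u x)^* = x^* by have [_ ->] := quad_conj hux; rewrite uu.
  apply: (mulfI v0); rewrite mulfV // {2}/v rmorphM /= cu /v.
  by transitivity ((x * x^*) * (u x * (u x)^*)); [ring | rewrite ex eux mulr1].
have cv : v^* = v^-1.
  apply: (mulfI v0); rewrite mulfV // /v rmorphM /= conjCK.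
  by transitivity ((x * x^*) * (u x * (u x)^*)); [ring | rewrite ex eux mulr1].
have Kv : quad Qi s v by apply: (sfM sK) => //; have [] := quad_conj hux.
pose T := v + u v.
have [a eT] : exists a : int, T = a%:~R.
  apply: Zi_real_int; last by rewrite /T rmorphD /= uv fmorphV /= cv invrK addrC.
  split; last by apply: rpredD; rewrite ?Aint_aut.
  apply: fixQ; first by apply: (sfD sK) => //; exact: (quad_stable sQ uQ us Kv).
  by rewrite /T rmorphD /= uv fmorphV /= uv invrK addrC.
rewrite /T uv in eT.
have eV : v * v = a%:~R * v - 1 by rewrite -eT mulrDl mulVf //; ring.
(* The squared absolute value of [v - v^-1] is [4 - a ^+ 2]. *)
have a2 : a ^+ 2 <= 4.
  have h : (v - v^*)^* = - (v - v^*) by rewrite rmorphB /= conjCK opprB.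
  have : 0 <= (v - v^*) * (v - v^*)^* by exact: mul_conjC_ge0.
  rewrite h cv mulrN.
  have -> : - ((v - v^-1) * (v - v^-1)) = (4 - a ^+ 2)%:~R.
    by rewrite rmorphB rmorphXn /= -eT; field; exact: v0.
  by rewrite ler0z subr_ge0.
(* The traces 0, 1, -1, 2, -2 give [v] the orders 4, 6, 3, 1, 2, which all divide 48. Then [u] fixes
   [v] and also inverts it. *)
have v48 : v ^+ 48 = 1.
  have : [|| a == 0, a == 1, a == -1, a == 2 | a == -2] by move: a2; clear; nia.
  case/or4P => [/eqP|/eqP|/eqP|/orP[]/eqP] ea; rewrite ea in eV.
  - by rewrite (exprM _ 2 24) expr2 eV mul0r sub0r -signr_odd.
  - have v3 : v ^+ 3 = -1 by rewrite exprS expr2 eV mulrBr mulr1 mulrCA eV; ring.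
    by rewrite (exprM _ 3 16) v3 -signr_odd.
  - have v3 : v ^+ 3 = 1 by rewrite exprS expr2 eV mulrBr mulr1 mulrCA eV; ring.
    by rewrite (exprM _ 3 16) v3 expr1n.
  - have : (v - 1) ^+ 2 = 0 by transitivity (v * v - 2 * v + 1); [ring | rewrite eV; ring].
    by move/eqP; rewrite expf_eq0 subr_eq0 => /eqP ->; rewrite expr1n.
  - have : (v + 1) ^+ 2 = 0 by transitivity (v * v + 2 * v + 1); [ring | rewrite eV; ring].
    by move/eqP; rewrite expf_eq0 addr_eq0 => /eqP ->; rewrite -signr_odd.
have v2 : v ^+ 2 = 1 by rewrite expr2 -{2}[v]u48 // uv mulfV.
have ex2 : x ^+ 2 = n * v by rewrite /n /v mulrACA eux mulr1.
by rewrite (exprM _ 2 4) ex2 exprMn n4 (exprM _ 2 2) v2 expr1n mulr1.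
Qed.
End Kronecker.

Lemma int_parity (x : int) : exists c, x = 2 * c \/ x = 2 * c + 1.
Proof.
exists (x %/ 2)%Z; have := divz_eq x 2.
have := ltz_pmod x (isT : 0 < 2 :> int); have := modz_ge0 x (isT : 2 != 0 :> int).
by move: (x %/ 2)%Z (x %% 2)%Z => a b; clear; lia.
Qed.

Lemma sqr_mod4 (x : int) : exists c, x ^+ 2 = 4 * c \/ x ^+ 2 = 4 * c + 1.
Proof.
have [c [ec|ec]] := int_parity x.
  by exists (c ^+ 2); left; rewrite ec; ring.
by exists (c ^+ 2 + c); right; rewrite ec; ring.
Qed.

Lemma quad_quad_stable (K : algC -> Prop) (u : {rmorphism algC -> algC}) a b y :
  is_subfield K -> (forall x, Qi x -> K x) -> u 'i = 'i -> quad (quad Qi a) b y ->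
  K a -> K b -> u a = a -> u b = - b -> K (u y) /\ u (u y) = y.
Proof.
move=> sK QK ui; have uQ z := @Qi_fix u z ui.
case=> _ [_ [[c [d [hc hd ->]]] [e [f [he hf ->]]] ->]] Ka Kb ua ub.
rewrite !(rmorphD, rmorphM) /= !ua !ub !rmorphN /= !ub !uQ // opprK; split=> //.
have Kcd := sfD sK (QK _ hc) (sfM sK (QK _ hd) Ka).
have Kef := sfD sK (QK _ he) (sfM sK (QK _ hf) Ka).
exact: (sfD sK Kcd (sfM sK Kef (sfN sK Kb))).
Qed.

(** * The fields [k] and [K = k(sqrt p)] and their automorphisms *)

Section Fields.
Variables p q : nat.
Hypotheses (pp : prime p) (pq : prime q) (npq : p != q) (p4 : (p %% 4 = 1)%N) (q4 : (q %% 4 = 1)%N).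
Local Notation sd := (sqrtC (2 * p * q)%N%:R : algC).
Local Notation rp := (sqrtC p%:R : algC).
Local Notation rs := (sqrtC 2 * sqrtC q%:R : algC).
Local Notation kf := (genfield [:: sd; 'i]).
Local Notation Kf := (genfield [:: sd; 'i; rp]).
Local Notation sQ := Qi_subfield.

Lemma sdE : sd = rs * rp.
Proof.
rewrite mulnAC !natrM !rootCMl ?mulr_ge0 ?ler0n //.
Qed.

Lemma rp_neq0 : rp != 0.
Proof. by rewrite sqrtC_eq0 pnatr_eq0 -lt0n prime_gt0. Qed.

Lemma rs_neq0 : rs != 0.
Proof. by rewrite mulf_neq0 // sqrtC_eq0 pnatr_eq0 // -lt0n prime_gt0. Qed.

Lemma sqrt_nat_real (n : nat) : (sqrtC n%:R : algC)^* = sqrtC n%:R.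
Proof. by apply: conj_Creal; apply: sqrtC_real; exact: ler0n. Qed.

Lemma rs_real : rs^* = rs.
Proof. by rewrite rmorphM /= !sqrt_nat_real. Qed.

Lemma Qi_nat (n : nat) : Qi n%:R. Proof. exact: (sf_nat sQ). Qed.

Lemma Qi_sd2 : Qi (sd ^+ 2). Proof. by rewrite sqrtCK; exact: Qi_nat. Qed.
Lemma Qi_rp2 : Qi (rp ^+ 2). Proof. by rewrite sqrtCK; exact: Qi_nat. Qed.
Lemma Qi_rs2 : Qi (rs ^+ 2).
Proof. by rewrite exprMn !sqrtCK -natrM; exact: Qi_nat. Qed.

Lemma kfE x : kf x <-> quad Qi sd x.
Proof.
split.
  apply: genfield_sub; first exact: (quad_subfield sQ Qi_sd2).
  move=> y; rewrite !inE => /orP[] /eqP ->; first exact: (quad_gen _ sQ).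
  exact: (quad_sub _ sQ Qi_i).
have sk := genfield_subfield [:: sd; 'i].
apply: (quad_min sk); last by apply: mem_genfield; rewrite mem_head.
move=> y; apply: (quad_min sk); first by move=> z; exact: (sf_rat sk).
by apply: mem_genfield; rewrite !inE eqxx orbT.
Qed.

Lemma kf_Kf x : kf x -> Kf x.
Proof.
apply: genfield_sub; first exact: genfield_subfield.
by move=> y hy; apply: mem_genfield; move: hy; rewrite !inE orbA => ->.
Qed.

Lemma Qi_Kf x : Qi x -> Kf x.
Proof. by move=> hx; apply: kf_Kf; apply/kfE; exact: (quad_sub _ sQ hx). Qed.

Lemma rp_Kf : Kf rp. Proof. by apply: mem_genfield; rewrite !inE eqxx !orbT. Qed.
Lemma sd_Kf : Kf sd. Proof. by apply: mem_genfield; rewrite mem_head. Qed.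
Lemma rs_Kf : Kf rs.
Proof.
have -> : rs = sd / rp by rewrite sdE mulfK // rp_neq0.
by apply: (sf_div (genfield_subfield _)); [exact: sd_Kf | exact: rp_Kf].
Qed.

(** [K] is presented as a tower over each of the three intermediate quadratic extensions of [Q(i)];
    each nontrivial automorphism has the lower floor of one tower as its fixed field. *)
Lemma Kf_quad (a b : algC) : Qi (a ^+ 2) -> Qi (b ^+ 2) ->
  quad (quad Qi a) b sd -> quad (quad Qi a) b rp -> forall x, Kf x -> quad (quad Qi a) b x.
Proof.
move=> a2 b2 hsd hrp x; have sa := quad_subfield sQ a2.
have b2' : quad Qi a (b ^+ 2) by exact: (quad_sub _ sQ b2).
apply: genfield_sub; first exact: (quad_subfield sa).
move=> y; rewrite !inE => /or3P[] /eqP -> //.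
exact: (quad_sub _ sa (quad_sub _ sQ Qi_i)).
Qed.

Lemma Kf_ps x : Kf x -> quad (quad Qi rp) rs x.
Proof.
have sa := quad_subfield sQ Qi_rp2.
apply: (Kf_quad Qi_rp2 Qi_rs2); last exact: (quad_sub _ sa (quad_gen _ sQ)).
exists 0, rp; split; [exact: (sf0 sa) | exact: (quad_gen _ sQ) | by rewrite sdE add0r mulrC].
Qed.

Lemma Kf_sp x : Kf x -> quad (quad Qi rs) rp x.
Proof.
have sa := quad_subfield sQ Qi_rs2.
apply: (Kf_quad Qi_rs2 Qi_rp2); last exact: (quad_gen _ sa).
exists 0, rs; split; [exact: (sf0 sa) | exact: (quad_gen _ sQ) | by rewrite sdE add0r].
Qed.

Lemma Kf_dp x : Kf x -> quad (quad Qi sd) rp x.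
Proof.
have sa := quad_subfield sQ Qi_sd2.
apply: (Kf_quad Qi_sd2 Qi_rp2); last exact: (quad_gen _ sa).
exact: (quad_sub _ sa (quad_gen _ sQ)).
Qed.

Lemma prime_coprime48 (r t : nat) : prime r -> (r %% 4 = 1)%N -> prime t -> r != t -> coprime r (48 * t).
Proof.
move=> pr r4 pt nrt; rewrite prime_coprime // Euclid_dvdM // (dvdn_prime2 pr pt) (negPf nrt) orbF.
have -> : 48%N = (2 ^ 4 * 3)%N by [].
rewrite Euclid_dvdM // Euclid_dvdX // !dvdn_prime2 // andbT negb_or.
by apply/andP; split; apply/eqP => e; move: r4; rewrite e.
Qed.

(** The roots of unity of order dividing [48 * t] are fixed: the factor 8 of 48 takes care of ['i]
    and [sqrtC 2], [t] of [sqrtC t%:R], and 48 of the roots of unity met in [K]. *)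
Lemma flip_auts (r t : nat) : prime r -> (r %% 4 = 1)%N -> prime t -> (t %% 4 = 1)%N -> r != t ->
  exists u : {rmorphism algC -> algC}, [/\ u (sqrtC r%:R) = - sqrtC r%:R, u (sqrtC t%:R) = sqrtC t%:R,
    u (sqrtC 2) = sqrtC 2, u 'i = 'i & forall z, z ^+ 48 = 1 -> u z = z].
Proof.
move=> pr r4 pt t4 nrt.
have m0 : (0 < 48 * t)%N by rewrite muln_gt0 (prime_gt0 pt).
have [u [hu hfix]] := flip_aut pr r4 m0 (prime_coprime48 pr r4 pt nrt).
have u48 z : z ^+ 48 = 1 -> u z = z by move=> hz; apply: hfix; rewrite exprM hz expr1n.
have [ui u2] : u 'i = 'i /\ u (sqrtC 2) = sqrtC 2.
  by apply: aut_i8 => z hz; apply: u48; rewrite (exprM _ 8 6) hz expr1n.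
exists u; split=> //; apply: (sqrt_fixed pt t4) => z hz.
by apply: hfix; rewrite mulnC exprM hz expr1n.
Qed.

Variables u1 u2 : {rmorphism algC -> algC}.
Hypotheses (u1p : u1 rp = - rp) (u1s : u1 rs = rs) (u1i : u1 'i = 'i).
Hypotheses (u2p : u2 rp = rp) (u2s : u2 rs = - rs) (u2i : u2 'i = 'i).
Hypotheses (u1_48 : forall z, z ^+ 48 = 1 -> u1 z = z) (u2_48 : forall z, z ^+ 48 = 1 -> u2 z = z).

Lemma u1d : u1 sd = - sd. Proof. by rewrite sdE rmorphM /= u1s u1p mulrN. Qed.
Lemma u2d : u2 sd = - sd. Proof. by rewrite sdE rmorphM /= u2s u2p mulNr. Qed.

(** Both square roots [rs] and [rp] change sign, so their product [sd] is fixed: this is the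
    nontrivial automorphism of [K] over [k]. *)
Definition sig : {rmorphism algC -> algC} := u1 \o u2.

Lemma sig_kf x : kf x -> sig x = x.
Proof.
apply: (genfield_sub (eq_subfield sig idfun)) => y; rewrite !inE => /orP[] /eqP -> /=.
  by rewrite u2d rmorphN /= u1d opprK.
by rewrite u2i u1i.
Qed.

Lemma u_Kf (u : {rmorphism algC -> algC}) x : (u = u1 \/ u = u2) -> Kf x -> Kf (u x) /\ u (u x) = x.
Proof.
move=> hu hx; have sK := genfield_subfield [:: sd; 'i; rp].
case: hu => ->.
  exact: (quad_quad_stable sK Qi_Kf u1i (Kf_sp hx) rs_Kf rp_Kf u1s u1p).
exact: (quad_quad_stable sK Qi_Kf u2i (Kf_ps hx) rp_Kf rs_Kf u2p u2s).
Qed.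
End Fields.

Lemma preim_subfield (K : algC -> Prop) (f : {rmorphism algC -> algC}) :
  is_subfield K -> is_subfield (fun x => K (f x)).
Proof.
move=> sK; split=> [|| x y hx hy | x hx | ]; last split=> [x y hx hy | x hx].
- by rewrite rmorph0; exact: (sf0 sK).
- by rewrite rmorph1; exact: (sf1 sK).
- by rewrite rmorphD; exact: (sfD sK).
- by rewrite rmorphN; exact: (sfN sK).
- by rewrite rmorphM; exact: (sfM sK).
- by rewrite fmorphV; exact: (sfV sK).
Qed.

(** * The prime above 2 does not capitulate *)

Section NoRamification.
Variables (p : nat) (rp : algC) (u : {rmorphism algC -> algC}).
Hypotheses (pp : prime p) (p4 : (p %% 4 = 1)%N) (rp2 : rp ^+ 2 = p%:R) (rp_real : rp^* = rp).
Hypotheses (rp0 : rp != 0) (ui : u 'i = 'i) (up : u rp = - rp).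
Local Notation sQ := Qi_subfield.

(** [p] divides [m = p l], so [n = b^2 - p l^2]; modulo 4 this is a difference of two squares, never
    2. *)
Lemma norm_form_mod4 (m b n : int) : m ^+ 2 = p%:Z * (b ^+ 2 - n) -> n = 2 \/ n = -2 -> False.
Proof.
move=> e hn; have : (p %| m)%Z.
  have : (p %| m ^+ 2)%Z by apply/dvdzP; exists (b ^+ 2 - n); rewrite e mulrC.
  by rewrite !dvdzE abszX Euclid_dvdX // => /andP[].
case/dvdzP=> l el; have p0 : p%:Z != 0 by rewrite eqz_nat -lt0n prime_gt0.
have e' : p%:Z * l ^+ 2 = b ^+ 2 - n by apply: (mulfI p0); rewrite -e el; ring.
have [c hc] := sqr_mod4 l; have [d hd] := sqr_mod4 b.
have [j ej] : exists j : int, p%:Z = 4 * j + 1.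
  by exists (p %/ 4)%N%:Z; rewrite {1}(divn_eq p 4) p4 PoszD PoszM mulrC.
have {hc} [c' hc] : exists c', p%:Z * l ^+ 2 = 4 * c' \/ p%:Z * l ^+ 2 = 4 * c' + 1.
  case: hc => hc; first by exists (p%:Z * c); left; rewrite hc; ring.
  by exists (p%:Z * c + j); right; rewrite hc mulrDr mulr1 {2}ej; ring.
rewrite e' in hc; move: hc hd hn; move: (b ^+ 2) => B; clear; lia.
Qed.

(* Such a [y] would make 2 ramify in [Q(sqrt p)]. *)
Lemma no_ramified y h : quad Qi rp y -> y^* = y -> y ^+ 4 = 4 * h ->
  h \in Aint -> h^-1 \in Aint -> h != 0 -> False.
Proof.
move=> hy cy e ah ahV h0; have uQ z := @Qi_fix u z ui.
have Q2 : Qi (rp ^+ 2) by rewrite rp2; exact: (sf_nat sQ).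
have sK := quad_subfield sQ Q2; have fixQ := quad_fixed uQ up rp0.
have [_ comm] := quad_conj rp_real ui up hy.
have huy := quad_stable sQ uQ up hy.
have uu : u (u y) = y.
  case: hy => a [b [ha hb ->]].
  by rewrite !(rmorphD, rmorphM) /= up rmorphN /= up !uQ // opprK.
have cuy : (u y)^* = u y by rewrite -comm cy.
have ay : y \in Aint.
  by apply: (@Aint_rootn 4) => //; rewrite e; apply: rpredM => //; exact: rpred_nat.
have auy : u y \in Aint by rewrite Aint_aut.
(* As [y] is real, its trace and norm over [Q(i)] are real Gaussian integers, hence integers. *)
have [a ea] : exists a : int, y + u y = a%:~R.
  apply: Zi_real_int; last by rewrite rmorphD /= cy cuy.
  split; last exact: rpredD.
  by apply: fixQ; [exact: (sfD sK) | rewrite rmorphD /= uu addrC].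
have [n en] : exists n : int, y * u y = n%:~R.
  apply: Zi_real_int; last by rewrite rmorphM /= cy cuy.
  split; last exact: rpredM.
  by apply: fixQ; [exact: (sfM sK) | rewrite rmorphM /= uu mulrC].
(* Taking norms in [y ^+ 4 = 4 * h] gives [n ^+ 4 = 16 * m] with [m] an integral unit, and
   positivity leaves [m = 1]. *)
have n2 : n = 2 \/ n = -2.
  have uh : u (y ^+ 4) = 4 * u h by rewrite e rmorphM rmorph_nat.
  have e4 : (n ^+ 4)%:~R = 16 * (h * u h) :> algC.
    rewrite rmorphXn /= -en exprMn -rmorphXn /= uh e; ring.
  have uh0 : u h != 0 by rewrite fmorph_eq0.
  have intz z : z \in Crat -> z \in Aint -> exists m : int, z = m%:~R.
    by move=> h1 h2; apply/intrP; exact: Cint_rat_Aint.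
  have Rn : h * u h \in Crat.
    have -> : h * u h = (n ^+ 4)%:~R / 16 by rewrite e4 [RHS]mulrC mulKf // pnatr_eq0.
    by apply: rpred_div; [exact: rpred_int | exact: rpred_nat].
  have [m em] : exists m : int, h * u h = m%:~R.
    by apply: intz Rn _; apply: rpredM; rewrite ?Aint_aut.
  have [m' em'] : exists m' : int, (h * u h)^-1 = m'%:~R.
    apply: intz; first by rewrite rpredV.
    by rewrite invfM -fmorphV; apply: rpredM; rewrite ?Aint_aut.
  have mm : m * m' = 1.
    by apply: (@intr_inj algC); rewrite rmorphM /= -em -em' mulfV // mulf_neq0.
  have n4 : n ^+ 4 = 16 * m by apply: (@intr_inj algC); rewrite e4 em rmorphM.
  have m1 : m = 1.
    have m0 : 0 <= m by rewrite -(pmulr_rge0 m (isT : 0 < 16 :> int)) -n4 (exprM _ 2 2) sqr_ge0.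
    have : (m %| 1)%Z by apply/dvdzP; exists m'; rewrite mulrC.
    by rewrite dvdzE dvdn1 => /eqP; move: m0; clear; lia.
  have : (n ^+ 2 - 4) * (n ^+ 2 + 4) = 0.
    by transitivity (n ^+ 4 - 16); [ring | rewrite n4 m1].
  move/eqP; rewrite mulf_eq0 => /orP[/eqP h1|/eqP h1]; last first.
    by have := sqr_ge0 n; move: h1; clear; lia.
  have : (n - 2) * (n + 2) = 0 by rewrite -h1; ring.
  by move/eqP; rewrite mulf_eq0 subr_eq0 addr_eq0 => /orP[] /eqP; [left | right].
(* [y ^+ 2 / 2] is integral because its square is [h]; its trace is [(a ^+ 2 - 2 * n) / 2], so [a]
   is even. *)
have [b eb] : exists b, a = 2 * b.
  have ean : (a ^+ 2 - 2 * n)%:~R = (y + u y) ^+ 2 - 2 * (y * u y).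
    by rewrite rmorphB rmorphXn [X in _ - X]rmorphM /= ea en.
  have uy2 : u (y ^+ 2 / 2) = u y ^+ 2 / 2 by rewrite rmorphM fmorphV rmorphXn rmorph_nat.
  have hy2 : y ^+ 2 / 2 \in Aint.
    apply: (@Aint_rootn 2) => //; rewrite expr_div_n -exprM e.
    have -> : 4 * h / 2 ^+ 2 = h by field.
    by [].
  have [t et] : exists t : int, y ^+ 2 / 2 + u (y ^+ 2 / 2) = t%:~R.
    have eq1 : y ^+ 2 / 2 + u (y ^+ 2 / 2) = (a ^+ 2 - 2 * n)%:~R / 2 by rewrite ean uy2; ring.
    apply/intrP; apply: Cint_rat_Aint; last by apply: rpredD; rewrite ?Aint_aut.
    by rewrite eq1; apply: rpred_div; [exact: rpred_int | exact: rpred_nat].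
  have e2 : a ^+ 2 - 2 * n = 2 * t.
    by apply: (@intr_inj algC); rewrite ean rmorphM /= -et uy2; field.
  have : (2 %| a ^+ 2)%Z by apply/dvdzP; exists (t + n); move: e2; move: (a ^+ 2) => A; clear; lia.
  rewrite !dvdzE abszX Euclid_dvdX // => /andP[h1 _].
  have /dvdzP[b ->] : (2 %| a)%Z by rewrite dvdzE.
  by exists b; rewrite mulrC.
have [m em] : exists m : int, (y - u y) * rp / 2 = m%:~R.
  have sq : ((y - u y) * rp / 2) ^+ 2 = (p%:Z * (b ^+ 2 - n))%:~R.
    rewrite expr_div_n exprMn rp2 rmorphM rmorphB rmorphXn /=.
    have ea' : y + u y = 2 * b%:~R by rewrite ea eb rmorphM.
    have -> : (y - u y) ^+ 2 = (y + u y) ^+ 2 - 4 * (y * u y) by ring.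
    by rewrite ea' en -[p%:~R]/(p%:R); field.
  apply: Zi_real_int; last first.
    by rewrite !rmorphM fmorphV rmorphB /= cy cuy rp_real rmorph_nat.
  split; last by apply: (@Aint_rootn 2) => //; rewrite sq; exact: Aint_int.
  apply: fixQ.
    apply: (sf_div sK); last exact: (sf_nat sK 2).
    by apply: (sfM sK); [exact: (sfB sK) | exact: (quad_gen _ sQ)].
  by rewrite !rmorphM fmorphV rmorphB /= uu up rmorph_nat; ring.
apply: (@norm_form_mod4 m b n) n2; apply: (@intr_inj algC).
rewrite rmorphXn /= -em expr_div_n exprMn rp2 rmorphM rmorphB rmorphXn /=.
have ea' : y + u y = 2 * b%:~R by rewrite ea eb rmorphM.
have -> : (y - u y) ^+ 2 = (y + u y) ^+ 2 - 4 * (y * u y) by ring.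
by rewrite ea' en -[p%:~R]/(p%:R); field.
Qed.
End NoRamification.

Section NoCapitulation.
Variables (p : nat) (rp rs sd : algC) (K : algC -> Prop) (u1 u2 : {rmorphism algC -> algC}).
Hypotheses (pp : prime p) (p4 : (p %% 4 = 1)%N) (rp2 : rp ^+ 2 = p%:R) (rp_real : rp^* = rp).
Hypotheses (rs_real : rs^* = rs) (Qrs2 : Qi (rs ^+ 2)) (rp0 : rp != 0) (rs0 : rs != 0).
Hypothesis sdE : sd = rs * rp.
Hypotheses (sK : is_subfield K) (QK : forall x, Qi x -> K x) (Kp : K rp) (Ks : K rs).
Hypotheses (Kps : forall x, K x -> quad (quad Qi rp) rs x) (Ksp : forall x, K x -> quad (quad Qi rs) rp x)
  (Kdp : forall x, K x -> quad (quad Qi sd) rp x).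
Hypotheses (u1p : u1 rp = - rp) (u1s : u1 rs = rs) (u1i : u1 'i = 'i).
Hypotheses (u2p : u2 rp = rp) (u2s : u2 rs = - rs) (u2i : u2 'i = 'i).
Hypotheses (u1_48 : forall z, z ^+ 48 = 1 -> u1 z = z) (u2_48 : forall z, z ^+ 48 = 1 -> u2 z = z).
Local Notation sQ := Qi_subfield.

Lemma K_conj x : K x -> K x^*.
Proof.
have sP := preim_subfield Num.conj sK.
move/Ksp; apply: (quad_min sP); last by rewrite /= rp_real.
move=> y; apply: (quad_min sP); last by rewrite /= rs_real.
by move=> z hz; apply: QK; exact: Qi_conj.
Qed.

Lemma K_comm (u : {rmorphism algC -> algC}) x : u = u1 \/ u = u2 -> K x -> u x^* = (u x)^*.
Proof.
move=> hu /Ksp; have ui : u 'i = 'i by case: hu => ->.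
pose f : {rmorphism algC -> algC} := u \o Num.conj.
pose g : {rmorphism algC -> algC} := Num.conj \o u.
have sE := eq_subfield f g; apply: (quad_min sE); last first.
  by rewrite /= rp_real; case: hu => ->; rewrite ?u1p ?u2p ?rmorphN /= ?rp_real.
move=> y; apply: (quad_min sE); last first.
  by rewrite /= rs_real; case: hu => ->; rewrite ?u1s ?u2s ?rmorphN /= ?rs_real.
by move=> z hz /=; rewrite !(Qi_fix ui) //; exact: Qi_conj.
Qed.

Lemma K_stable (u : {rmorphism algC -> algC}) x : u = u1 \/ u = u2 -> K x -> K (u x) /\ u (u x) = x.
Proof.
case=> -> hx; first exact: (quad_quad_stable sK QK u1i (Ksp hx) Ks Kp u1s u1p).
exact: (quad_quad_stable sK QK u2i (Kps hx) Kp Ks u2p u2s).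
Qed.

(* The product of the norms of [w] to the three intermediate quadratic extensions of [Q(i)]
   is [w^2] times the norm of [w] to [Q(i)]. *)
Lemma norm1_root16 w : K w -> w \in Aint -> w * w^* = 1 -> w ^+ 16 = 1.
Proof.
move=> Kw Aw ew.
have h1 : u1 = u1 \/ u1 = u2 by left. have h2 : u2 = u1 \/ u2 = u2 by right.
have [K1 i1] := K_stable h1 Kw; have [K2 i2] := K_stable h2 Kw.
have [K12 _] := K_stable h1 K2.
have [K21 _] := K_stable h2 K1.
have c1 := K_comm h1 Kw; have c2 := K_comm h2 Kw; have c12 := K_comm h1 K2.
have e1 : u1 w * (u1 w)^* = 1 by rewrite -c1 -rmorphM ew rmorph1.
have e2 : u2 w * (u2 w)^* = 1 by rewrite -c2 -rmorphM ew rmorph1.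
have e12 : u1 (u2 w) * (u1 (u2 w))^* = 1 by rewrite -c12 -rmorphM e2 rmorph1.
have Qp2 : Qi (rp ^+ 2) by rewrite rp2; exact: (sf_nat sQ).
have Qd2 : Qi (sd ^+ 2) by rewrite sdE exprMn; exact: (sfM sQ).
have sdr : sd^* = sd by rewrite sdE rmorphM /= rs_real rp_real.
have sd0 : sd != 0 by rewrite sdE mulf_neq0.
have u1d : u1 sd = - sd by rewrite sdE rmorphM /= u1s u1p mulrN.
have u2d : u2 sd = - sd by rewrite sdE rmorphM /= u2s u2p mulNr.
have A1 : u1 w \in Aint by rewrite Aint_aut.
have A2 : u2 w \in Aint by rewrite Aint_aut.
have A12 : u1 (u2 w) \in Aint by rewrite Aint_aut.
have comm12 z : K z -> u1 (u2 z) = u2 (u1 z).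
  move/Ksp; pose f : {rmorphism algC -> algC} := u1 \o u2; pose g : {rmorphism algC -> algC} := u2 \o u1.
  have sE := eq_subfield f g; apply: (quad_min sE); last by rewrite /= u2p u1p rmorphN /= u2p.
  move=> y; apply: (quad_min sE); last by rewrite /= u2s u1s rmorphN /= u1s u2s.
  by move=> t ht /=; rewrite !(Qi_fix u1i) // !(Qi_fix u2i) // !(Qi_fix u1i).
have X8 : (w * u2 w) ^+ 8 = 1.
  apply: (norm1_root8 (u := u1) Qp2 rp0 rp_real u1i u1p u1_48); [|exact: rpredM|]; last first.
    by rewrite rmorphM /= mulrACA ew e2 mulr1.
  apply: (quad_fixed (F := quad Qi rp) (s := rs) (u := u2)) => //.
  - move=> z [a [b [ha hb ->]]].
    by rewrite rmorphD rmorphM /= u2p !(Qi_fix u2i).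
  - by apply: Kps; exact: (sfM sK).
  - by rewrite rmorphM /= i2 mulrC.
have Y8 : (w * u1 w) ^+ 8 = 1.
  apply: (norm1_root8 (u := u2) Qrs2 rs0 rs_real u2i u2s u2_48); [|exact: rpredM|]; last first.
    by rewrite rmorphM /= mulrACA ew e1 mulr1.
  apply: (quad_fixed (F := quad Qi rs) (s := rp) (u := u1)) => //.
  - move=> z [a [b [ha hb ->]]].
    by rewrite rmorphD rmorphM /= u1s !(Qi_fix u1i).
  - by apply: Ksp; exact: (sfM sK).
  - by rewrite rmorphM /= i1 mulrC.
have Z8 : (w * u1 (u2 w)) ^+ 8 = 1.
  apply: (norm1_root8 (u := u1) Qd2 sd0 sdr u1i u1d u1_48); [|exact: rpredM|]; last first.
    by rewrite rmorphM /= mulrACA ew e12 mulr1.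
  pose f : {rmorphism algC -> algC} := u1 \o u2.
  apply: (quad_fixed (F := quad Qi sd) (s := rp) (u := f)) => //.
  - move=> z [a [b [ha hb ->]]] /=.
    by rewrite !(rmorphD, rmorphM) /= u2d rmorphN /= u1d opprK !(Qi_fix u2i) // !(Qi_fix u1i).
  - by rewrite /= u2p u1p.
  - by apply: Kdp; exact: (sfM sK).
  - rewrite /= !rmorphM /= mulrC; congr (_ * _).
    by rewrite -(comm12 _ K2) i2 i1.
have Z8' : (u1 w * u2 w) ^+ 8 = 1.
  have := congr1 u1 Z8; rewrite rmorphXn rmorphM rmorph1 /=.
  by have [_ ->] := K_stable h1 K2.
have : (w ^+ 2 * (u1 w * u2 w)) ^+ 8 = 1.
  have -> : w ^+ 2 * (u1 w * u2 w) = (w * u2 w) * (w * u1 w) by ring.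
  by rewrite exprMn X8 Y8 mulr1.
by rewrite exprMn Z8' mulr1 -exprM.
Qed.

(** [w] is a 48th root of unity, hence fixed by [u1] and [u2], whose common fixed field in [K] is
    [Q(i)]. *)
Lemma norm1_unit4 w : K w -> w \in Aint -> w * w^* = 1 -> is_unit4 w.
Proof.
move=> Kw Aw ew; have w48 : w ^+ 48 = 1 by rewrite (exprM _ 16 3) norm1_root16 // expr1n.
have Qp2 : Qi (rp ^+ 2) by rewrite rp2; exact: (sf_nat sQ).
apply: Zi_norm1 => //; split=> //.
apply: (quad_fixed (F := Qi) (s := rp) (u := u1)) => //; [by move=> z; exact: (Qi_fix u1i) | | exact: u1_48].
apply: (quad_fixed (F := quad Qi rp) (s := rs) (u := u2)) => //; [ | exact: Kps | exact: u2_48].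
move=> z [a [b [ha hb ->]]].
by rewrite rmorphD rmorphM /= u2p !(Qi_fix u2i).
Qed.

(* [a / a^*] is an algebraic integer all of whose conjugates have absolute value 1, hence a power of [i];
   so [a] or [2 / ((1 - i) a)] is real or purely imaginary, and its norm to [Q(sqrt p)] contradicts
   [no_ramified]. *)
Lemma no_sqrt_pi0 a v : K a -> a ^+ 2 = (1 + 'i) * v -> v \in Aint -> v^-1 \in Aint -> v != 0 -> False.
Proof.
move=> Ka ea Av AvV v0.
have i2 : 'i * 'i = -1 :> algC := mulCii _.
have iV : ('i : algC)^-1 = - 'i := invCi _.
have i1 := gi11_neq0.
have i1' : 1 - 'i != 0 :> algC by rewrite -conjCi -[1](rmorph1 Num.conj) -rmorphD fmorph_eq0.
have a0 : a != 0.
  by apply/eqP => h; move/eqP: ea; rewrite h expr0n eq_sym mulf_eq0 (negPf i1) (negPf v0).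
have ca0 : a^* != 0 by rewrite fmorph_eq0.
have cv0 : v^* != 0 by rewrite fmorph_eq0.
have cca : (a^*) ^+ 2 = (1 - 'i) * v^*.
  by rewrite -rmorphXn /= ea rmorphM rmorphD /= conjCi rmorph1.
(* The prime above 2 is its own conjugate, as [1 + 'i = 'i * (1 - 'i)]; hence the square of this
   quotient is integral. *)
have hw : is_unit4 (a / a^*).
  apply: norm1_unit4.
  - by apply: (sf_div sK) => //; exact: K_conj.
  - apply: (@Aint_rootn 2) => //; rewrite expr_div_n ea cca.
    have -> : (1 + 'i) * v / ((1 - 'i) * v^*) = 'i * v * (v^-1)^*.
      have e : 1 + 'i = 'i * (1 - 'i) :> algC.
        by transitivity ('i - 'i * 'i : algC); [rewrite i2; ring | ring].
      by rewrite fmorphV /= e; field; rewrite cv0 i1'.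
    by rewrite !rpredM ?Aint_i // Aint_conj.
  - by rewrite rmorphM fmorphV /= conjCK; field; rewrite a0 ca0.
have ea' : a = a / a^* * a^* by rewrite divfK.
have h1 : u1 = u1 \/ u1 = u2 by left. have h2 : u2 = u1 \/ u2 = u2 by right.
(* The norm [y * u2 y] to [Q(i, sqrt p)] is real in both cases, a possible sign occurring twice, and
   its fourth power is 4 times a unit. *)
have final y c : K y -> y^* = y \/ y^* = - y -> y ^+ 4 = 2 * c -> c \in Aint -> c^-1 \in Aint -> c != 0 -> False.
  move=> Ky cy ey Ac AcV c0; have [K2y i2y] := K_stable h2 Ky.
  have Qp2 : Qi (rp ^+ 2) by rewrite rp2; exact: (sf_nat sQ).
  apply: (@no_ramified p rp u1 pp p4 rp2 rp_real rp0 u1i u1p (y * u2 y) (c * u2 c)).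
  - apply: (quad_fixed (F := quad Qi rp) (s := rs) (u := u2)) => //.
    + move=> z [a' [b' [ha' hb' ->]]].
      by rewrite rmorphD rmorphM /= u2p !(Qi_fix u2i).
    + by apply: Kps; exact: (sfM sK).
    + by rewrite rmorphM /= i2y mulrC.
  - rewrite rmorphM /= -(K_comm h2 Ky).
    by case: cy => ->; rewrite // rmorphN mulrNN.
  - by rewrite exprMn -rmorphXn /= ey rmorphM rmorph_nat /=; ring.
  - by rewrite rpredM ?Aint_aut.
  - by rewrite invfM -fmorphV rpredM ?Aint_aut.
  - by rewrite mulf_neq0 // fmorph_eq0.
have a4 : a ^+ 4 = 2 * ('i * v ^+ 2).
  rewrite (exprM _ 2 2) ea; transitivity ((1 + 2 * 'i + 'i * 'i) * v ^+ 2); first by ring.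
  by rewrite i2; ring.
have Ac : 'i * v ^+ 2 \in Aint by rewrite rpredM ?Aint_i ?rpredX.
have AcV : ('i * v ^+ 2)^-1 \in Aint by rewrite invfM iV -exprVn rpredM ?rpredN ?Aint_i ?rpredX.
have c0 : 'i * v ^+ 2 != 0 by rewrite mulf_neq0 ?neq0Ci ?expf_neq0.
have two : (2 : algC) != 0 by rewrite pnatr_eq0.
(* The fourth power of [(1 - 'i) * a] is -8 times a unit; dividing 2 by this element brings it back
   to 2 times a unit, as [final] requires. *)
have second : ((1 - 'i) * a)^* = (1 - 'i) * a \/ ((1 - 'i) * a)^* = - ((1 - 'i) * a) -> False.
  move=> hc.
  apply: (final (2 / ((1 - 'i) * a)) (- ('i * v ^+ 2)^-1)).
  - apply: (sf_div sK); first exact: (sf_nat sK 2).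
    apply: (sfM sK) => //; apply: (sfB sK); [exact: (sf1 sK) | exact: (QK Qi_i)].
  - have conjV z : (2 / z : algC)^* = 2 / z^* by rewrite rmorphM fmorphV rmorph_nat.
    rewrite conjV; by case: hc => ->; [left | right; rewrite invrN mulrN].
  - rewrite expr_div_n exprMn a4.
    have -> : (1 - 'i) ^+ 4 = - 4 :> algC.
      transitivity ((1 - 2 * 'i + 'i * 'i) ^+ 2 : algC); first by ring.
      by rewrite i2; transitivity (4 * ('i * 'i) : algC); [ring | rewrite i2; ring].
    by field; rewrite v0 neq0Ci.
  - by rewrite rpredN.
  - by rewrite invrN invrK rpredN.
  - by rewrite oppr_eq0 invr_eq0.
case: hw => ew; rewrite ew in ea'.
- by apply: (final a ('i * v ^+ 2)) => //; left; rewrite {2}ea' mul1r.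
- by apply: (final a ('i * v ^+ 2)) => //; right; rewrite {2}ea' mulN1r opprK.
- apply: second; left; rewrite rmorphM rmorphB /= conjCi rmorph1 {2}ea'.
  by transitivity (('i - 'i * 'i) * a^*); [rewrite i2; ring | ring].
- apply: second; right; rewrite rmorphM rmorphB /= conjCi rmorph1 {2}ea'.
  by transitivity (('i - 'i * 'i) * a^*); [rewrite i2; ring | ring].
Qed.
End NoCapitulation.

(** * Capitulation of the ramified primes in [k(sqrt p)] *)

Section Concrete.
Variables (p q : nat) (A B : int).
Hypotheses (pp : prime p) (pq : prime q) (npq : p != q) (p4 : (p %% 4 = 1)%N) (q4 : (q %% 4 = 1)%N).
Hypothesis eAB : p%:Z = A ^+ 2 + B ^+ 2.
Local Notation sd := (sqrtC (2 * p * q)%N%:R : algC).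
Local Notation kf := (genfield [:: sd; 'i]).
Local Notation Kf := (genfield [:: sd; 'i; sqrtC p%:R]).
Local Notation sQ := Qi_subfield.

Lemma sd_neq0 : sd != 0.
Proof. by rewrite sqrtC_eq0 pnatr_eq0 !muln_eq0 !negb_or -!lt0n !prime_gt0. Qed.

Lemma flip_sd : exists tau : {rmorphism algC -> algC}, tau 'i = 'i /\ tau sd = - sd.
Proof.
have [u [hp hq h2 hi _]] := flip_auts pp p4 pq q4 npq.
by exists u; split=> //; rewrite sdE !rmorphM hp hq h2 mulrN.
Qed.

Lemma Zi_sd2 : Zi (sd ^+ 2). Proof. by rewrite sqrtCK; exact: (ri_nat sQ). Qed.

Lemma kf_cap_norm I : nonzero_ideal kf I -> capitulates Kf I ->
  exists2 g, ringint kf g & ideal_mul kf I I = pideal kf g.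
Proof.
have [u1 [h1p h1q h12 h1i h1f]] := flip_auts pp p4 pq q4 npq.
have nqp : q != p by rewrite eq_sym.
have [u2 [h2q h2p h22 h2i h2f]] := flip_auts pq q4 pp p4 nqp.
have h1s : u1 (sqrtC 2 * sqrtC q%:R) = sqrtC 2 * sqrtC q%:R by rewrite rmorphM h1q h12.
have h2s : u2 (sqrtC 2 * sqrtC q%:R) = - (sqrtC 2 * sqrtC q%:R) by rewrite rmorphM h2q h22 mulrN.
have [tau [ti td]] := flip_sd.
have sk := genfield_subfield [:: sd; 'i]; have sK := genfield_subfield [:: sd; 'i; sqrtC p%:R].
have kE := kfE p q.
have fixk := sig_kf h1p h1s h1i h2p h2s h2i.
apply: (cap_norm sk sK (@kf_Kf p q) fixk).
- move=> x hx fx; apply/kE.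
  apply: (quad_fixed (F := quad Qi sd) (s := sqrtC p%:R) (u := sig u1 u2)) fx.
  + by move=> y /kE; exact: fixk.
  + by rewrite /sig /= h2p h1p.
  + exact: rp_neq0.
  + exact: Kf_dp.
- move=> x hx; have [h _] := u_Kf pp h1p h1s h1i h2p h2s h2i (or_intror erefl) hx.
  by have [] := u_Kf pp h1p h1s h1i h2p h2s h2i (or_introl erefl) h.
- move=> x /Kf_dp [a [b [/kE ha /kE hb ->]]].
  have sp : sig u1 u2 (sqrtC p%:R) = - sqrtC p%:R by rewrite /sig /= h2p h1p.
  by rewrite !(rmorphD, rmorphM) sp rmorphN sp opprK !fixk.
move=> J nJ; have [J' [n [h1 h2 h3 h4 _]]] := invertible sk kE ti td sd_neq0 nJ.
by exists J', n; split=> //; exact: (Zi_O kE).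
Qed.

(** [x - 'i] has odd norm [p y^2], and with its conjugate it generates an ideal containing 2, so the
    two are coprime. One prime above [p] is split off; the rest has square norm and is a unit times
    a square. *)
Lemma neg_pell_factor (x y : int) : x ^+ 2 + 1 = p%:Z * y ^+ 2 ->
  exists B' w z, [/\ B' = B \/ B' = - B, [/\ Zi w, Zi w^-1 & w != 0], Zi z
    & x%:~R - 'i = gi A B' * (w * z ^+ 2)].
Proof.
move=> exy; have ex : x%:~R - 'i = gi x (-1) by rewrite /gi rmorphN mulN1r.
(* An odd [x] would make [x ^+ 2 + 1] congruent to 2 modulo 4, whereas [p * y ^+ 2] is 0 or 1. *)
have odd_n : exists n, x ^+ 2 + 1 = 2 * n + 1.
  have [c hc] := sqr_mod4 x; have [d hd] := sqr_mod4 y.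
  have [j ej] : exists j : int, p%:Z = 4 * j + 1.
    by exists (p %/ 4)%N%:Z; rewrite {1}(divn_eq p 4) p4 PoszD PoszM mulrC.
  have {hd} [d' hd] : exists d', p%:Z * y ^+ 2 = 4 * d' \/ p%:Z * y ^+ 2 = 4 * d' + 1.
    case: hd => hd; first by exists (p%:Z * d); left; rewrite hd; ring.
    by exists (p%:Z * d + j); right; rewrite hd mulrDr mulr1 {2}ej; ring.
  rewrite -exy in hd; exists (2 * c); move: hc hd; move: (x ^+ 2) => X; clear; lia.
have [n en] := odd_n.
have ea : gi x (-1) * (gi x (-1))^* = (x ^+ 2 + 1)%:~R by rewrite gi_norm /gnorm sqrrN expr1n.
have cop : conj_coprime (gi x (-1)).
  apply: (@conj_coprime_odd _ n 'i (- 'i)); [exact: Zi_i | exact: (riN sQ Zi_i) | by rewrite ea en | exact: Zi_gi |].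
  rewrite gi_conj gi_i giN !giM giD; rewrite -[2]/(2%:~R) gi_int; congr gi; ring.
rewrite exy in ea.
have [B' [a [hB ha e1 ea' ca]]] := peel pp eAB (Zi_gi x (-1)) ea cop.
have a0 : a != 0.
  apply/eqP => h; have : gi x (-1) = 0 by rewrite e1 h mulr0.
  by rewrite -[0]/(0%:~R) gi_int => /gi_inj[_]; lia.
have [w [z [hw hwV w0 hz e2]]] := conj_coprime_sqr ha a0 ea' ca.
by exists B', w, z; split=> //; rewrite ex e1 e2.
Qed.

Lemma gi_cap H : is_ideal kf H -> ideal_mul kf H H = pideal kf (gi A B) -> capitulates Kf H.
Proof.
move=> hH eH; have [x [y exy]] := neg_pell_prime pp p4.
have sk := genfield_subfield [:: sd; 'i]; have sK := genfield_subfield [:: sd; 'i; sqrtC p%:R].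
have kE := kfE p q; have kK := @kf_Kf p q.
have [B' [w [z [hB [hw hwV w0] hz e]]]] := neg_pell_factor exy.
have QK := @Qi_Kf p q.
have At : (sqrtC p%:R : algC) \in Aint.
  by apply: (@Aint_rootn 2) => //; rewrite sqrtCK; exact: rpred_nat.
have exy' : x%:~R ^+ 2 + 1 = (sqrtC p%:R) ^+ 2 * y%:~R ^+ 2 :> algC.
  have h : (x ^+ 2 + 1)%:~R = (p%:Z * y ^+ 2)%:~R :> algC by rewrite exy.
  rewrite rmorphD [RHS]rmorphM !rmorphXn rmorph1 /= in h.
  by rewrite sqrtCK.
have [Qz _] := hz.
have [b [u [Kb Au AuV u0 eb]]] := sqrt_from_neg_pell sK (QK _ Qi_i) (@rp_Kf p q) At exy' hw hwV w0 hz (QK _ Qz) e.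
have oA := Zi_O kE (Zi_gi A B).
have gN0 B1 : B1 = B \/ B1 = - B -> gi A B1 != 0.
  by case=> ->; apply: (@gi_prime_neq0 p) => //; rewrite sqrrN.
case: hB => eB; rewrite eB in eb.
  by apply: (cap_sqrt sk sK kK hH oA (gN0 _ (or_introl erefl)) eH Kb Au AuV u0 eb).
(* If the Pell solution involves the conjugate prime, [b] is divided into [sqrtC p%:R]: the two
   primes multiply to [p]. *)
have g1 := gN0 _ (or_introl erefl); have g2 := gN0 _ (or_intror erefl).
apply: (cap_sqrt (b := sqrtC p%:R / b) (u := u^-1) sk sK kK hH oA g1 eH) => //.
- by apply: (sf_div sK) => //; exact: rp_Kf.
- by rewrite invrK.
- by rewrite invr_eq0.
rewrite expr_div_n sqrtCK eb -(gi_mul_conj eAB); field.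
by rewrite g2 u0.
Qed.

(** A generator of the extended ideal would have a square equal to [1 + 'i] times a unit. *)
Lemma gi11_not_cap H : is_ideal kf H -> ideal_mul kf H H = pideal kf (1 + 'i) -> ~ capitulates Kf H.
Proof.
move=> hH eH /capitulatesE[a ha ea].
have [u1 [h1p h1q h12 h1i h1f]] := flip_auts pp p4 pq q4 npq.
have nqp : q != p by rewrite eq_sym.
have [u2 [h2q h2p h22 h2i h2f]] := flip_auts pq q4 pp p4 nqp.
have h1s : u1 (sqrtC 2 * sqrtC q%:R) = sqrtC 2 * sqrtC q%:R by rewrite rmorphM h1q h12.
have h2s : u2 (sqrtC 2 * sqrtC q%:R) = - (sqrtC 2 * sqrtC q%:R) by rewrite rmorphM h2q h22 mulrN.
have sk := genfield_subfield [:: sd; 'i]; have sK := genfield_subfield [:: sd; 'i; sqrtC p%:R].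
have kE := kfE p q; have kK := @kf_Kf p q.
have Z1 : Zi (1 + 'i) by apply: (riD sQ); [exact: (ri1 sQ) | exact: Zi_i].
have o1 := Zi_O kE Z1; have O1 := ri_sub kK o1.
have e : pideal Kf (1 + 'i) = pideal Kf (a * a).
  by rewrite -(pidealM sK ha ha) -ea -(ext_mul sk sK kK hH hH) eH (ext_pideal sk sK kK o1).
have i1 := gi11_neq0.
have [h1 h2 a0] := pideal_eq_unit sK O1 (riM sK ha ha) i1 e.
have [Ka _] := ha; have [_ A1] := h1; have [_ A2] := h2.
apply: (@no_sqrt_pi0 p (sqrtC p%:R) (sqrtC 2 * sqrtC q%:R) sd Kf u1 u2 pp p4 _ _ _ _ _ _ _ sK _ _ _ _ _ _
   h1p h1s h1i h2p h2s h2i h1f h2f a (a * a / (1 + 'i))) => //.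
- exact: sqrtCK.
- exact: sqrt_nat_real.
- exact: rs_real.
- exact: Qi_rs2.
- exact: rp_neq0.
- exact: rs_neq0.
- exact: sdE.
- exact: Qi_Kf.
- exact: rp_Kf.
- exact: rs_Kf.
- exact: Kf_ps.
- exact: Kf_sp.
- exact: Kf_dp.
- by rewrite [RHS]mulrC divfK.
- by rewrite invf_div.
- by rewrite mulf_neq0 // invr_eq0.
Qed.
End Concrete.

Section Relation.
Variables (p q : nat) (A B C D : int).
Hypotheses (pp : prime p) (pq : prime q) (npq : p != q) (p4 : (p %% 4 = 1)%N) (q4 : (q %% 4 = 1)%N).
Hypotheses (eAB : p%:Z = A ^+ 2 + B ^+ 2) (eCD : q%:Z = C ^+ 2 + D ^+ 2).
Hypothesis genus : [\/ leg p q%:R = -1 /\ leg p 2 = -1, leg p q%:R = -1 /\ leg q 2 = -1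
    | leg p 2 = -1 /\ leg q 2 = -1].
Local Notation sd := (sqrtC (2 * p * q)%N%:R : algC).
Local Notation kf := (genfield [:: sd; 'i]).
Local Notation sQ := Qi_subfield.

(** Here [x] is odd, so [1 + 'i] is first taken out of [x - 'i]; the cofactor [a1] has odd norm
    [p q y^2], and one prime above each of [p] and [q] is split off. *)
Lemma sqrt_relation : exists B' D' b u, [/\ B' = B \/ B' = - B, D' = D \/ D' = - D,
  kf b, [/\ u \in Aint, u^-1 \in Aint & u != 0] & b ^+ 2 = (1 + 'i) * (gi A B' * gi C D') * u].
Proof.
have [x [y exy]] := neg_pell_two_primes pp pq npq p4 q4 genus.
have sk := genfield_subfield [:: sd; 'i]; have kE := kfE p q.
have [c ec] : exists c, x = 2 * c + 1.
  have [c [ec|ec]] := int_parity x.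
  - have h : 2 * (p%:Z * q%:Z * y ^+ 2 - 2 * c ^+ 2) = 1.
      transitivity ((2 * p * q)%N%:Z * y ^+ 2 - x ^+ 2); first by rewrite ec !PoszM; ring.
      by rewrite -exy; ring.
    by move: h; move: (_ - _) => z; clear; lia.
  - by exists c.
pose a1 := gi c (- (c + 1)).
have ea1 : x%:~R - 'i = gi 1 1 * a1.
  rewrite gi_int gi_i giN giD giM ec; congr gi; ring.
have na1 : a1 * a1^* = (p%:Z * (q%:Z * y ^+ 2))%:~R.
  rewrite gi_norm; congr (_%:~R); apply: (mulfI (isT : 2 != 0 :> int)).
  transitivity (x ^+ 2 + 1); first by rewrite ec /gnorm; ring.
  by rewrite exy !PoszM; ring.
have oa1 : a1 * a1^* = (2 * (c ^+ 2 + c) + 1)%:~R.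
  by rewrite gi_norm; congr (_%:~R); rewrite /gnorm; ring.
have cop : conj_coprime a1.
  apply: (conj_coprime_odd (Zi_gi (-1) 1) (Zi_gi (-1) (-1)) oa1 (Zi_gi _ _)).
  rewrite gi_conj !giM giD -[2]/(2%:~R) gi_int; congr gi; ring.
have [B' [a2 [hB ha2 e2 na2 cop2]]] := peel pp eAB (Zi_gi c (- (c + 1))) na1 cop.
have [D' [a3 [hD ha3 e3 na3 cop3]]] := peel pq eCD ha2 na2 cop2.
have a10 : a1 != 0.
  apply/eqP => h; have : gi c (- (c + 1)) = 0 by [].
  by rewrite -[0]/(0%:~R) gi_int => /gi_inj[]; clear; lia.
have a30 : a3 != 0.
  apply/eqP => h; case/eqP: a10; rewrite -[RHS](mulr0 (gi A B' * gi C D')) -h -mulrA -e3; exact: e2.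
have [w [z [hw hwV w0 hz e4]]] := conj_coprime_sqr ha3 a30 na3 cop3.
have Qk := @Qi_k kf sd kE.
have At : sd \in Aint by apply: (@Aint_rootn 2) => //; rewrite sqrtCK; exact: rpred_nat.
have exy' : x%:~R ^+ 2 + 1 = sd ^+ 2 * y%:~R ^+ 2 :> algC.
  have h : (x ^+ 2 + 1)%:~R = ((2 * p * q)%N%:Z * y ^+ 2)%:~R :> algC by rewrite exy.
  rewrite rmorphD [RHS]rmorphM !rmorphXn rmorph1 /= in h.
  by rewrite sqrtCK.
have [Qz _] := hz.
have e5 : x%:~R - 'i = ((1 + 'i) * (gi A B' * gi C D')) * (w * z ^+ 2).
  by rewrite ea1 /a1 e2 e3 e4 /gi mul1r; ring.
have [b [u [kb Au AuV u0 eb]]] := sqrt_from_neg_pell sk (Qk _ Qi_i) (s_k kE) At exy' hw hwV w0 hz (Qk _ Qz) e5.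
by exists B', D', b, u.
Qed.
End Relation.

(** * The two kernels *)

Section Classes.
Variables (k : algC -> Prop) (sk : is_subfield k).
Local Notation O := (ringint k).
Local Notation ideal := (is_ideal k).
Local Infix "**" := (ideal_mul k) (at level 40, left associativity).
Local Notation P := (pideal k).

Definition eqc (I J : algC -> Prop) : Prop := [/\ ideal I, ideal J & same_class k I J].

Lemma eqc_refl I : ideal I -> eqc I I.
Proof. by move=> hI; split=> //; exact: sc_refl. Qed.
Lemma eqc_sym I J : eqc I J -> eqc J I.
Proof. by case=> hI hJ h; split=> //; exact: sc_sym. Qed.
Lemma eqc_trans I J K : eqc I J -> eqc J K -> eqc I K.
Proof. by case=> hI hJ h [_ hK h']; split=> //; exact: (sc_trans sk hI hJ hK h h'). Qed.
Lemma eqc_mul I I' J J' : eqc I I' -> eqc J J' -> eqc (I ** J) (I' ** J').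
Proof.
case=> hI hI' h [hJ hJ' h']; split; [exact: mul_ideal | exact: mul_ideal |].
exact: (sc_mul sk hI hI' hJ hJ' h h').
Qed.

Definition sqr_trivial X := ideal X /\ eqc (X ** X) O.

Lemma sqr_trivial_intro X r : ideal X -> O r -> r != 0 -> X ** X = P r -> sqr_trivial X.
Proof.
move=> hX hr r0 e; split=> //; rewrite e; split; [exact: pideal_ideal | exact: ideal_O |].
exact: sc_pideal.
Qed.

Lemma sqr_trivial_mul X Y : sqr_trivial X -> sqr_trivial Y -> sqr_trivial (X ** Y).
Proof.
case=> hX eX [hY eY]; split; first exact: mul_ideal.
rewrite (idmulACA sk hX hY hX hY) -(idmulO sk (ideal_O sk)); exact: eqc_mul.
Qed.

(** Boolean exponents suffice for classes of order dividing 2; adding them is exclusive or. *)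
Definition pw (b : bool) X := if b then X else O.

Lemma pw_ideal b X : ideal X -> ideal (pw b X).
Proof. by case: b => //= _; exact: ideal_O. Qed.

Lemma pw_mul b c X : sqr_trivial X -> eqc (pw b X ** pw c X) (pw (b (+) c) X).
Proof.
case=> hX eX; have hO := ideal_O sk; case: b; case: c => //=.
- by rewrite (idmulO sk hX); exact: eqc_refl.
- by rewrite (idOmul sk hX); exact: eqc_refl.
- by rewrite (idmulO sk hO); exact: eqc_refl.
Qed.

Lemma pw_distr b X Y : ideal X -> ideal Y -> pw b (X ** Y) = pw b X ** pw b Y.
Proof. by case: b => //=; rewrite (idmulO sk (ideal_O sk)). Qed.

Definition tri (X0 X1 X2 : algC -> Prop) (a b c : bool) := pw a X0 ** (pw b X1 ** pw c X2).

Lemma tri_mul X0 X1 X2 a b c a' b' c' : sqr_trivial X0 -> sqr_trivial X1 -> sqr_trivial X2 ->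
  eqc (tri X0 X1 X2 a b c ** tri X0 X1 X2 a' b' c') (tri X0 X1 X2 (a (+) a') (b (+) b') (c (+) c')).
Proof.
move=> s0 s1 s2; have [h0 _] := s0; have [h1 _] := s1; have [h2 _] := s2.
have pi b0 X : ideal X -> ideal (pw b0 X) by exact: pw_ideal.
have m := mul_ideal sk.
rewrite /tri (idmulACA sk (pi a _ h0) (m _ _ (pi b _ h1) (pi c _ h2)) (pi a' _ h0)
  (m _ _ (pi b' _ h1) (pi c' _ h2))) (idmulACA sk (pi b _ h1) (pi c _ h2) (pi b' _ h1) (pi c' _ h2)).
by apply: eqc_mul; [exact: pw_mul | apply: eqc_mul; exact: pw_mul].
Qed.

(** In [(X0 X1)^b (X0 X2)^c] the extra factor is [X0^(b + c)], which the first exponent compensates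
    modulo squares. *)
Lemma tri_shift X0 X1 X2 a b c : sqr_trivial X0 -> sqr_trivial X1 -> sqr_trivial X2 ->
  eqc (tri X0 X1 X2 a b c) (tri X0 (X0 ** X1) (X0 ** X2) (a (+) (b (+) c)) b c).
Proof.
move=> s0 s1 s2; have [h0 _] := s0; have [h1 _] := s1; have [h2 _] := s2.
have pi b0 X : ideal X -> ideal (pw b0 X) by exact: pw_ideal.
have i0 b0 := pi b0 _ h0; have i1 b0 := pi b0 _ h1; have i2 b0 := pi b0 _ h2.
have m := mul_ideal sk.
apply: eqc_sym; rewrite /tri !pw_distr // (idmulACA sk (i0 b) (i1 b) (i0 c) (i2 c)).
rewrite (idmulA sk (i0 _) (m _ _ (i0 b) (i0 c)) (m _ _ (i1 b) (i2 c))).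
apply: eqc_mul; last by apply: eqc_refl; exact: m.
apply: (@eqc_trans _ (pw (a (+) (b (+) c)) X0 ** pw (b (+) c) X0)).
  by apply: eqc_mul; [exact: eqc_refl | exact: pw_mul].
apply: (@eqc_trans _ (pw (a (+) (b (+) c) (+) (b (+) c)) X0)); first exact: pw_mul.
by rewrite -addbA addbb addbF; exact: eqc_refl.
Qed.

Variables (K : algC -> Prop) (sK : is_subfield K) (kK : forall x, k x -> K x).
Variables (X0 X1 X2 : algC -> Prop).
Hypotheses (s0 : sqr_trivial X0) (s1 : sqr_trivial X1) (s2 : sqr_trivial X2).
Hypotheses (n1 : nonzero_ideal k X1) (n2 : nonzero_ideal k X2).
Hypotheses (c1 : capitulates K X1) (c2 : capitulates K X2) (nc0 : ~ capitulates K X0).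
Hypothesis gen : forall I, nonzero_ideal k I -> capitulates K I -> exists a b c, eqc I (tri X0 X1 X2 a b c).
Hypotheses (np1 : ~ eqc X1 O) (np2 : ~ eqc X2 O) (np12 : ~ eqc (X1 ** X2) O).

Lemma cap_eqc I J : eqc I J -> capitulates K I -> capitulates K J.
Proof. by case=> hI hJ h; exact: (cap_sc sk sK kK hI hJ h). Qed.

Lemma ideal_pow_ideal X n : ideal X -> ideal (ideal_pow k X n).
Proof. by move=> hX; elim: n => [|n ih] /=; [exact: ideal_O | exact: mul_ideal]. Qed.

Lemma cap_pow X n : ideal X -> capitulates K X -> capitulates K (ideal_pow k X n).
Proof.
move=> hX cX; elim: n => [|n ih] /=; first exact: cap_O.
by apply: cap_mul => //; exact: ideal_pow_ideal.
Qed.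

Lemma pw_pow b X : ideal X -> pw b X = ideal_pow k X b.
Proof. by case: b => //= hX; rewrite (idmulO sk hX). Qed.

(** If [I] is equivalent to [X0] times a product [M] of [X1] and [X2], then [I] times [M]
    capitulates and is equivalent to [X0], since [M] has trivial square; this is excluded. *)
Lemma kernel_pw I : nonzero_ideal k I -> capitulates K I -> exists b c, eqc I (pw b X1 ** pw c X2).
Proof.
have [h0 _] := s0; have [h1 _] := s1; have [h2 _] := s2.
move=> nI cI; have [a [b [c e]]] := gen nI cI; exists b, c.
have hM : ideal (pw b X1 ** pw c X2) by apply: mul_ideal => //; exact: pw_ideal.
case: a e => e; last first.
  by apply: (eqc_trans e); rewrite /tri /= (idOmul sk hM); exact: eqc_refl.
case: nc0; have ce := cap_eqc e cI.
have cM : capitulates K (pw b X1 ** pw c X2).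
  apply: (cap_mul sk sK kK) => //; try exact: pw_ideal.
    by case: (b) => //=; exact: cap_O.
  by case: (c) => //=; exact: cap_O.
have sM : sqr_trivial (pw b X1 ** pw c X2).
  have sO : sqr_trivial O.
    by split; [exact: ideal_O | rewrite (idmulO sk (ideal_O sk)); exact/eqc_refl/ideal_O].
  by apply: sqr_trivial_mul; [case: (b) | case: (c)].
have [_ eM] := sM.
apply: (@cap_eqc (X0 ** (pw b X1 ** pw c X2) ** (pw b X1 ** pw c X2))); last first.
  by apply: (cap_mul sk sK kK) => //; exact: mul_ideal.
rewrite -(idmulA sk h0 hM hM) -{2}[X0](idmulO sk h0).
by apply: eqc_mul eM; exact: eqc_refl.
Qed.

Lemma kernel_iff I : nonzero_ideal k I -> capitulates K I <->
  exists a b : nat, same_class k I (ideal_pow k X1 a ** ideal_pow k X2 b).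
Proof.
have [h1 _] := s1; have [h2 _] := s2.
move=> nI; split.
  by case/(kernel_pw nI) => b [c [_ _ e]]; exists b, c; rewrite -!pw_pow.
case=> a [b e]; have [hI _] := nI.
have p1 := ideal_pow_ideal a h1; have p2 := ideal_pow_ideal b h2.
apply: (@cap_eqc (ideal_pow k X1 a ** ideal_pow k X2 b)).
  by split=> //; [exact: mul_ideal | exact: sc_sym].
by apply: (cap_mul sk sK kK) => //; exact: cap_pow.
Qed.

Lemma kernel_four : exists I1 I2 I3 I4 : algC -> Prop,
  [/\ [/\ nonzero_ideal k I1, nonzero_ideal k I2, nonzero_ideal k I3 & nonzero_ideal k I4],
      [/\ capitulates K I1, capitulates K I2, capitulates K I3 & capitulates K I4],
      [/\ ~ same_class k I1 I2, ~ same_class k I1 I3, ~ same_class k I1 I4, ~ same_class k I2 I3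
        & [/\ ~ same_class k I2 I4 & ~ same_class k I3 I4]]
    & forall I, nonzero_ideal k I -> capitulates K I ->
        [\/ same_class k I I1, same_class k I I2, same_class k I I3 | same_class k I I4]].
Proof.
have [h1 e1] := s1; have [h2 e2] := s2; have hO := ideal_O sk; have h12 := mul_ideal sk h1 h2.
have r1 := eqc_refl h1; have r2 := eqc_refl h2.
exists O, X1, X2, (X1 ** X2); split.
- by split=> //; [exact: nonzero_O | exact: nonzero_mul].
- by split=> //; [exact: cap_O | exact: cap_mul].
- split; [| | | |split].
  + by move=> h; apply: np1; split=> //; exact: sc_sym.
  + by move=> h; apply: np2; split=> //; exact: sc_sym.
  + by move=> h; apply: np12; split=> //; exact: sc_sym.
  + move=> h; apply: np12; apply: (@eqc_trans _ (X2 ** X2)) => //.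
    by apply: eqc_mul => //; split.
  + move=> h; apply: np2.
    have e : eqc (X1 ** X1) (X1 ** (X1 ** X2)) by apply: eqc_mul => //; split.
    apply: (@eqc_trans _ (X1 ** (X1 ** X2))); last exact: eqc_trans (eqc_sym e) e1.
    rewrite (idmulA sk h1 h1 h2) -{1}(idOmul sk h2).
    by apply: eqc_mul => //; exact: eqc_sym.
  + move=> h; apply: np1.
    have e : eqc (X2 ** X2) (X2 ** (X1 ** X2)) by apply: eqc_mul => //; split.
    apply: (@eqc_trans _ (X2 ** (X1 ** X2))); last exact: eqc_trans (eqc_sym e) e2.
    rewrite (idmulC _ X1) (idmulA sk h2 h2 h1) -{1}(idOmul sk h1).
    by apply: eqc_mul => //; exact: eqc_sym.
move=> I nI /(kernel_pw nI) [b [c [_ _]]].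
case: b; case: c => /=; rewrite ?(idmulO sk) ?(idOmul sk) //.
- by constructor 4.
- by constructor 2.
- by constructor 3.
- by constructor 1.
Qed.
End Classes.

Section ClassRelations.
Variables (k : algC -> Prop) (sk : is_subfield k).
Local Notation O := (ringint k).
Local Notation ideal := (is_ideal k).
Local Notation eqk := (eqc k).
Local Infix "**" := (ideal_mul k) (at level 40, left associativity).

Lemma eqc_inv X Y : sqr_trivial k X -> sqr_trivial k Y -> eqk (X ** Y) O -> eqk X Y.
Proof.
case=> hX eX [hY eY] e; apply: (eqc_trans sk (J := X ** (Y ** Y))).
  by rewrite -{1}(idmulO sk hX); apply: (eqc_mul sk); [exact: eqc_refl | exact: eqc_sym].
rewrite (idmulA sk hX hY hY) -{3}(idOmul sk hY).
by apply: (eqc_mul sk) => //; exact: eqc_refl.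
Qed.

Lemma eqc_relations X0 Xb Xc Xd Xe : sqr_trivial k X0 -> sqr_trivial k Xb -> sqr_trivial k Xc ->
  sqr_trivial k Xd -> sqr_trivial k Xe -> eqk (Xb ** Xc ** (Xd ** Xe)) O ->
  eqk (X0 ** (Xb ** Xd)) O -> eqk Xd (X0 ** Xb) /\ eqk Xe (X0 ** Xc).
Proof.
move=> s0 sb sc sd se r1 r2; have [h0 e0] := s0; have [hb eb] := sb; have [hc ec] := sc.
have [hd ed] := sd; have [he ee] := se; have m := mul_ideal sk.
have rd : eqk (X0 ** Xb) Xd.
  by apply: eqc_inv => //; [exact: sqr_trivial_mul | rewrite -idmulA].
split; first exact: eqc_sym.
have re : eqk (Xb ** Xc ** Xd) Xe.
  by apply: eqc_inv => //; [do !apply: sqr_trivial_mul | rewrite -(idmulA sk (m _ _ hb hc) hd he)].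
apply: (eqc_trans sk (eqc_sym re)).
apply: (eqc_trans sk (J := Xb ** Xc ** (X0 ** Xb))).
  by apply: (eqc_mul sk); [exact: eqc_refl (m _ _ hb hc) | exact: eqc_sym].
rewrite (idmulC _ X0 Xb) (idmulACA sk hb hc hb h0) (idmulC _ Xc) -{2}(idOmul sk (m _ _ h0 hc)).
by apply: (eqc_mul sk) => //; exact: eqc_refl (m _ _ h0 hc).
Qed.

Lemma tri_unit X0 X1 X2 : ideal X0 -> ideal X1 -> ideal X2 ->
  [/\ tri k X0 X1 X2 false false false = O, tri k X0 X1 X2 true false false = X0,
      tri k X0 X1 X2 false true false = X1, tri k X0 X1 X2 false false true = X2
    & tri k X0 X1 X2 true true false = X0 ** X1 /\ tri k X0 X1 X2 true false true = X0 ** X2].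
Proof.
move=> h0 h1 h2; have hO := ideal_O sk.
by split; rewrite /tri /= ?(idOmul sk hO) ?(idmulO sk h0) ?(idmulO sk h1) ?(idOmul sk h1) ?(idOmul sk h2).
Qed.

Lemma not_principal X : ideal X -> ~ is_principal k X -> ~ eqk X O.
Proof.
move=> hX np [_ _ /(sc_principal sk hX)[a ha [_ e]]]; apply: np.
by exists a; split=> // x; rewrite e.
Qed.
End ClassRelations.

Section Assembly.
Variables (p q : nat) (A B C D : int) (H0 H1 H2 H3 H4 : algC -> Prop).
Hypotheses (pp : prime p) (pq : prime q) (npq : p != q) (p4 : (p %% 4 = 1)%N) (q4 : (q %% 4 = 1)%N).
Hypotheses (eAB : p%:Z = A ^+ 2 + B ^+ 2) (eCD : q%:Z = C ^+ 2 + D ^+ 2).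
Hypothesis genus : [\/ leg p q%:R = -1 /\ leg p 2 = -1, leg p q%:R = -1 /\ leg q 2 = -1
    | leg p 2 = -1 /\ leg q 2 = -1].
Local Notation sd := (sqrtC (2 * p * q)%N%:R : algC).
Local Notation kf := (genfield [:: sd; 'i]).
Local Notation Kp := (genfield [:: sd; 'i; sqrtC p%:R]).
Local Notation Kq := (genfield [:: sd; 'i; sqrtC q%:R]).
Local Notation sQ := Qi_subfield.
Local Notation O := (ringint kf).
Local Notation ideal := (is_ideal kf).
Local Notation eqk := (eqc kf).
Local Notation P := (pideal kf).
Local Infix "**" := (ideal_mul kf) (at level 40, left associativity).
Hypotheses (P0 : prime_ideal kf H0) (P1 : prime_ideal kf H1) (P2 : prime_ideal kf H2)
  (P3 : prime_ideal kf H3) (P4 : prime_ideal kf H4).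
Hypotheses (E0 : H0 ** H0 = P (gi 1 1)) (E1 : H1 ** H1 = P (gi A B)) (E2 : H2 ** H2 = P (gi A (- B)))
  (E3 : H3 ** H3 = P (gi C D)) (E4 : H4 ** H4 = P (gi C (- D))).

Let sk := genfield_subfield [:: sd; 'i].
Let kE := kfE p q.
Let eABN : p%:Z = A ^+ 2 + (- B) ^+ 2. Proof. by rewrite sqrrN. Qed.
Let eCDN : q%:Z = C ^+ 2 + (- D) ^+ 2. Proof. by rewrite sqrrN. Qed.

Lemma prime_ideal_nonzero H : prime_ideal kf H -> nonzero_ideal kf H. Proof. by case. Qed.
Lemma prime_ideal_ideal H : prime_ideal kf H -> ideal H. Proof. by case=> -[]. Qed.
Let N0 := prime_ideal_nonzero P0. Let I0 := prime_ideal_ideal P0.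
Let N1 := prime_ideal_nonzero P1. Let I1 := prime_ideal_ideal P1.
Let N2 := prime_ideal_nonzero P2. Let I2 := prime_ideal_ideal P2.
Let N3 := prime_ideal_nonzero P3. Let I3 := prime_ideal_ideal P3.
Let N4 := prime_ideal_nonzero P4. Let I4 := prime_ideal_ideal P4.

Let Og a b : O (gi a b). Proof. exact: (Zi_O kE (Zi_gi a b)). Qed.

Let e11 : 2%:Z = 1 ^+ 2 + 1 ^+ 2. Proof. by []. Qed.
Let g0 : gi 1 1 != 0. Proof. exact: (@gi_prime_neq0 2). Qed.
Let g1 : gi A B != 0. Proof. exact: (@gi_prime_neq0 p). Qed.
Let g2 : gi A (- B) != 0. Proof. exact: (@gi_prime_neq0 p). Qed.
Let g3 : gi C D != 0. Proof. exact: (@gi_prime_neq0 q). Qed.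
Let g4 : gi C (- D) != 0. Proof. exact: (@gi_prime_neq0 q). Qed.

Let S0 : sqr_trivial kf H0. Proof. exact: (sqr_trivial_intro sk I0 (Og _ _) g0 E0). Qed.
Let S1 : sqr_trivial kf H1. Proof. exact: (sqr_trivial_intro sk I1 (Og _ _) g1 E1). Qed.
Let S2 : sqr_trivial kf H2. Proof. exact: (sqr_trivial_intro sk I2 (Og _ _) g2 E2). Qed.
Let S3 : sqr_trivial kf H3. Proof. exact: (sqr_trivial_intro sk I3 (Og _ _) g3 E3). Qed.
Let S4 : sqr_trivial kf H4. Proof. exact: (sqr_trivial_intro sk I4 (Og _ _) g4 E4). Qed.

(** [H] and [(b)] have the same square, so [sqr_inj] makes them equal. *)
Lemma principal_sqrt H r b u : nonzero_ideal kf H -> O r -> r != 0 -> H ** H = P r ->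
  kf b -> u \in Aint -> u^-1 \in Aint -> u != 0 -> b ^+ 2 = r * u -> eqk H O.
Proof.
move=> nH hr r0 eH kb Au AuV u0 eb; have [tau [ti td]] := flip_sd pp pq npq p4 q4.
have hO := ideal_O sk; have [hH _] := nH; have [kr Ar] := hr.
have b0 : b != 0 by apply/eqP => h; move/eqP: eb; rewrite h expr0n eq_sym mulf_eq0 (negPf r0) (negPf u0).
have ob : O b by split=> //; apply: (@Aint_rootn 2) => //; rewrite eb; exact: rpredM.
have ku : kf u.
  have -> : u = b ^+ 2 / r by rewrite eb mulrC mulKf.
  by apply: (sf_div sk) => //; exact: (sfX sk).
have pb := pideal_ideal sk ob.
have nP : nonzero_ideal kf (P b) by split=> //; exists b; split=> //; exact: mem_pideal.
have -> : H = P b.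
  apply: (sqr_inj sk kE ti td (sd_neq0 pp pq)) => //.
  rewrite eH (pidealM sk ob ob) -expr2 eb pideal_unit //; split=> //.
  exact: (sfV sk).
by split=> //; exact: sc_pideal.
Qed.

(** Comes from [(sd) = H0^2 H1 H2 H3 H4], verified on squares: [(1 + i)^2 p q = 2 i p q], a unit
    times [sd ^+ 2]. The factor [H0^2] has trivial class. *)
Lemma four_relation : eqk (H1 ** H2 ** (H3 ** H4)) O.
Proof.
have m := mul_ideal sk; have h12 := m _ _ I1 I2; have h34 := m _ _ I3 I4.
have h00 := m _ _ I0 I0; have h1234 := m _ _ h12 h34.
apply: (eqc_trans sk (J := H0 ** H0 ** (H1 ** H2 ** (H3 ** H4)))).
  rewrite -{1}(idOmul sk h1234); apply: (eqc_mul sk); last exact: eqc_refl.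
  by apply: eqc_sym => //; case: S0.
have e : H0 ** H0 ** (H1 ** H2 ** (H3 ** H4)) ** (H0 ** H0 ** (H1 ** H2 ** (H3 ** H4))) =
    P (gi 1 1 * gi 1 1 * (gi A B * gi A (- B) * (gi C D * gi C (- D)))).
  rewrite (idmulACA sk h00 h1234 h00 h1234) E0 (idmulACA sk h12 h34 h12 h34).
  rewrite (idmulACA sk I1 I2 I1 I2) (idmulACA sk I3 I4 I3 I4) E1 E2 E3 E4.
  by rewrite !(pidealM sk) //; do ?apply: (riM sk).
have ev : gi 1 1 * gi 1 1 * (gi A B * gi A (- B) * (gi C D * gi C (- D))) = sd ^+ 2 * 'i.
  rewrite (gi_mul_conj eAB) (gi_mul_conj eCD) sqrtCK giM.
  have -> : gi (1 * 1 - 1 * 1) (1 * 1 + 1 * 1) = 2 * 'i by rewrite /gi add0r.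
  by rewrite !natrM; ring.
apply: (principal_sqrt (b := sd) (u := - 'i) _ _ _ e); rewrite ?ev.
- by do !apply: nonzero_mul.
- apply: (riM sk); last exact: (Zi_O kE Zi_i).
  by rewrite sqrtCK; exact: (ri_nat sk).
- by rewrite mulf_neq0 ?neq0Ci // expf_neq0 // sd_neq0.
- exact: (s_k kE).
- by rewrite rpredN Aint_i.
- by rewrite -invCi invrK Aint_i.
- by rewrite oppr_eq0 neq0Ci.
by rewrite -mulrA mulrN -expr2 sqrCi opprK mulr1.
Qed.

(** The signs left open in [sqrt_relation] decide which of [H3], [H4] is paired with [H1]; the
    generated subgroup is the same. *)
Lemma H34_relation : (eqk H3 (H0 ** H1) /\ eqk H4 (H0 ** H2)) \/ (eqk H4 (H0 ** H1) /\ eqk H3 (H0 ** H2)).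
Proof.
have [B' [D' [b [u [hB hD kb [Au AuV u0] eb]]]]] := sqrt_relation pp pq npq p4 q4 eAB eCD genus.
have m := mul_ideal sk.
have i1 : 1 + 'i = gi 1 1 by rewrite /gi mul1r.
rewrite i1 in eb.
have r2 Xb Xd : nonzero_ideal kf Xb -> nonzero_ideal kf Xd -> Xb ** Xb = P (gi A B') -> Xd ** Xd = P (gi C D') ->
    gi A B' != 0 -> gi C D' != 0 -> eqk (H0 ** (Xb ** Xd)) O.
  move=> nb nd e1 e2 z1 z2; have [hb _] := nb; have [hd _] := nd; have hbd := m _ _ hb hd.
  apply: (principal_sqrt (r := gi 1 1 * (gi A B' * gi C D')) _ _ _ _ kb Au AuV u0 eb).
  - by do !apply: nonzero_mul.
  - by do !apply: (riM sk).
  - by rewrite !mulf_neq0.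
  by rewrite (idmulACA sk I0 hbd I0 hbd) (idmulACA sk hb hd hb hd) E0 e1 e2 !(pidealM sk) //; exact: (riM sk).
have r1 := four_relation.
have r1' : eqk (H1 ** H2 ** (H4 ** H3)) O by rewrite (idmulC _ H4).
have r1'' : eqk (H2 ** H1 ** (H3 ** H4)) O by rewrite (idmulC _ H2).
have r1''' : eqk (H2 ** H1 ** (H4 ** H3)) O by rewrite (idmulC _ H2) (idmulC _ H4).
case: hB => eB; case: hD => eD; rewrite eB eD in r2.
- by left; apply: (eqc_relations sk S0 S1 S2 S3 S4 r1); exact: r2.
- by right; apply: (eqc_relations sk S0 S1 S2 S4 S3 r1'); exact: r2.
- right; apply/and_comm; apply: (eqc_relations sk S0 S2 S1 S3 S4 r1''); exact: r2.
- left; apply/and_comm; apply: (eqc_relations sk S0 S2 S1 S4 S3 r1'''); exact: r2.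
Qed.

Definition in_tri I := exists a b c, eqk I (tri kf H0 H1 H2 a b c).

Lemma in_tri_mul I Y a b c : in_tri I -> eqk Y (tri kf H0 H1 H2 a b c) -> in_tri (I ** Y).
Proof.
case=> a' [b' [c' e]] e'; exists (a' (+) a), (b' (+) b), (c' (+) c).
by apply: (eqc_trans sk (eqc_mul sk e e')); exact: tri_mul.
Qed.

(** If [u] were ['i] or [- 'i], the genus conditions at [p] and at [q] would make both symbols of 2
    equal to 1, against the hypothesis. *)
Lemma unit_norm (tau : {rmorphism algC -> algC}) g n u : tau 'i = 'i -> tau sd = - sd -> O g -> Zi n -> n != 0 -> is_unit4 u ->
  g * tau g = u * n ^+ 2 -> u = 1 \/ u = -1.
Proof.
move=> ti td og hn n0 hu e.
have u0p := unit4_phi pp p4 eAB hu; have u0q := unit4_phi pq q4 eCD hu.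
have dpq : ~~ (p %| q)%N by rewrite dvdn_prime2.
have dqp : ~~ (q %| p)%N by rewrite dvdn_prime2 // eq_sym.
have sdp : sd ^+ 2 = gi A B * cofactor q A B by rewrite sqrtCK (cofactorE q eAB).
have sdq : sd ^+ 2 = gi C D * cofactor p C D by rewrite sqrtCK mulnAC (cofactorE p eCD).
have hp := genus_norm_unit sk kE (Zi_sd2 p q) ti td (sd_neq0 pp pq) pp p4 eAB
  (Zi_cofactor q A B) sdp (phi_cofactor_neq0 pp dpq p4 eAB) og (unit4_Zi hu) hn n0 u0p e.
have hq := genus_norm_unit sk kE (Zi_sd2 p q) ti td (sd_neq0 pp pq) pq q4 eCD
  (Zi_cofactor p C D) sdq (phi_cofactor_neq0 pq dqp q4 eCD) og (unit4_Zi hu) hn n0 u0q e.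
have contra : u = 'i \/ u = - 'i -> False.
  move=> ui; move: hp hq; rewrite !leg_phi_i //; try exact: rt_sqr.
  by move=> hp hq; move: genus; rewrite hp hq; case=> -[].
by case: hu => h; [left | right | case: contra; left | case: contra; right].
Qed.

Lemma ramified_cons C0 H z hs : prime_ideal kf H -> Zi z -> prime_elt z -> z != 0 -> H ** H = P z ->
  (forall X, ideal X -> C0 X -> C0 (X ** H)) -> ramified_list kf C0 hs ->
  ramified_list kf C0 ((H, z) :: hs).
Proof. by move=> h1 h2 h3 h4 h5 h6 h7; split. Qed.

Lemma torsion I g : nonzero_ideal kf I -> O g -> I ** I = P g -> in_tri I.
Proof.
have [tau [ti td]] := flip_sd pp pq npq p4 q4; have sd0 := sd_neq0 pp pq; have Zs2 := Zi_sd2 p q.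
have un g' n u : O g' -> Zi n -> n != 0 -> is_unit4 u -> g' * tau g' = u * n ^+ 2 -> u = 1 \/ u = -1.
  exact: unit_norm ti td.
move=> nI og eI; have [hI _] := nI.
have [J [c [hJ hc c0 eJ IJ]]] := reduce_square sk kE ti td sd0 un nI og eI.
have nJ := nonzero_sqr hJ (Zi_O kE hc) c0 eJ.
have [J' [l [nJ' hl l0 [eJ' [l' hl' el]] JJ']]] := reduce_conductor sk kE Zs2 ti td sd0 nJ hc c0 eJ.
have [hJ' _] := nJ'.
suff [a [b [c' e]]] : in_tri J'.
  exists a, b, c'; apply: (eqc_trans sk (J := J)); first by split.
  by apply: (eqc_trans sk (J := J')) => //; split.
have [t0 t1 t2 t3 [t4 t5]] := tri_unit sk I0 I1 I2.
have hO := ideal_O sk.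
have inO : in_tri O by exists false, false, false; rewrite t0; exact: eqc_refl.
have c0' X : ideal X -> in_tri X -> in_tri (X ** H0).
  by move=> _ hX; apply: (in_tri_mul hX (a := true) (b := false) (c := false)); rewrite t1; exact: eqc_refl.
have c1' X : ideal X -> in_tri X -> in_tri (X ** H1).
  by move=> _ hX; apply: (in_tri_mul hX (a := false) (b := true) (c := false)); rewrite t2; exact: eqc_refl.
have c2' X : ideal X -> in_tri X -> in_tri (X ** H2).
  by move=> _ hX; apply: (in_tri_mul hX (a := false) (b := false) (c := true)); rewrite t3; exact: eqc_refl.
have [c3' c4'] : (forall X, ideal X -> in_tri X -> in_tri (X ** H3)) /\
    (forall X, ideal X -> in_tri X -> in_tri (X ** H4)).
  have h34 := H34_relation; rewrite -t4 -t5 in h34.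
  by case: h34 => -[h h']; split=> X _ hX; apply: (in_tri_mul hX); first [exact: h | exact: h'].
have pe0 := gi_prime_elt (r := 2) isT e11.
have pe1 := gi_prime_elt pp eAB; have pe2 := gi_prime_elt pp eABN.
have pe3 := gi_prime_elt pq eCD; have pe4 := gi_prime_elt pq eCDN.
(* [4 * sd ^+ 2 = 8 p q], and [(1 + i)^6 = -8 i]: six copies of [H0] are needed, and the product of
   the list is [- 'i] times [4 * sd ^+ 2], which explains the factor put on [l'] below. *)
pose hs := [:: (H0, gi 1 1); (H0, gi 1 1); (H0, gi 1 1); (H0, gi 1 1); (H0, gi 1 1); (H0, gi 1 1);
  (H1, gi A B); (H2, gi A (- B)); (H3, gi C D); (H4, gi C (- D))].
have Zg a b : Zi (gi a b) := Zi_gi a b.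
have ram : ramified_list kf in_tri hs.
  by rewrite /hs; do 10 (apply: ramified_cons => //).
apply: (strip_all sk kE ti td sd0 inO ram hJ' hl (riM sQ hl' (riN sQ Zi_i)) l0 eJ').
rewrite /hs !big_cons big_nil /=.
transitivity (- 'i * (4 * sd ^+ 2)); first by rewrite el; ring.
have e2 : gi 1 1 * gi 1 1 = 2 * 'i by rewrite giM gi_i -[2]/(2%:~R) [2%:~R]gi_int giM; congr gi; ring.
have i2 : 'i * 'i = -1 :> algC := mulCii _.
transitivity ((gi 1 1 * gi 1 1) ^+ 3 * (gi A B * gi A (- B)) * (gi C D * gi C (- D))); last by ring.
rewrite e2 (gi_mul_conj eAB) (gi_mul_conj eCD) sqrtCK !natrM.
transitivity (8 * 'i * ('i * 'i) * p%:R * q%:R : algC); last by ring.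
by rewrite i2; ring.
Qed.

(** Exchanging [p] and [q] carries the results on [k(sqrt p)] over to [k(sqrt q)]; the radicand then
    has to be reordered. *)
Let d_comm : (2 * q * p)%N = (2 * p * q)%N. Proof. by rewrite mulnAC. Qed.

Lemma cap_torsion_p I : nonzero_ideal kf I -> capitulates Kp I -> in_tri I.
Proof. by move=> nI /(kf_cap_norm pp pq npq p4 q4 nI)[g og eg]; exact: torsion og eg. Qed.

Lemma cap_torsion_q I : nonzero_ideal kf I -> capitulates Kq I -> in_tri I.
Proof.
have nqp : q != p by rewrite eq_sym.
have := @kf_cap_norm q p pq pp nqp q4 p4 I; rewrite d_comm => h nI cI.
by have [g og eg] := h nI cI; exact: torsion og eg.
Qed.

Lemma cap_p H : ideal H -> H ** H = P (gi A B) \/ H ** H = P (gi A (- B)) -> capitulates Kp H.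
Proof.
by move=> hH [] e; [exact: (gi_cap pp pq npq p4 q4 eAB hH e) | exact: (gi_cap pp pq npq p4 q4 eABN hH e)].
Qed.

Lemma cap_q H : ideal H -> H ** H = P (gi C D) \/ H ** H = P (gi C (- D)) -> capitulates Kq H.
Proof.
have nqp : q != p by rewrite eq_sym.
have h1 := @gi_cap q p C D pq pp nqp q4 p4 eCD H; have h2 := @gi_cap q p C (- D) pq pp nqp q4 p4 eCDN H.
rewrite d_comm in h1 h2.
by move=> hH [] e; [exact: h1 | exact: h2].
Qed.

Let i1E : 1 + 'i = gi 1 1 :> algC. Proof. by rewrite /gi mul1r. Qed.

Lemma not_cap_p : ~ capitulates Kp H0.
Proof. by apply: (gi11_not_cap pp pq npq p4 q4) => //; rewrite i1E. Qed.

Lemma not_cap_q : ~ capitulates Kq H0.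
Proof.
have nqp : q != p by rewrite eq_sym.
have := @gi11_not_cap q p pq pp nqp q4 p4 H0; rewrite d_comm i1E; exact.
Qed.

Lemma class_np : [/\ ~ eqk H1 O, ~ eqk H2 O, ~ eqk (H1 ** H2) O, ~ eqk (H0 ** H1) O & ~ eqk (H0 ** H2) O].
Proof.
have [tau [ti td]] := flip_sd pp pq npq p4 q4; have sd0 := sd_neq0 pp pq.
have m := mul_ideal sk; have sd2 : sd ^+ 2 = (2 * p * q)%N%:R := sqrtCK _.
have npi := nonprincipal_pi pp pq npq p4 q4 eAB eCD sd2 sk kE ti td sd0 genus.
have npiN := nonprincipal_pi pp pq npq p4 q4 eABN eCD sd2 sk kE ti td sd0 genus.
have np0 := nonprincipal_pi0 pp pq npq p4 q4 eAB eCD sd2 sk kE ti td sd0 genus.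
have np0N := nonprincipal_pi0 pp pq npq p4 q4 eABN eCD sd2 sk kE ti td sd0 genus.
have npp := nonprincipal_p pp pq npq p4 q4 eAB eCD sd2 sk kE ti td sd0 genus.
split; apply: (not_principal sk); try exact: m; try by [].
- exact: npi E1.
- exact: npiN E2.
- by apply: npp; rewrite (idmulACA sk I1 I2 I1 I2) E1 E2 (pidealM sk (Og _ _) (Og _ _)) (gi_mul_conj eAB).
- by apply: np0; rewrite (idmulACA sk I0 I1 I0 I1) E0 E1 (pidealM sk (Og _ _) (Og _ _)) mulrC.
- by apply: np0N; rewrite (idmulACA sk I0 I2 I0 I2) E0 E2 (pidealM sk (Og _ _) (Og _ _)) mulrC.
Qed.

Lemma cap_q_G : capitulates Kq (H0 ** H1) /\ capitulates Kq (H0 ** H2).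
Proof.
have kK := @kf_Kf q p; rewrite d_comm in kK.
have sK := genfield_subfield [:: sd; 'i; sqrtC q%:R].
have c3 : capitulates Kq H3 by apply: cap_q => //; left.
have c4 : capitulates Kq H4 by apply: cap_q => //; right.
by case: H34_relation => -[h h']; split; apply: (cap_eqc sk sK kK _ _); first [exact: h | exact: h' | by []].
Qed.

Lemma kernels : [/\
    exists I1 I2 I3 I4 : algC -> Prop,
      [/\ [/\ nonzero_ideal kf I1, nonzero_ideal kf I2, nonzero_ideal kf I3 & nonzero_ideal kf I4],
          [/\ capitulates Kp I1, capitulates Kp I2, capitulates Kp I3 & capitulates Kp I4],
          [/\ ~ same_class kf I1 I2, ~ same_class kf I1 I3, ~ same_class kf I1 I4, ~ same_class kf I2 I3
            & [/\ ~ same_class kf I2 I4 & ~ same_class kf I3 I4]]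
        & forall I, nonzero_ideal kf I -> capitulates Kp I ->
            [\/ same_class kf I I1, same_class kf I I2, same_class kf I I3 | same_class kf I I4]],
    exists I1 I2 I3 I4 : algC -> Prop,
      [/\ [/\ nonzero_ideal kf I1, nonzero_ideal kf I2, nonzero_ideal kf I3 & nonzero_ideal kf I4],
          [/\ capitulates Kq I1, capitulates Kq I2, capitulates Kq I3 & capitulates Kq I4],
          [/\ ~ same_class kf I1 I2, ~ same_class kf I1 I3, ~ same_class kf I1 I4, ~ same_class kf I2 I3
            & [/\ ~ same_class kf I2 I4 & ~ same_class kf I3 I4]]
        & forall I, nonzero_ideal kf I -> capitulates Kq I ->
            [\/ same_class kf I I1, same_class kf I I2, same_class kf I I3 | same_class kf I I4]],
    (forall I, nonzero_ideal kf I -> capitulates Kp I <->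
       exists a b : nat, same_class kf I (ideal_pow kf H1 a ** ideal_pow kf H2 b))
  & (forall I, nonzero_ideal kf I -> capitulates Kq I <->
       exists a b : nat, same_class kf I (ideal_pow kf (H0 ** H1) a ** ideal_pow kf (H0 ** H2) b))].
Proof.
have sKp := genfield_subfield [:: sd; 'i; sqrtC p%:R].
have sKq := genfield_subfield [:: sd; 'i; sqrtC q%:R].
have kKp := @kf_Kf p q; have kKq := @kf_Kf q p; rewrite d_comm in kKq.
have [np1 np2 np12 np01 np02] := class_np.
have [cG1 cG2] := cap_q_G.
have cH1 : capitulates Kp H1 by apply: cap_p => //; left.
have cH2 : capitulates Kp H2 by apply: cap_p => //; right.
have SG1 := sqr_trivial_mul sk S0 S1; have SG2 := sqr_trivial_mul sk S0 S2.
have NG1 := nonzero_mul sk N0 N1; have NG2 := nonzero_mul sk N0 N2.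
have genq I : nonzero_ideal kf I -> capitulates Kq I ->
    exists a b c, eqk I (tri kf H0 (H0 ** H1) (H0 ** H2) a b c).
  move=> nI /(cap_torsion_q nI)[a [b [c e]]]; exists (a (+) (b (+) c)), b, c.
  by apply: (eqc_trans sk e); exact: tri_shift.
(* The product of the two new generators is equivalent to [H1 ** H2], because [H0 ** H0] is
   principal. *)
have npG : ~ eqk (H0 ** H1 ** (H0 ** H2)) O.
  move=> e; apply: np12; apply: (eqc_trans sk _ e); apply: eqc_sym.
  rewrite (idmulACA sk I0 I1 I0 I2) -{2}(idOmul sk (mul_ideal sk I1 I2)).
  by apply: (eqc_mul sk); [case: S0 | exact: eqc_refl sk _ (mul_ideal sk I1 I2)].
split.
- exact: (kernel_four sk sKp kKp S0 S1 S2 N1 N2 cH1 cH2 not_cap_p cap_torsion_p np1 np2 np12).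
- exact: (kernel_four sk sKq kKq S0 SG1 SG2 NG1 NG2 cG1 cG2 not_cap_q genq np01 np02 npG).
- exact: (kernel_iff sk sKp kKp S0 S1 S2 cH1 cH2 not_cap_p cap_torsion_p).
- exact: (kernel_iff sk sKq kKq S0 SG1 SG2 cG1 cG2 not_cap_q genq).
Qed.
End Assembly.

Unset Implicit Arguments.

Theorem theorem43 (p1 p2 : nat) (e f g h : int)
  (H0 H1 H2 H3 H4 : algC -> Prop) :
  prime p1 -> prime p2 -> p1 != p2 ->
  (p1 %% 4 = 1)%N -> (p2 %% 4 = 1)%N ->
  (* at least two of (p1/p2), (2/p1), (2/p2) equal -1 *)
  [|| (legendre p1 p2 == -1) && (legendre 2 p1 == -1),
      (legendre p1 p2 == -1) && (legendre 2 p2 == -1)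
    | (legendre 2 p1 == -1) && (legendre 2 p2 == -1)] ->
  (p1%:Z = e ^+ 2 + 4 * f ^+ 2) -> (p2%:Z = g ^+ 2 + 4 * h ^+ 2) ->
  let k := genfield [:: sqrtC (2 * p1 * p2)%N%:R; 'i] in
  let K1 := genfield [:: sqrtC (2 * p1 * p2)%N%:R; 'i; sqrtC p1%:R] in
  let K2 := genfield [:: sqrtC (2 * p1 * p2)%N%:R; 'i; sqrtC p2%:R] in
  let pi1 : algC := e%:~R + 2 * 'i * f%:~R in
  let pi2 : algC := e%:~R - 2 * 'i * f%:~R in
  let pi3 : algC := g%:~R + 2 * 'i * h%:~R in
  let pi4 : algC := g%:~R - 2 * 'i * h%:~R in
  prime_ideal k H0 -> ideal_eq (ideal_mul k H0 H0) (pideal k (1 + 'i)) ->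
  prime_ideal k H1 -> ideal_eq (ideal_mul k H1 H1) (pideal k pi1) ->
  prime_ideal k H2 -> ideal_eq (ideal_mul k H2 H2) (pideal k pi2) ->
  prime_ideal k H3 -> ideal_eq (ideal_mul k H3 H3) (pideal k pi3) ->
  prime_ideal k H4 -> ideal_eq (ideal_mul k H4 H4) (pideal k pi4) ->
  [/\
    (* exactly four classes of k capitulate in K1 *)
    (exists I1 I2 I3 I4 : algC -> Prop,
       [/\ [/\ nonzero_ideal k I1, nonzero_ideal k I2, nonzero_ideal k I3
             & nonzero_ideal k I4],
           [/\ capitulates K1 I1, capitulates K1 I2, capitulates K1 I3
             & capitulates K1 I4],
           [/\ ~ same_class k I1 I2, ~ same_class k I1 I3, ~ same_class k I1 I4,
               ~ same_class k I2 I3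
             & [/\ ~ same_class k I2 I4 & ~ same_class k I3 I4]]
         & forall I, nonzero_ideal k I -> capitulates K1 I ->
             [\/ same_class k I I1, same_class k I I2, same_class k I I3
               | same_class k I I4]]),
    (* exactly four classes of k capitulate in K2 *)
    (exists I1 I2 I3 I4 : algC -> Prop,
       [/\ [/\ nonzero_ideal k I1, nonzero_ideal k I2, nonzero_ideal k I3
             & nonzero_ideal k I4],
           [/\ capitulates K2 I1, capitulates K2 I2, capitulates K2 I3
             & capitulates K2 I4],
           [/\ ~ same_class k I1 I2, ~ same_class k I1 I3, ~ same_class k I1 I4,
               ~ same_class k I2 I3
             & [/\ ~ same_class k I2 I4 & ~ same_class k I3 I4]]
         & forall I, nonzero_ideal k I -> capitulates K2 I ->
             [\/ same_class k I I1, same_class k I I2, same_class k I I3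
               | same_class k I I4]]),
    (* ker J_K1 = < [H1], [H2] > *)
    (forall I, nonzero_ideal k I ->
       capitulates K1 I <->
       exists a b : nat,
         same_class k I (ideal_mul k (ideal_pow k H1 a) (ideal_pow k H2 b)))
  & (* ker J_K2 = < [H0 H1], [H0 H2] > *)
    (forall I, nonzero_ideal k I ->
       capitulates K2 I <->
       exists a b : nat,
         same_class k I (ideal_mul k (ideal_pow k (ideal_mul k H0 H1) a)
                                     (ideal_pow k (ideal_mul k H0 H2) b)))].
Proof.
move=> pp pq npq p4 q4 genus ep eq k K1 K2 pi1 pi2 pi3 pi4 P0 E0 P1 E1 P2 E2 P3 E3 P4 E4.
have p2' := p1mod4_gt2 pp p4; have po := p1mod4_odd pp p4.
have q2' := p1mod4_gt2 pq q4; have qo := p1mod4_odd pq q4.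
have eAB : p1%:Z = e ^+ 2 + (2 * f) ^+ 2 by rewrite ep; ring.
have eCD : p2%:Z = g ^+ 2 + (2 * h) ^+ 2 by rewrite eq; ring.
have {}genus : [\/ leg p1 p2%:R = -1 /\ leg p1 2 = -1, leg p1 p2%:R = -1 /\ leg p2 2 = -1
    | leg p1 2 = -1 /\ leg p2 2 = -1].
  have hr := leg_reciprocity pp p4 pq q2' npq qo.
  move: genus; rewrite !legendreE // -hr.
  by case/or3P=> /andP[/eqP -> /eqP ->]; [constructor 1 | constructor 2 | constructor 3].
have giE (a b : int) : a%:~R + 2 * 'i * b%:~R = gi a (2 * b) by rewrite /gi rmorphM /=; ring.
have giE' (a b : int) : a%:~R - 2 * 'i * b%:~R = gi a (- (2 * b)).
  by rewrite /gi rmorphN rmorphM /=; ring.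
have E0' : ideal_mul k H0 H0 = pideal k (gi 1 1).
  by rewrite (ideal_ext_eq E0) /gi mul1r.
have E1' : ideal_mul k H1 H1 = pideal k (gi e (2 * f)) by rewrite (ideal_ext_eq E1) /pi1 giE.
have E2' : ideal_mul k H2 H2 = pideal k (gi e (- (2 * f))) by rewrite (ideal_ext_eq E2) /pi2 giE'.
have E3' : ideal_mul k H3 H3 = pideal k (gi g (2 * h)) by rewrite (ideal_ext_eq E3) /pi3 giE.
have E4' : ideal_mul k H4 H4 = pideal k (gi g (- (2 * h))) by rewrite (ideal_ext_eq E4) /pi4 giE'.
exact: (kernels pp pq npq p4 q4 eAB eCD genus P0 P1 P2 P3 P4 E0' E1' E2' E3' E4').
Qed.
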